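(* Suppose the Markov chain $\Xi$ on $\mathbb X\subseteq\mathbb R$ satisfies $(\mathrm T^{\mathrm{in}}_{\alpha,\beta,c})$ and $(\mathrm D'_{\gamma,b})$, and let $q>0$. Then for all $a$ sufficiently large and all $x$ with $|x|>a$: (i) if $\gamma>\beta-1>1/2$, then $\mathbb E_x[\tau_a^q]<\infty$ for $q<\frac{2\beta-3}{\beta}$ and $=\infty$ for $q>\frac{2\beta-3}{\beta}$; (ii) if $\gamma=\beta-1$ and $b+c\pi\cot(\pi\beta)<0$, then $\mathbb E_x[\tau_a^q]<\infty$ for $q<\nu^\star/\beta$ and $=\infty$ for $q>\nu^\star/\beta$, where $\nu^\star\in(0,\beta)$ is the unique solution of $$\frac bc=\Gamma(\nu^\star)\left(\frac{(1-\beta+\nu^\star)\Gamma(1-\beta)}{\Gamma(2-\beta+\nu^\star)}-\frac{\Gamma(\beta-\nu^\star)}{\Gamma(\beta)}\right);$$ (iii) if $\gamma<\beta-1$ and $b<0$, then $\mathbb E_x[\tau_a^q]<\infty$ for $q<\frac{\beta}{\gamma+1}$ and $=\infty$ for $q\ge\frac{\beta}{\gamma+1}$.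
   Context: $\Xi=(\xi_n)_{n\ge0}$ is a time-homogeneous Markov chain on an infinite, unbounded, measurable $\mathbb X\subseteq\mathbb R$. $\mathbb P_x,\mathbb E_x$ refer to the chain started at $x$; $\theta:=\xi_1-\xi_0$; $y_+:=y\mathbf 1\{y\ge0\}$, $y_-:=-y\mathbf 1\{y<0\}$; $\mu(x):=\mathbb E_x[\theta]$; $\tau_a:=\min\{n\ge0:|\xi_n|\le a\}$; $\Gamma$ is the gamma function. $(\mathrm T^{\mathrm{in}}_{\alpha,\beta,c})$: there exist $\beta\in(1,2)$, $\alpha>\beta$, $c>0$, $x_0\in\mathbb R_+$ with $\lim_{y\to\infty}\sup_{x\ge x_0}|y^\beta\mathbb P_x[\theta_->y]-c|=\lim_{y\to\infty}\sup_{x\le-x_0}|y^\beta\mathbb P_x[\theta_+>y]-c|=0$, $\sup_{x\ge x_0}\mathbb E_x[\theta_+^\alpha]<\infty$, $\sup_{x\le-x_0}\mathbb E_x[\theta_-^\alpha]<\infty$. $(\mathrm D'_{\gamma,b})$: there exist $\gamma\ge0$, $b\in\mathbb R$ with $\lim_{x\to+\infty}x^\gamma\mu(x)=\lim_{x\to-\infty}(-|x|^\gamma\mu(x))=b$. *)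

(* Defs.v *)
From HB Require Import structures.
From mathcomp Require Import all_boot all_order all_algebra.
From mathcomp Require Import all_classical all_reals all_analysis.
Set Implicit Arguments. Unset Strict Implicit. Unset Printing Implicit Defensive.
Import Order.TTheory GRing.Theory Num.Theory.
Import numFieldNormedType.Exports.
Local Open Scope classical_set_scope.
Local Open Scope ring_scope.

Section Defs.
Context {R : realType}.

(* Euler's Gamma function.  For s > 0 it is the integral
   int_0^oo t^(s-1) e^(-t) dt; for s <= 0 it is extended by the functional
   equation Gamma s = Gamma (s+n) / (s (s+1) ... (s+n-1)) with n the least
   natural number such that s + n > 0 (meaningful for non-integer s). *)
Definition Gamma_int (s : R) : R :=
  fine (\int[@lebesgue_measure R]_(t in `[0%R, +oo[) ((t `^ (s - 1)) * expR (- t))%:E)%E.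

Definition Gamma (s : R) : R :=
  let n := if 0 < s then 0%N else (Num.truncn (- s)).+1 in
  Gamma_int (s + n%:R) / \prod_(k < n) (s + k%:R).

(* Finite-dimensional distributions of a Markov chain with transition kernel
   K started at x:  chain_fdd K [:: A_0; ...; A_n] x
     = P_x[xi_0 in A_0, ..., xi_n in A_n]
     = 1_{A_0}(x) int K(x,dy_1) 1_{A_1}(y_1) int ... int K(y_{n-1},dy_n) 1_{A_n}(y_n). *)
Fixpoint chain_fdd (K : R.-pker R ~> R) (As : seq (set R)) (x : R) : \bar R :=
  match As with
  | [::] => 1%E
  | A :: As' => ((\1_A x : R)%:E * \int[K x]_y chain_fdd K As' y)%E
  end.

Definition is_markov_chain (d : measure_display) (Omega : measurableType d)
  (X : set R) (K : R.-pker R ~> R) (P : R -> probability Omega R)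
  (xi : nat -> Omega -> R) : Prop :=
  measurable X /\
  (forall x, X x -> K x X = 1%E) /\
  (forall n, measurable_fun setT (xi n)) /\
  (forall x, X x -> forall As : seq (set R), (forall A, A \in As -> measurable A) ->
      P x [set w | forall i, (i < size As)%N -> nth set0 As i (xi i w)]
      = chain_fdd K As x).

Definition hitting_time (d : measure_display) (Omega : measurableType d)
  (xi : nat -> Omega -> R) (a : R) (w : Omega) : \bar R :=
  ereal_inf [set (n%:R)%:E | n in [set n : nat | `|xi n w| <= a]].

Definition moment_tau (d : measure_display) (Omega : measurableType d)
  (P : R -> probability Omega R) (xi : nat -> Omega -> R) (a q x : R) : \bar R :=
  (\int[P x]_w poweR (hitting_time xi a w) q)%E.

Definition drift (d : measure_display) (Omega : measurableType d)
  (P : R -> probability Omega R) (xi : nat -> Omega -> R) (x : R) : \bar R :=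
  (\int[P x]_w (xi 1%N w - xi 0%N w)%:E)%E.

Definition cond_Tin (d : measure_display) (Omega : measurableType d)
  (X : set R) (P : R -> probability Omega R) (xi : nat -> Omega -> R)
  (alpha beta c : R) : Prop :=
  1 < beta /\ beta < 2 /\ beta < alpha /\ 0 < c /\
  exists x0 : R, 0 <= x0 /\
    (forall eps : R, 0 < eps -> exists Y : R, forall y : R, Y < y ->
       forall x, X x -> x0 <= x ->
         (`| (y `^ beta)%:E * P x [set w | (y < Num.max 0 (- (xi 1%N w - xi 0%N w)))%R]
             - c%:E | <= eps%:E)%E) /\
    (forall eps : R, 0 < eps -> exists Y : R, forall y : R, Y < y ->
       forall x, X x -> x <= - x0 ->
         (`| (y `^ beta)%:E * P x [set w | (y < Num.max 0 (xi 1%N w - xi 0%N w))%R]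
             - c%:E | <= eps%:E)%E) /\
    (exists M : R, forall x, X x -> x0 <= x ->
       (\int[P x]_w ((Num.max 0 (xi 1%N w - xi 0%N w)) `^ alpha)%:E <= M%:E)%E) /\
    (exists M : R, forall x, X x -> x <= - x0 ->
       (\int[P x]_w ((Num.max 0 (- (xi 1%N w - xi 0%N w))) `^ alpha)%:E <= M%:E)%E).

Definition cond_Dprime (d : measure_display) (Omega : measurableType d)
  (X : set R) (P : R -> probability Omega R) (xi : nat -> Omega -> R)
  (gamma b : R) : Prop :=
  0 <= gamma /\
  (forall eps : R, 0 < eps -> exists M : R, forall x, X x -> M < x ->
     exists m : R, drift P xi x = m%:E /\ `| x `^ gamma * m - b | < eps) /\
  (forall eps : R, 0 < eps -> exists M : R, forall x, X x -> x < M ->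
     exists m : R, drift P xi x = m%:E /\ `| - (`|x| `^ gamma * m) - b | < eps).

End Defs.

(* Main.v *)
Require Import Defs.
From HB Require Import structures.
From mathcomp Require Import all_boot all_order all_algebra.
From mathcomp Require Import all_classical all_reals all_analysis.
From mathcomp Require Import measurable_realfun ring lra.
Set Implicit Arguments. Unset Strict Implicit.
Import Order.TTheory GRing.Theory Num.Theory.
Import numFieldNormedType.Exports.
Local Open Scope classical_set_scope.
Local Open Scope ring_scope.

(* Let eta be the jump from x towards the origin and r = |x|.  Since
   |xi_1| = |r - eta|, the increment of |x|^p splits into the drift term and the
   mean of |r - eta|^p - r^p + p r^(p-1) eta = p r^p Phi_p (eta / r).
   Integrating the tail c v^(-beta) of eta against the derivative of Phi_p gives
     E_x |xi_1|^p - |x|^p = p |x|^(p-1) mu_out + (c p J(p) + o(1)) |x|^(p - beta),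
   where mu_out is the outward drift and J(p) is a combination of Beta integrals.
   J is continuous and strictly increasing on (0, beta), tends to +oo at beta, has
   a limit not above pi cot(pi (beta - 1)) at 0 and vanishes at 2 beta - 3;
   the equation of case (ii) is J(nu) = - b / c.
   With P_x[tau_a >= k] written u_k(x):
   - if E_x |xi_1|^p <= |x|^p - eps |x|^(p-s) off a ball, then
     u_k(x) <= (D |x|^s / k)^(p/s), by induction on k;
   - a chain started at distance Z stays out of the ball for a time of order Z^s
     whenever s < beta and s <= gamma + 1;
   - hence, for nu < p < p' < beta, the submartingale
     (|x|^p - a^p) Z^(-p) - |x|^p' Z^(-p') shows that distance Z is reached
     with probability of order Z^(-p); in case (iii) a single jump
     does it with probability of order Z^(-beta). *)

(** * Integrals with a finite value *)

(** The one-step estimate must hold with one radius for all starting points, so it is proved for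
    every law that shares a tail modulus [Y] and a moment bound [M]. For each y > 0 the quotient
    (y^p - 1) / p increases with p, so Phi_p does too, and J inherits strict monotonicity with no
    derivative of Gamma. The cotangent enters only through J near 0, and only its partial fractions
    are needed there. Reaching distance Z with probability of order Z^(-p) and staying for a time of
    order Z^s gives a tail of order k^(-p/s). In cases (i) and (ii) both p > nu and s < beta are
    strict, since the leading drift of |x|^nu vanishes and inward jumps have no moment of order
    beta; the critical q stays undecided. In case (iii) s = gamma + 1 < beta is admissible and a
    single jump costs exactly the order Z^(-beta), so the critical q is included. The subtracted
    power p' keeps the submartingale bounded above: the mean of |x|^p alone could be carried by rare
    large jumps and would say nothing about the probability of reaching Z. *)

Section HasInt.
Context d (T : measurableType d) (R : realType) (m : {measure set T -> \bar R}).
Implicit Types (D : set T) (f g : T -> R) (I J : R).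

(** Integrability is bundled with a real value so that sums, differences and comparisons of
    integrals take place in [R], away from infinite values. *)
Definition hasint D f I : Prop :=
  m.-integrable D (EFin \o f) /\ (\int[m]_(x in D) (f x)%:E = I%:E)%E.

Lemma hasint_integrable D f : measurable D -> m.-integrable D (EFin \o f) ->
  exists I, hasint D f I.
Proof.
move=> mD fi; exists (fine (\int[m]_(x in D) (f x)%:E)%E); split => //.
by rewrite fineK//; exact: integrable_fin_num.
Qed.

Lemma hasint_unique D f I J : hasint D f I -> hasint D f J -> I = J.
Proof. by move=> [_ fI] [_]; rewrite fI => -[]. Qed.

Lemma hasint_measurable D f I : hasint D f I -> measurable_fun D f.
Proof. by move=> [/measurable_int/measurable_EFinP]. Qed.

Lemma eq_hasint D f g I : measurable D -> (forall x, D x -> f x = g x) ->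
  hasint D f I -> hasint D g I.
Proof.
move=> mD fg [fi fI]; split.
  by apply: eq_integrable fi => // x /set_mem Dx /=; rewrite fg.
by rewrite -fI; apply: eq_integral => x /set_mem Dx /=; rewrite fg.
Qed.

Lemma hasintD D f g I J : measurable D -> hasint D f I -> hasint D g J ->
  hasint D (fun x => f x + g x) (I + J).
Proof.
move=> mD [fi fI] [gi gJ]; split.
  by have := integrableD mD fi gi; apply: eq_integrable.
by under eq_integral do rewrite EFinD; rewrite integralD// fI gJ.
Qed.

Lemma hasintZ D k f I : measurable D -> hasint D f I ->
  hasint D (fun x => k * f x) (k * I).
Proof.
move=> mD [fi fI]; split.
  by have := integrableZl mD k fi; apply: eq_integrable.
by under eq_integral do rewrite EFinM; rewrite integralZl// fI.
Qed.

Lemma hasintB D f g I J : measurable D -> hasint D f I -> hasint D g J ->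
  hasint D (fun x => f x - g x) (I - J).
Proof.
move=> mD fI /(hasintZ (-1) mD) gJ; have := hasintD mD fI gJ.
by rewrite mulN1r; apply: eq_hasint => // x _; rewrite mulN1r.
Qed.

Lemma hasint_le D f g I J : measurable D -> hasint D f I -> hasint D g J ->
  (forall x, D x -> f x <= g x) -> I <= J.
Proof.
move=> mD [fi fI] [gi gJ] fg; rewrite -lee_fin -fI -gJ.
by apply: le_integral => // x /set_mem Dx /=; rewrite lee_fin fg.
Qed.

Lemma hasint_dom D f g J : measurable D -> measurable_fun D f ->
  hasint D g J -> (forall x, D x -> `|f x| <= g x) ->
  exists2 I, hasint D f I & `|I| <= J.
Proof.
move=> mD mf gJ fg.
have fi : m.-integrable D (EFin \o f).
  apply: le_integrable gJ.1 => //; first exact/measurable_EFinP.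
  move=> x Dx /=; rewrite lee_fin (le_trans (fg _ Dx))//.
  by rewrite ler_norm.
have [I fI] := hasint_integrable mD fi; exists I => //.
rewrite ler_norml; apply/andP; split.
  rewrite lerNl -mulN1r.
  apply: (hasint_le mD (hasintZ (-1) mD fI) gJ) => x Dx.
  by rewrite mulN1r (le_trans _ (fg _ Dx))// -normrN ler_norm.
by apply: (hasint_le mD fI gJ) => x Dx; rewrite (le_trans _ (fg _ Dx))// ler_norm.
Qed.

Lemma hasint_ge0 D f I : measurable D -> measurable_fun D f ->
  (forall x, D x -> 0 <= f x) -> (\int[m]_(x in D) (f x)%:E = I%:E)%E ->
  hasint D f I.
Proof.
move=> mD mf f0 fI; split => //.
apply/integrableP; split; first exact/measurable_EFinP.
rewrite (_ : (\int[m]_(x in D) _)%E = I%:E) ?ltry// -fI.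
by apply: eq_integral => x /set_mem Dx /=; rewrite ger0_norm// f0.
Qed.

Lemma hasint_ge0_lty D f : measurable D -> measurable_fun D f ->
  (forall x, D x -> 0 <= f x) -> (\int[m]_(x in D) (f x)%:E < +oo)%E ->
  exists2 I, hasint D f I & 0 <= I.
Proof.
move=> mD mf f0 fI.
have f0' : (0 <= \int[m]_(x in D) (f x)%:E)%E.
  by apply: integral_ge0 => x Dx; rewrite lee_fin f0.
exists (fine (\int[m]_(x in D) (f x)%:E)%E); last exact: fine_ge0.
by apply: hasint_ge0 => //; rewrite fineK// ge0_fin_numE.
Qed.

Lemma hasint_nng D f I : hasint D f I -> (forall x, D x -> 0 <= f x) -> 0 <= I.
Proof.
by move=> [_ fI] f0; rewrite -lee_fin -fI; apply: integral_ge0 => x Dx; rewrite lee_fin f0.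
Qed.

Lemma hasint_patch D f I : measurable D ->
  hasint D f I <-> hasint setT (f \_ D) I.
Proof.
move=> mD; have E : (EFin \o f) \_ D = EFin \o (f \_ D).
  by apply/funext => x /=; rewrite !patchE; case: ifP.
split=> -[fi fI]; split.
- by rewrite -E -integrable_mkcond.
- by rewrite -fI [RHS]integral_mkcond -/(EFin \o f) E.
- by rewrite integrable_mkcond// E.
- by rewrite -fI [LHS]integral_mkcond -/(EFin \o f) E.
Qed.

Lemma hasint_setU D1 D2 f I J : measurable D1 -> measurable D2 ->
  (forall x, D1 x -> D2 x -> False) ->
  hasint D1 f I -> hasint D2 f J -> hasint (D1 `|` D2) f (I + J).
Proof.
move=> m1 m2 D12 fI fJ.
have mD : measurable (D1 `|` D2) by exact: measurableU.
apply/hasint_patch => //.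
have := hasintD measurableT ((hasint_patch f I m1).1 fI) ((hasint_patch f J m2).1 fJ).
apply: eq_hasint => // x _.
rewrite !patchE !in_setU.
have [/set_mem x1|] := boolP (x \in D1); have [/set_mem x2|] := boolP (x \in D2) => //=.
- by have := D12 _ x1 x2.
- by rewrite addr0.
- by rewrite add0r.
- by rewrite addr0.
Qed.

Lemma hasint_subset D1 D2 f I : measurable D1 -> measurable D2 -> D2 `<=` D1 ->
  hasint D1 f I -> exists J, hasint D2 f J.
Proof.
move=> m1 m2 D21 [fi _]; apply: hasint_integrable => //.
exact: integrableS fi.
Qed.

Lemma hasint_subset_le D1 D2 f I J : measurable D1 -> measurable D2 ->
  D2 `<=` D1 -> (forall x, D1 x -> 0 <= f x) ->
  hasint D1 f I -> hasint D2 f J -> J <= I.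
Proof.
move=> m1 m2 D21 f0 [fi fI] [_ fJ].
rewrite -lee_fin -fI -fJ; apply: ge0_subset_integral => //.
by apply: measurable_int fi.
Qed.

Lemma hasint_norm D f I : measurable D -> hasint D f I ->
  exists J, hasint D (fun x => `|f x|) J.
Proof.
move=> mD [fi _]; apply: hasint_integrable => //.
exact: integrable_norm.
Qed.

End HasInt.

(** * Fundamental theorem of calculus on open and unbounded intervals *)

Section FTC.
Context (R : realType).
Let mu : {measure set _ -> \bar R} := @lebesgue_measure R.
Implicit Types (D : set R) (f F : R -> R) (a b x y A B : R).

Lemma cvg_harmonicM (h : R) : h * n.+1%:R^-1 @[n --> \oo] --> (0 : R).
Proof.
rewrite -[X in _ --> X](mulr0 h); apply: cvgM; first exact: cvg_cst.
exact: cvg_harmonic.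
Qed.

Lemma cvg_at_right_harmonic F a h A : 0 < h -> F x @[x --> a^'+] --> A ->
  F (a + h * n.+1%:R^-1) @[n --> \oo] --> A.
Proof.
move=> h0 /cvg_at_rightP; apply; split=> [n|].
  by rewrite ltrDl mulr_gt0.
rewrite -[X in _ --> X]addr0; apply: cvgD; first exact: cvg_cst.
exact: cvg_harmonicM.
Qed.

Lemma cvg_at_left_harmonic F a h A : 0 < h -> F x @[x --> a^'-] --> A ->
  F (a - h * n.+1%:R^-1) @[n --> \oo] --> A.
Proof.
move=> h0 /cvg_at_leftP; apply; split=> [n|].
  by rewrite ltrBlDr ltrDl mulr_gt0.
rewrite -[X in _ --> X]subr0; apply: cvgB; first exact: cvg_cst.
exact: cvg_harmonicM.
Qed.

Section exhaustion.
Variables (D : set R) (a_ b_ : nat -> R) (f F : R -> R) (A B : R).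
Hypothesis an : forall n, a_ n.+1 <= a_ n.
Hypothesis bn : forall n, b_ n <= b_ n.+1.
Hypothesis ab : forall n, a_ n < b_ n.
Hypothesis DE : D = \bigcup_n `[a_ n, b_ n]%classic.
Hypothesis cf : forall x, D x -> {for x, continuous f}.
Hypothesis dF : forall x, D x -> is_derive x 1 F (f x).
Hypothesis FA : F (a_ n) @[n --> \oo] --> A.
Hypothesis FB : F (b_ n) @[n --> \oo] --> B.

Let D_ n := `[a_ n, b_ n]%classic.

Let nd_D : {homo D_ : n m / (n <= m)%N >-> (n <= m)%O}.
Proof.
apply: homo_leq => [?|? ? ?|n]; [exact: lexx|exact: le_trans|].
apply/subsetPset => x; rewrite /D_ /= !in_itv/= => /andP[ax xb].
by rewrite (le_trans _ ax)//= (le_trans xb).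
Qed.

Let D_D n : D_ n `<=` D.
Proof. by rewrite DE => x Dx; exists n. Qed.

Let mD : measurable D.
Proof. by rewrite DE; apply: bigcup_measurable => n _; exact: measurable_itv. Qed.

Let int_D n : (\int[mu]_(x in D_ n) (f x)%:E = (F (b_ n) - F (a_ n))%:E)%E.
Proof.
rewrite EFinB; apply: continuous_FTC2 => //.
- apply: continuous_in_subspaceT => x /set_mem/D_D; exact: cf.
- have dF' x : D_ n x -> derivable F x 1.
    by move=> /D_D/dF ?; exact: ex_derive.
  have ca : D_ n (a_ n) by rewrite /D_/= in_itv/= lexx ltW.
  have cb : D_ n (b_ n) by rewrite /D_/= in_itv/= lexx ltW.
  split.
  + move=> x; rewrite in_itv/= => /andP[ax xb]; apply: dF'.
    by rewrite /D_/= in_itv/= !ltW.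
  + apply: cvg_at_right_filter; apply: differentiable_continuous.
    by apply/derivable1_diffP; exact: dF'.
  + apply: cvg_at_left_filter; apply: differentiable_continuous.
    by apply/derivable1_diffP; exact: dF'.
- move=> x; rewrite in_itv/= => /andP[ax xb].
  have /D_D/dF ? : D_ n x by rewrite /D_/= in_itv/= !ltW.
  by rewrite derive1E derive_val.
Qed.

Let int_cvg : (\int[mu]_(x in D_ n) (f x)%:E)%E @[n --> \oo] --> (B - A)%:E.
Proof.
under eq_fun do rewrite int_D.
by apply: cvg_EFin; [exact: nearW|exact: cvgB].
Qed.

Let mf : measurable_fun D f.
Proof.
rewrite DE; apply/measurable_fun_bigcup => [n|n]; first exact: measurable_itv.
apply: subspace_continuous_measurable_fun; first exact: measurable_itv.
by apply: continuous_in_subspaceT => x /set_mem/D_D; exact: cf.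
Qed.

(** On each compact piece the integral is F (b_n) - F (a_n), and monotone convergence passes to the
    union, so integrability is a conclusion here. *)
Lemma ge0_FTC_exhaust : (forall x, D x -> 0 <= f x) -> hasint mu D f (B - A).
Proof.
move=> f0; apply: hasint_ge0 => //.
have mDn i : measurable (D_ i) by exact: measurable_itv.
have := @ge0_nondecreasing_set_cvg_integral _ (measurableTypeR R) R D_ (EFin \o f) mu nd_D mDn.
move=> H; apply: (cvg_unique _ _ int_cvg) => //.
rewrite DE; apply: H.
- move=> i; apply/measurable_EFinP; exact: measurable_funS mf.
- by move=> i x /D_D Dx; rewrite lee_fin f0.
Qed.

(** For [f] of either sign monotone convergence is replaced by dominated convergence with |f| as the
    dominating function. *)
Lemma integrable_FTC_exhaust : mu.-integrable D (EFin \o f) ->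
  hasint mu D f (B - A).
Proof.
move=> fi; split => //.
pose f_ n := (EFin \o f) \_ (D_ n).
have mDn i : measurable (D_ i) by exact: measurable_itv.
have mf_ n : measurable_fun D (f_ n).
  apply: (@measurable_funS _ _ _ _ setT) => //.
  apply/(measurable_restrictT _ (mDn n)); apply/measurable_EFinP.
  exact: measurable_funS mf.
have f1 : {ae mu, forall x, D x -> f_ ^~ x @ \oo --> (EFin \o f) x}.
  apply: aeW => x; rewrite {1}DE => -[n _ Dnx].
  apply: cvg_near_cst; exists n => // k /= nk; rewrite /f_ patchE mem_set//.
  by have /subsetPset := nd_D nk; exact.
have f2 : {ae mu, forall x n, D x -> (`|f_ n x| <= (abse \o (EFin \o f)) x)%E}.
  apply: aeW => x n Dx; rewrite /f_ patchE.
  by case: ifP => //= _; rewrite normr0 lee_fin.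
have [_ _ H] := @dominated_convergence _ (measurableTypeR R) R mu D mD f_ (EFin \o f)
   (abse \o (EFin \o f)) mf_ (measurable_int mu fi) f1 (integrable_abse fi) f2.
have {}H : (\int[mu]_(x in D_ n) (f x)%:E)%E @[n --> \oo] -->
    (\int[mu]_(x in D) (f x)%:E)%E.
  apply: cvg_trans H; apply: near_eq_cvg; apply: nearW => n /=.
  rewrite /f_ -integral_mkcondr; congr (integral mu _ _).
  by rewrite setIidr//; exact: D_D.
exact: (cvg_unique _ H int_cvg).
Qed.

End exhaustion.

(** One third of the length keeps the left end point below the right one already at n = 0. *)
Lemma itvoo_bigcup a b : a < b ->
  `]a, b[%classic = \bigcup_n `[a + (b - a) / 3 * n.+1%:R^-1, b - (b - a) / 3 * n.+1%:R^-1]%classic.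
Proof.
move=> ab; set h := (b - a) / 3; have h0 : 0 < h by rewrite divr_gt0 ?subr_gt0.
clearbody h; apply/seteqP; split=> x /=; rewrite ?in_itv/=.
  move=> /andP[ax xb].
  have xa0 : 0 < (x - a) / h by rewrite divr_gt0 ?subr_gt0.
  have bx0 : 0 < (b - x) / h by rewrite divr_gt0 ?subr_gt0.
  have e0 : 0 < Num.min ((x - a) / h) ((b - x) / h) by rewrite lt_min xa0 bx0.
  have /cvgrPdist_lt/(_ _ e0)[N _ HN] := @cvg_harmonic R.
  have := HN N (leqnn _); rewrite /= sub0r normrN ger0_norm ?invr_ge0//.
  rewrite lt_min !ltr_pdivlMr// => /andP[h1 h2]; exists N => //=.
  by rewrite in_itv/= (mulrC h) -lerBrDl (ltW h1)/= lerBrDl -lerBrDr ltW.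
move=> [n _]; rewrite /= in_itv/= => /andP[h1 h2].
have hn : 0 < h * n.+1%:R^-1 by rewrite mulr_gt0.
by move: (h / _) hn h1 h2 => e e0 h1 h2; apply/andP; split; lra.
Qed.

Section itvoo.
Variables (a b : R) (f F : R -> R) (A B : R).
Hypothesis ab : a < b.
Hypothesis cf : forall x, a < x < b -> {for x, continuous f}.
Hypothesis dF : forall x, a < x < b -> is_derive x 1 F (f x).
Hypothesis FA : F x @[x --> a^'+] --> A.
Hypothesis FB : F x @[x --> b^'-] --> B.

Let h := (b - a) / 3.
Let h0 : 0 < h. Proof. by rewrite divr_gt0 ?subr_gt0. Qed.

Let hle n : h * n.+2%:R^-1 <= h * n.+1%:R^-1.
Proof. by rewrite ler_pM2l// lef_pV2 ?posrE// ler_nat. Qed.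

Let hab n : a + h * n.+1%:R^-1 < b - h * n.+1%:R^-1.
Proof.
have : h * n.+1%:R^-1 <= h.
  by rewrite ger_pMr// invf_le1// ler1n.
have : b = a + 3 * h by rewrite /h; field.
by move: (h / _) h0; move: h => k e; lra.
Qed.

Lemma ge0_FTC_oo : (forall x, a < x < b -> 0 <= f x) ->
  hasint mu `]a, b[ f (B - A).
Proof.
move=> f0; apply: (@ge0_FTC_exhaust _ (fun n => a + h * n.+1%:R^-1)
  (fun n => b - h * n.+1%:R^-1) f F).
- by move=> n; rewrite lerD2l.
- by move=> n; rewrite lerD2l lerN2.
- exact: hab.
- exact: itvoo_bigcup.
- by move=> x; rewrite /= in_itv/=; exact: cf.
- exact: cvg_at_right_harmonic.
- exact: cvg_at_left_harmonic.
- by move=> x; rewrite /= in_itv/=; exact: f0.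
Qed.

Lemma integrable_FTC_oo : mu.-integrable `]a, b[ (EFin \o f) ->
  hasint mu `]a, b[ f (B - A).
Proof.
move=> fi; apply: (@integrable_FTC_exhaust _ (fun n => a + h * n.+1%:R^-1)
  (fun n => b - h * n.+1%:R^-1) f F) => //.
- by move=> n; rewrite lerD2l.
- by move=> n; rewrite lerD2l lerN2.
- exact: itvoo_bigcup.
- exact: cvg_at_right_harmonic.
- exact: cvg_at_left_harmonic.
Qed.

End itvoo.

Lemma ge0_FTC_oy a f F A B :
  (forall x, a < x -> {for x, continuous f}) ->
  (forall x, a < x -> is_derive x 1 F (f x)) ->
  F x @[x --> a^'+] --> A -> F x @[x --> +oo] --> B ->
  (forall x, a < x -> 0 <= f x) -> hasint mu `]a, +oo[ f (B - A).
Proof.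
move=> cf dF FA FB f0.
apply: (@ge0_FTC_exhaust _ (fun n => a + 1 * n.+1%:R^-1)
  (fun n => a + n.+2%:R) f F).
- by move=> n; rewrite lerD2l !mul1r lef_pV2 ?posrE// ler_nat.
- by move=> n; rewrite lerD2l ler_nat.
- move=> n; rewrite ltrD2l mul1r (@le_lt_trans _ _ 1) ?ltr1n//.
  by rewrite invf_le1// ler1n.
- apply/seteqP; split=> x /=; rewrite ?in_itv/= ?andbT.
    move=> ax; have xa0 : 0 < x - a by rewrite subr_gt0.
    have /cvgrPdist_lt/(_ _ xa0)[N _ HN] := @cvg_harmonic R.
    (* [N] places x to the right of the shrinking left end point, the truncation to the left of the
       growing right one. *)
    exists (N + Num.truncn (x - a))%N => //=; rewrite in_itv/= mul1r.
    have h := HN (N + Num.truncn (x - a))%N (leq_addr _ _).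
    move: h; rewrite /= sub0r normrN ger0_norm ?invr_ge0// => h.
    rewrite -lerBrDl (ltW h)//= -lerBlDl.
    by apply: (le_trans (ltW (truncnS_gt _))); rewrite ler_nat ltnS leqW// leq_addl.
  move=> [n _]; rewrite /= in_itv/= => /andP[+ _]; apply: lt_le_trans.
  by rewrite ltrDl mul1r.
- by move=> x; rewrite /= in_itv/= andbT; exact: cf.
- by move=> x; rewrite /= in_itv/= andbT; exact: dF.
- exact: cvg_at_right_harmonic.
- move/cvg_pinftyP : FB; apply; apply/cvgryPge => M.
  exists (Num.truncn (M - a)) => // n /= Mn.
  by rewrite -lerBlDl; apply: (le_trans (ltW (truncnS_gt _))); rewrite ler_nat ltnS leqW.
- by move=> x; rewrite /= in_itv/= andbT; exact: f0.
Qed.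

End FTC.

(** * Affine change of variables for Lebesgue measure *)

Section affine.
Context (R : realType).
Let mu : {measure set _ -> \bar R} := @lebesgue_measure R.

(** Lebesgue measure and k times its image under x |-> k x + a agree on half-open intervals, hence
    everywhere. Integrals over a subset enter through functions extended by 0. *)
Lemma ge0_integral_affine (k a : R) (f : R -> \bar R) : 0 < k ->
  measurable_fun setT f -> (forall x, 0 <= f x)%E ->
  (\int[mu]_x f x = k%:E * \int[mu]_x f (k * x + a)%R)%E.
Proof.
move=> k0 mf f0.
pose phi : measurableTypeR R -> measurableTypeR R := fun x => k * x + a.
have mphi : measurable_fun setT phi.
  by apply: measurable_funD => //; apply: measurable_funM.
pose kn : {nonneg R} := NngNum (ltW k0).
pose m' := mscale kn (pushforward mu phi); pose m := m' mphi.
have E A : measurable A -> mu A = m A.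
  apply: lebesgue_measure_unique => _ [[b c] _ <-].
  transitivity (k%:E * mu (phi @^-1` `]b, c]%classic))%E; last by [].
  have -> : phi @^-1` `]b, c]%classic = `](b - a) / k, (c - a) / k]%classic.
    apply/seteqP; split => x; rewrite /phi /= !in_itv/=;
    by rewrite ltr_pdivrMr// ler_pdivlMr// (mulrC x) ltrBlDr lerBrDr.
  rewrite /mu /= !lebesgue_measure_itv/= !lte_fin ltr_pM2r ?invr_gt0// ltrD2r.
  case: ifP => _; last by rewrite mule0.
  by rewrite -!EFinB -EFinM; congr EFin; field; rewrite gt_eqF.
rewrite (eq_measure_integral m); last by move=> A mA _; exact: E.
rewrite ge0_integral_mscale//; congr (_ * _)%E.
by rewrite ge0_integral_pushforward.
Qed.

End affine.

(** * Gamma and Beta integrals *)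

Lemma measurable_fun_powR d (T : measurableType d) (R : realType) (D : set T)
    (f : T -> R) (p : R) :
  measurable_fun D f -> measurable_fun D (fun x => f x `^ p).
Proof. by move=> mf; apply: (measurableT_comp (measurable_powR p)). Qed.

Lemma itv0y_setU (R : realType) :
  `]0, +oo[%classic = `]0, 1[%classic `|` `[1, +oo[%classic :> set R.
Proof.
apply/seteqP; split=> x /=; rewrite !in_itv/= !andbT.
  by move=> x0; have [x1|x1] := ltP x 1; [left; rewrite x0|right].
by move=> [/andP[]//|]; apply: lt_le_trans.
Qed.

(** The unknown integral may be infinite a priori; the identity itself excludes this, because k
    times +oo is not real. The Beta integrals are thus evaluated without a separate proof that they
    converge. *)
Lemma EFin_eq_div (R : realFieldType) (c k : R) (x : \bar R) : 0 < k ->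
  (0 <= x -> c%:E = k%:E * x -> x = (c / k)%:E)%E.
Proof.
move=> k0; case: x => [r|_|//].
  by move=> _; rewrite -EFinM => -[->]; congr EFin; field; rewrite gt_eqF.
by rewrite gt0_muley ?lte_fin.
Qed.

Section GammaBeta.
Context (R : realType).
Let mu : {measure set _ -> \bar R} := @lebesgue_measure R.
Implicit Types (a b s t u v w : R).

Lemma lebesgue_tonelli (f : R * R -> \bar R) :
  measurable_fun setT f -> (forall z, 0 <= f z)%E ->
  (\int[mu]_x \int[mu]_y f (x, y) = \int[mu]_y \int[mu]_x f (x, y))%E.
Proof.
move=> mf f0.
exact: (@fubini_tonelli _ _ (measurableTypeR R) (measurableTypeR R) R
  lebesgue_measure lebesgue_measure f mf f0).
Qed.

Definition gammaf a t : R := t `^ (a - 1) * expR (- t).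

Lemma measurable_gammaf a : measurable_fun setT (gammaf a).
Proof.
apply: measurable_funM; first exact: measurable_powR.
by apply: measurableT_comp => //; exact: oppr_measurable.
Qed.

Lemma gammaf_ge0 a t : 0 <= gammaf a t.
Proof. by rewrite mulr_ge0 ?powR_ge0 ?expR_ge0. Qed.

Lemma is_derive_cvg (f : R -> R) (x l : R) : is_derive x 1 f l ->
  f y @[y --> x] --> f x.
Proof.
move=> h; have : {for x, continuous f}; last by [].
by apply: differentiable_continuous; apply/derivable1_diffP; exact: ex_derive.
Qed.

Lemma continuous_powR_gt0 a t : 0 < t -> {for t, continuous (fun x : R => x `^ a)}.
Proof.
move=> t0; apply: differentiable_continuous; apply/derivable1_diffP.
by apply: derivable_powR; rewrite in_itv/= t0.
Qed.

Lemma cvg_powR1 a : (x : R) `^ a @[x --> (1 : R)] --> (1 : R).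
Proof.
by have := @continuous_powR_gt0 a 1 ltr01; rewrite /prop_for /continuous_at powR1.
Qed.

Lemma hasint_powR0 (s u : R) : 0 < s -> 0 < u ->
  hasint mu `]0, u[ (fun v => s * v `^ (s - 1)) (u `^ s).
Proof.
move=> s0 u0; rewrite -[u `^ s]subr0.
apply: (@ge0_FTC_oo _ _ _ _ (fun t => t `^ s)).
- exact: u0.
- by move=> x /andP[x0 _]; apply: cvgM; [exact: cvg_cst|exact: continuous_powR_gt0].
- by move=> x /andP[x0 _]; exact: is_derive1_powR.
- exact: powR_cvg0.
- apply: cvg_at_left_filter; exact: continuous_powR_gt0.
- by move=> x _; rewrite mulr_ge0 ?powR_ge0 ?(ltW s0).
Qed.

Lemma hasint_powR01 a : 0 < a -> hasint mu `]0, 1[ (fun t => t `^ (a - 1)) a^-1.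
Proof.
move=> a0.
have mD : measurable (`]0, 1[%classic : set (measurableTypeR R)) by exact: measurable_itv.
have := hasintZ a^-1 mD (hasint_powR0 a0 ltr01); rewrite powR1 mulr1.
by apply: eq_hasint => // t _; rewrite mulKf// gt_eqF.
Qed.

Lemma cvg_powRNy a : a < 0 -> (t : R) `^ a @[t --> +oo] --> (0 : R).
Proof.
move=> a0; apply/cvgrPdist_lt => e e0.
exists (e `^ a^-1); split => [|t et]; first exact: num_real.
have t0 : 0 < t by rewrite (lt_trans _ et)// powR_gt0.
rewrite sub0r normrN ger0_norm ?powR_ge0// -[a]opprK powRN invf_plt ?posrE ?powR_gt0//.
have : (e `^ a^-1) `^ (- a) < t `^ (- a).
  by apply: gt0_ltr_powR; rewrite ?oppr_gt0 ?nnegrE ?powR_ge0// ltW.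
by rewrite -powRrM mulrN mulVf ?lt_eqF// powR_inv1// ltW.
Qed.

Lemma hasint_powR_tail (beta v : R) : 0 < beta -> 0 < v ->
  hasint mu `]v, +oo[ (fun u => beta * u `^ (- beta - 1)) (v `^ (- beta)).
Proof.
move=> b0 v0; have -> : v `^ (- beta) = 0 - (- v `^ (- beta)) by rewrite sub0r opprK.
have dF (x : R) : 0 < x -> is_derive x 1 (fun u : R => - u `^ (- beta)) (beta * x `^ (- beta - 1)).
  move=> x0; have d1 := is_derive1_powR (- beta) x0.
  by apply: is_derive_eq; ring.
apply: (@ge0_FTC_oy _ v _ (fun u => - u `^ (- beta))).
- move=> x vx; apply: cvgM; first exact: cvg_cst.
  by apply: continuous_powR_gt0; exact: lt_trans vx.
- by move=> x vx; apply: dF; exact: lt_trans vx.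
- by apply: cvg_at_right_filter; apply: (is_derive_cvg (dF _ v0)).
- by rewrite -[X in _ --> X]oppr0; apply: cvgN; apply: cvg_powRNy; rewrite oppr_lt0.
- by move=> x vx; rewrite mulr_ge0 ?powR_ge0 ?ltW.
Qed.

Lemma hasint_powR1y a : a < 0 ->
  hasint mu `]1, +oo[ (fun t => t `^ (a - 1)) (- a^-1).
Proof.
move=> a0; have b0 : 0 < - a by rewrite oppr_gt0.
have mD : measurable (`]1, +oo[%classic : set (measurableTypeR R)) by exact: measurable_itv.
have := hasintZ (- a)^-1 mD (hasint_powR_tail b0 ltr01); rewrite powR1 mulr1 invrN.
by apply: eq_hasint => // t _; rewrite opprK -invrN mulKf// gt_eqF.
Qed.

Lemma hasint_expRN (k : R) : 0 < k ->
  hasint mu `]1, +oo[ (fun t => expR (- k * t)) (k^-1 * expR (- k)).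
Proof.
move=> k0; rewrite -[k^-1 * _]opprK -[- - _]sub0r -mulNr.
have E : - k^-1 * expR (- k) = (fun t : R => - k^-1 * expR (- k * t)) 1.
  by rewrite /= mulr1.
have dF (x : R) : is_derive x 1 (fun t : R => - k^-1 * expR (- k * t)) (expR (- k * x)).
  apply: is_derive_eq; rewrite /GRing.scale/=; field; rewrite gt_eqF//.
rewrite E; apply: ge0_FTC_oy => //.
- move=> x _; apply: continuous_comp; last exact: continuous_expR.
  by apply: cvgM; [exact: cvg_cst|exact: cvg_id].
- exact: cvg_at_right_filter (is_derive_cvg (dF 1)).
- rewrite -[X in _ --> X](mulr0 (- k^-1)); apply: cvgM; first exact: cvg_cst.
  apply/cvgrPdist_lt => e e0.
  exists (- ln e / k); split => [|t et]; first exact: num_real.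
  rewrite sub0r normrN ger0_norm ?expR_ge0// -[ltRHS]lnK ?posrE// ltr_expR.
  by move: et; rewrite ltr_pdivrMr// mulNr (mulrC k) ltrNl.
Qed.

(** With K = |a| + 1, the inequality t / (2 K) <= exp (t / (2 K)) is raised to the power K. *)
Lemma powR_le_expR a t : 1 <= t -> t `^ (a - 1) <= (2 * (`|a| + 1)) `^ (`|a| + 1) * expR (t / 2).
Proof.
move=> t1; have [K aK K0] : exists2 K : R, K = `|a| + 1 & 0 < K.
  by exists (`|a| + 1) => //; rewrite ltr_wpDl.
rewrite -aK; apply: (@le_trans _ _ (t `^ K)).
  by apply: ler_powR => //; rewrite aK; have := ler_norm a; lra.
have -> : expR (t / 2) = expR (t / (2 * K)) `^ K.
  by rewrite -expRM; congr expR; field; rewrite gt_eqF.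
rewrite -powRM ?expR_ge0 ?mulr_ge0//; last exact: ltW.
apply: ge0_ler_powR; rewrite ?nnegrE; rewrite ?mulr_ge0 ?expR_ge0//; try lra.
rewrite -ler_pdivrMl; last lra.
by rewrite mulrC (le_trans _ (expR_ge1Dx _))// lerDr ler01.
Qed.

Lemma gammaf_hasint_lty a : 0 < a ->
  exists2 G, hasint mu `]0, +oo[ (gammaf a) G & 0 < G.
Proof.
move=> a0.
have m1 : measurable (`]0, 1[%classic : set (measurableTypeR R)) by exact: measurable_itv.
have m2 : measurable (`[1, +oo[%classic : set (measurableTypeR R)) by exact: measurable_itv.
have [I1 I1E _] : exists2 I, hasint mu `]0, 1[ (gammaf a) I & `|I| <= a^-1.
  apply: (hasint_dom _ _ (hasint_powR01 a0)) => //.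
    exact: measurable_funTS (measurable_gammaf a).
  move=> x /=; rewrite in_itv/= => /andP[x0 x1].
  by rewrite ger0_norm ?gammaf_ge0// ler_piMr ?powR_ge0// -expR0 ler_expR oppr_le0 ltW.
have I1pos : 0 < I1.
  (* On ]0, 1[ the factor exp (-t) is at least exp (-1); this gives strict positivity, which later
     permits division by Gamma. *)
  apply: (@lt_le_trans _ _ (expR (- 1) * a^-1)); first by rewrite mulr_gt0 ?expR_gt0 ?invr_gt0.
  have h1 := hasintZ (expR (-1)) m1 (hasint_powR01 a0).
  apply: (hasint_le m1 h1 I1E).
  move=> x /=; rewrite in_itv/= => /andP[x0 x1].
  by rewrite mulrC ler_wpM2l ?powR_ge0// ler_expR lerN2 ltW.
have [I2 I2E I20] : exists2 I, hasint mu `[1, +oo[ (gammaf a) I & 0 <= I.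
  apply: hasint_ge0_lty => //.
  - exact: measurable_funTS (measurable_gammaf a).
  - by move=> x _; exact: gammaf_ge0.
  rewrite -integral_itv_obnd_cbnd; last first.
    by apply/measurable_EFinP; exact: measurable_funTS (measurable_gammaf a).
  have k0 : 0 < 2^-1 :> R by [].
  have m3 : measurable (`]1, +oo[%classic : set (measurableTypeR R)) by exact: measurable_itv.
  have := hasintZ ((2 * (`|a| + 1)) `^ (`|a| + 1)) m3 (hasint_expRN k0) => h3.
  have [||I [_ hI] _] := @hasint_dom _ _ _ mu `]1, +oo[ (gammaf a) _ _ m3 _ h3.
  - exact: measurable_funTS (measurable_gammaf a).
  - move=> x /=; rewrite in_itv/= andbT => x1.
    rewrite ger0_norm ?gammaf_ge0// /gammaf.
    have -> : expR (- 2^-1 * x) = expR (x / 2) * expR (- x).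
      by rewrite -expRD; congr expR; field.
    by rewrite mulrA ler_wpM2r ?expR_ge0// powR_le_expR// ltW.
  by apply: (@le_lt_trans _ _ I%:E); [rewrite -hI|rewrite ltry].
exists (I1 + I2); last by rewrite ltr_pwDl.
rewrite itv0y_setU; apply: hasint_setU => // x /=; rewrite !in_itv/= => /andP[_ x1].
by rewrite andbT leNgt x1.
Qed.

Lemma Gamma_pos_int a : 0 < a -> Gamma a = Gamma_int a.
Proof. by move=> a0; rewrite /Gamma a0 addr0 big_ord0 divr1. Qed.

Lemma hasint_Gamma a : 0 < a -> hasint mu `]0, +oo[ (gammaf a) (Gamma a).
Proof.
move=> a0; have [G h _] := gammaf_hasint_lty a0; split; first exact: h.1.
rewrite Gamma_pos_int// /Gamma_int -integral_itv_obnd_cbnd; last first.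
  by apply/measurable_EFinP; exact: measurable_funTS (measurable_gammaf a).
by have [_ E] := h; rewrite E.
Qed.

Lemma Gamma_gt0 a : 0 < a -> 0 < Gamma a.
Proof.
move=> a0; have [G h G0] := gammaf_hasint_lty a0.
by rewrite (hasint_unique (hasint_Gamma a0) h).
Qed.

Lemma Gamma1 : Gamma 1 = 1 :> R.
Proof.
have h1 : hasint mu `]0, +oo[ (gammaf 1) 1.
  rewrite [X in hasint _ _ _ X](_ : _ = 0 - (- 1)); last by rewrite sub0r opprK.
  have dF (x : R) : is_derive x 1 (fun t : R => - expR (- t)) (expR (- x)).
    by apply: is_derive_eq; rewrite /GRing.scale/=; ring.
  apply: (@eq_hasint _ _ _ mu _ (fun t => expR (- t))); first exact: measurable_itv.
    by move=> x _; rewrite /gammaf subrr powRr0 mul1r.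
  apply: (@ge0_FTC_oy _ _ _ (fun t => - expR (- t))).
  - move=> x _; apply: continuous_comp; last exact: continuous_expR.
    exact: opp_continuous.
  - have := is_derive_cvg (dF 0); rewrite oppr0 expR0.
    exact: cvg_at_right_filter.
  - rewrite -[X in _ --> X]oppr0; apply: cvgN; exact: cvgr_expR.
  - by move=> x _; exact: expR_ge0.
exact: hasint_unique (hasint_Gamma ltr01) h1.
Qed.

Let D0 : set (measurableTypeR R) := `]0, +oo[%classic.
Let D01 : set (measurableTypeR R) := `]0, 1[%classic.
Let mD0 : measurable D0. Proof. exact: measurable_itv. Qed.
Let mD01 : measurable D01. Proof. exact: measurable_itv. Qed.

(** Extension by 0 to the whole line, so that Tonelli and the affine substitution apply without
    tracking domains. *)
Let g a : R -> R := gammaf a \_ D0.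

Let gE a t : g a t = if 0 < t then gammaf a t else 0.
Proof. by rewrite /g patchE mem_setE /D0 in_itv/= andbT. Qed.

Let mg a : measurable_fun setT (g a).
Proof.
by apply/(measurable_restrictT _ mD0); exact: measurable_funTS (measurable_gammaf a).
Qed.

Let mgE a : measurable_fun setT (fun x => (g a x)%:E).
Proof. by apply/measurable_EFinP; exact: mg. Qed.

Let mgEc a (k : R) : measurable_fun setT (fun x : R => (g a (k * x + 0))%:E).
Proof.
apply/measurable_EFinP; apply: (measurableT_comp (mg a)).
by apply: measurable_funD => //; apply: measurable_funM.
Qed.

Let g0 a t : 0 <= g a t.
Proof. by rewrite gE; case: ifP => // _; exact: gammaf_ge0. Qed.

Let int_g a : 0 < a -> (\int[mu]_t (g a t)%:E = (Gamma a)%:E)%E.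
Proof. by move=> a0; have [_] := (hasint_patch mu (gammaf a) (Gamma a) mD0).1 (hasint_Gamma a0). Qed.

Lemma gammafM a s t : 0 <= s -> 0 <= t -> gammaf a (s * t) = s `^ (a - 1) * t `^ (a - 1) * expR (- (s * t)).
Proof. by move=> s0 t0; rewrite /gammaf powRM. Qed.

(** Gamma a * Gamma b is a double integral. Putting s = t v in the first factor and exchanging the
    order leaves, for fixed v, a Gamma (a + b) integral with exponential rate 1 + v. *)
Lemma hasint_BetaNy a b : 0 < a -> 0 < b ->
  hasint mu `]0, +oo[ (fun v => v `^ (a - 1) * (1 + v) `^ (- (a + b)))
    (Gamma a * Gamma b / Gamma (a + b)).
Proof.
move=> a0 b0; have ab0 : 0 < a + b by rewrite addr_gt0.
pose h v : R := v `^ (a - 1) * (1 + v) `^ (- (a + b)).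
have mh : measurable_fun setT h.
  apply: measurable_funM; first exact: measurable_powR.
  by apply: measurable_fun_powR; exact: measurable_funD.
have h0 v : 0 <= h v by rewrite mulr_ge0 ?powR_ge0.
apply: hasint_ge0 => //; [exact: measurable_funTS mh|by move=> v _; exact: h0|].
have G0 := Gamma_gt0 ab0.
apply: EFin_eq_div => //; first by apply: integral_ge0 => v _; rewrite lee_fin h0.
transitivity ((Gamma (a + b))%:E * \int[mu]_(v in D0) (h v)%:E)%E; last by [].
pose f (z : R * R) : \bar R := (g b z.1 * (z.1 * g a (z.1 * z.2)))%:E.
have mf : measurable_fun setT f.
  apply/measurable_EFinP; apply: measurable_funM.
    exact: measurableT_comp (mg b) measurable_fst.
  apply: measurable_funM; first exact: measurable_fst.
  by apply: measurableT_comp (mg a) _; apply: measurable_funM.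
have f0 z : (0 <= f z)%E.
  rewrite lee_fin gE; case: ifPn => z0; last by rewrite mul0r.
  by apply: mulr_ge0; [exact: gammaf_ge0|apply: mulr_ge0; [exact: ltW|exact: g0]].
transitivity (\int[mu]_t \int[mu]_v f (t, v))%E.
  rewrite EFinM muleC -[X in (X * _)%E](int_g b0) -ge0_integralZr//; last 3 first.
  - exact: mgE.
  - by move=> x _; rewrite lee_fin.
  - by rewrite lee_fin ltW// Gamma_gt0.
  apply: eq_integral => t _; rewrite /f /=.
  rewrite gE; case: ifPn => t0; last first.
    by rewrite mul0e integral0_eq// => v _; rewrite mul0r.
  rewrite -(int_g a0) (ge0_integral_affine 0 t0); last 2 first.
  - exact: mgE.
  - by move=> x; rewrite lee_fin.
  rewrite muleA -ge0_integralZl//; last 3 first.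
  - exact: mgEc.
  - by move=> x _; rewrite lee_fin.
  - by rewrite -EFinM lee_fin mulr_ge0 ?gammaf_ge0// ltW.
  by apply: eq_integral => v _; rewrite addr0 -!EFinM mulrA.
rewrite lebesgue_tonelli//.
transitivity (\int[mu]_v ((Gamma (a + b))%:E * ((h \_ D0) v)%:E))%E; last first.
  rewrite ge0_integralZl//; last 3 first.
  - by apply/measurable_EFinP; apply/(measurable_restrictT _ mD0); exact: measurable_funTS mh.
  - by move=> x _; rewrite lee_fin patchE; case: ifP.
  - by rewrite lee_fin ltW.
  by congr (_ * _)%E; rewrite [RHS]integral_mkcond restrict_EFin.
apply: eq_integral => v _; rewrite /f /=.
rewrite patchE mem_setE /D0 in_itv/= andbT; case: ifPn => v0; last first.
  rewrite mule0 integral0_eq// => t _; rewrite gE; case: ifPn => t0; last by rewrite mul0r.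
  by rewrite gE pmulr_rgt0// (negbTE v0) !mulr0.
have v1 : 0 < 1 + v by rewrite addr_gt0.
rewrite -(int_g ab0) [X in _ = (X * _)%E](ge0_integral_affine 0 v1); last 2 first.
- exact: mgE.
- by move=> x; rewrite lee_fin.
rewrite muleAC -EFinM -ge0_integralZl//; last 3 first.
- exact: mgEc.
- by move=> x _; rewrite lee_fin.
- by rewrite lee_fin mulr_ge0// ltW.
apply: eq_integral => t _; rewrite addr0 -EFinM; congr EFin.
rewrite !gE !(pmulr_rgt0 _ v1); case: ifPn => t0; last by rewrite mul0r mulr0.
rewrite pmulr_lgt0// t0 !gammafM ?(ltW t0) ?(ltW v0) ?(ltW v1)// /h /gammaf.
have -> : t `^ (a + b - 1) = t `^ (b - 1) * (t * t `^ (a - 1)).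
  rewrite mulr_powRB1 ?(ltW t0)// -powRD; last by rewrite (gt_eqF t0) implybT.
  by congr (_ `^ _); ring.
have -> : (1 + v) `^ (- (a + b)) = ((1 + v) * (1 + v) `^ (a + b - 1))^-1.
  by rewrite mulr_powRB1 ?(ltW v1)// powRN.
have -> : expR (- ((1 + v) * t)) = expR (- t) * expR (- (t * v)).
  by rewrite -expRD; congr expR; ring.
have N0 : (1 + v) * (1 + v) `^ (a + b - 1) != 0.
  by rewrite gt_eqF// mulr_gt0// powR_gt0.
set P := (1 + v) `^ (a + b - 1) in N0 *.
by field; move: N0; rewrite mulf_eq0 negb_or andbC.
Qed.

(** The convolution of the two Gamma integrands is a multiple of the integrand for a + b; the
    substitution s = w u in the inner integral exhibits the factor as a Beta integral. *)
Lemma hasint_Beta a b : 0 < a -> 0 < b ->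
  hasint mu `]0, 1[ (fun u => u `^ (a - 1) * (1 - u) `^ (b - 1))
    (Gamma a * Gamma b / Gamma (a + b)).
Proof.
move=> a0 b0; have ab0 : 0 < a + b by rewrite addr_gt0.
pose h u : R := u `^ (a - 1) * (1 - u) `^ (b - 1).
have mh : measurable_fun setT h.
  apply: measurable_funM; first exact: measurable_powR.
  by apply: measurable_fun_powR; exact: measurable_funB.
have h0 v : 0 <= h v by rewrite mulr_ge0 ?powR_ge0.
apply: hasint_ge0 => //; [exact: measurable_funTS mh|by move=> v _; exact: h0|].
have G0 := Gamma_gt0 ab0.
apply: EFin_eq_div => //; first by apply: integral_ge0 => v _; rewrite lee_fin h0.
transitivity ((Gamma (a + b))%:E * \int[mu]_(v in D01) (h v)%:E)%E; last by [].
pose f (z : R * R) : \bar R := (g a z.1 * g b (z.2 - z.1))%:E.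
have mf : measurable_fun setT f.
  apply/measurable_EFinP; apply: measurable_funM.
    exact: measurableT_comp (mg a) measurable_fst.
  by apply: measurableT_comp (mg b) _; apply: measurable_funB.
have f0 z : (0 <= f z)%E by rewrite lee_fin mulr_ge0.
transitivity (\int[mu]_s \int[mu]_w f (s, w))%E.
  rewrite EFinM -[X in (X * _)%E](int_g a0) -ge0_integralZr//; last 3 first.
  - exact: mgE.
  - by move=> x _; rewrite lee_fin.
  - by rewrite lee_fin ltW// Gamma_gt0.
  apply: eq_integral => s _; rewrite /f /=.
  rewrite -(int_g b0) (ge0_integral_affine (- s) ltr01); last 2 first.
  - exact: mgE.
  - by move=> x; rewrite lee_fin.
  rewrite mul1e -ge0_integralZl//; last 3 first.
  - apply/measurable_EFinP; apply: (measurableT_comp (mg b)).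
    by apply: measurable_funD => //; apply: measurable_funM.
  - by move=> x _; rewrite lee_fin.
  - by rewrite lee_fin.
  by apply: eq_integral => v _; rewrite mul1r -!EFinM.
rewrite lebesgue_tonelli//.
transitivity (\int[mu]_w ((g (a + b) w)%:E * \int[mu]_(v in D01) (h v)%:E))%E; last first.
  rewrite ge0_integralZr//; last 3 first.
  - exact: mgE.
  - by move=> x _; rewrite lee_fin.
  - by apply: integral_ge0 => v _; rewrite lee_fin h0.
  by rewrite int_g.
apply: eq_integral => w _; rewrite /f /=.
have [w0|w0] := ltP 0 w; last first.
  rewrite [in RHS]gE ltNge w0/= mul0e integral0_eq// => s _.
  rewrite !gE; case: ifPn => s0; last by rewrite mul0r.
  by rewrite subr_gt0 ltNge (le_trans w0 (ltW s0))/= mulr0.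
rewrite (ge0_integral_affine 0 w0); last 2 first.
- apply/measurable_EFinP; apply: measurable_funM; first exact: mg.
  by apply: (measurableT_comp (mg b)); apply: measurable_funB.
- by move=> x; rewrite lee_fin mulr_ge0.
rewrite [in RHS]integral_mkcond restrict_EFin -!ge0_integralZl//; last 6 first.
- apply/measurable_EFinP; apply: measurable_funM; apply: (measurableT_comp (mg _)).
    by apply: measurable_funD => //; apply: measurable_funM.
  by apply: measurable_funB => //; apply: measurable_funD => //; apply: measurable_funM.
- by move=> x _; rewrite lee_fin mulr_ge0.
- by rewrite lee_fin ltW.
- by apply/measurable_EFinP/(measurable_restrictT _ mD01); exact: measurable_funTS mh.
- by move=> x _; rewrite lee_fin patchE; case: ifP.
- by rewrite lee_fin.
apply: eq_integral => u _; rewrite addr0 -!EFinM; congr EFin.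
rewrite patchE mem_setE /D01 in_itv/= !gE pmulr_rgt0// w0.
have -> : w - w * u = w * (1 - u) by ring.
rewrite pmulr_rgt0// subr_gt0.
have [u0|u0] /= := ltP 0 u; last by rewrite mul0r !mulr0.
have [u1|u1] /= := ltP u 1; last by rewrite !mulr0.
rewrite !gammafM ?(ltW w0) ?(ltW u0) ?subr_ge0 ?(ltW u1)// /h /gammaf.
have -> : w `^ (a + b - 1) = w * w `^ (a - 1) * w `^ (b - 1).
  rewrite mulr_powRB1 ?(ltW w0)// -powRD; last by rewrite (gt_eqF w0) implybT.
  by congr (_ `^ _); ring.
have -> : expR (- w) = expR (- (w * u)) * expR (- (w * (1 - u))).
  by rewrite -expRD; congr expR; ring.
by ring.
Qed.

(** The Beta integral with second parameter 1 is also the elementary integral of u^(s-1), equal to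
    1/s; this replaces an integration by parts. *)
Lemma GammaS s : 0 < s -> Gamma (s + 1) = s * Gamma s.
Proof.
move=> s0; have := hasint_Beta s0 ltr01.
have h : hasint mu `]0, 1[ (fun u => u `^ (s - 1) * (1 - u) `^ (1 - 1)) s^-1.
  apply: eq_hasint (hasint_powR01 s0); first exact: mD01.
  by move=> x _; rewrite subrr powRr0 mulr1.
move=> /hasint_unique/(_ h); rewrite Gamma1 mulr1 => /esym E.
have G0 : Gamma (s + 1) != 0 by rewrite gt_eqF// Gamma_gt0// addr_gt0.
have -> : Gamma s = s^-1 * Gamma (s + 1) by rewrite E mulfVK.
by rewrite mulrA mulfV ?mul1r// gt_eqF.
Qed.

End GammaBeta.

(** * Powers, translations and end points in Lebesgue integrals *)

Section realint_more.
Context (R : realType).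
Let mu : {measure set _ -> \bar R} := @lebesgue_measure R.
Implicit Types (p u v x a : R) (f : R -> R).

Lemma continuous_norm_powR p : 0 < p -> continuous (fun u : R => `|u| `^ p).
Proof.
move=> p0 u; have [->|u0] := eqVneq u 0.
  rewrite /continuous_at normr0 powR0 ?gt_eqF//.
  apply/cvgrPdist_lt => e e0.
  have pe : 0 < e `^ p^-1 by rewrite powR_gt0.
  exists (e `^ p^-1) => //= t; rewrite /= sub0r normrN => te.
  rewrite sub0r normrN ger0_norm ?powR_ge0//.
  have : `|t| `^ p < (e `^ p^-1) `^ p by apply: gt0_ltr_powR; rewrite ?nnegrE ?(ltW pe).
  by rewrite -powRrM mulVf ?gt_eqF// powRr1// ltW.
apply: (@continuous_comp _ _ _ (fun u : R => `|u|) (fun x : R => x `^ p)).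
  exact: norm_continuous.
by apply: continuous_powR_gt0; rewrite normr_gt0.
Qed.

Lemma is_derive_powR_1B p x : x < 1 ->
  is_derive x 1 (fun u : R => (1 - u) `^ p) (- (p * (1 - x) `^ (p - 1))).
Proof.
move=> x1; have h : 0 < 1 - x by rewrite subr_gt0.
have d1 : is_derive x 1 (fun u : R => 1 - u) (-1).
  by apply: is_derive_eq; ring.
have := @is_derive1_comp _ (fun x : R => x `^ p) (fun u => 1 - u) x _ _
  (is_derive1_powR p h) d1.
by rewrite mulrN1.
Qed.

Lemma is_derive_powR_B1 p x : 1 < x ->
  is_derive x 1 (fun u : R => (u - 1) `^ p) (p * (x - 1) `^ (p - 1)).
Proof.
move=> x1; have h : 0 < x - 1 by rewrite subr_gt0.
have d1 : is_derive x 1 (fun u : R => u - 1) 1.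
  by apply: is_derive_eq; ring.
have := @is_derive1_comp _ (fun x : R => x `^ p) (fun u => u - 1) x _ _
  (is_derive1_powR p h) d1.
by rewrite mulr1.
Qed.

Lemma hasint_shift f a I : measurable_fun setT f -> (forall x, 0 <= f x) ->
  hasint mu `]0, +oo[ f I -> hasint mu `]a, +oo[ (fun v => f (v - a)) I.
Proof.
move=> mf f0 fI.
pose D0 : set (measurableTypeR R) := `]0, +oo[%classic.
pose Da : set (measurableTypeR R) := `]a, +oo[%classic.
have m0 : measurable D0 by exact: measurable_itv.
have ma : measurable Da by exact: measurable_itv.
have mfa : measurable_fun setT (fun v : R => f (v - a)).
  by apply: measurableT_comp => //; exact: measurable_funB.
apply: hasint_ge0 => //; first exact: measurable_funTS mfa.
have mp : measurable_fun setT (EFin \o ((fun v : R => f (v - a)) \_ Da)).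
  by apply/measurable_EFinP/(measurable_restrictT _ ma); exact: measurable_funTS mfa.
transitivity (\int[mu]_x (((fun v : R => f (v - a)) \_ Da) x)%:E)%E.
  by rewrite [LHS]integral_mkcond restrict_EFin.
rewrite (ge0_integral_affine a ltr01 mp); last first.
  by move=> x; rewrite lee_fin patchE; case: ifP.
have [_ <-] := (hasint_patch mu f I m0).1 fI.
rewrite mul1e; apply: eq_integral => x _ /=.
rewrite !patchE !mem_setE /Da /D0 !in_itv/= !andbT mul1r ltrDr.
by rewrite addrK.
Qed.

Lemma hasint_obnd_cbnd f a I : measurable_fun setT f ->
  hasint mu `]a, +oo[ f I -> hasint mu `[a, +oo[ f I.
Proof.
move=> mf fI.
pose D1 : set (measurableTypeR R) := [set a].
pose Da : set (measurableTypeR R) := `]a, +oo[%classic.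
have m1 : measurable D1 by exact: measurable_set1.
have ma : measurable Da by exact: measurable_itv.
have h1 : hasint mu D1 f 0.
  split; last exact: integral_set1.
  apply: null_set_integrable => //; last exact: lebesgue_measure_set1.
  by apply/measurable_EFinP; exact: measurable_funTS mf.
have E : `[a, +oo[%classic = D1 `|` Da.
  apply/seteqP; split=> x /=; rewrite !in_itv/= !andbT.
    rewrite le_eqVlt => /predU1P[<-|ax]; first by left.
    by right; rewrite /Da /= in_itv/= andbT.
  by move=> [->//|]; rewrite /Da /= in_itv/= andbT => /ltW.
have := hasint_setU m1 ma _ h1 fI; rewrite E add0r; apply.
by move=> x ->; rewrite /Da/= in_itv/= ltxx.
Qed.

End realint_more.

(** * Partial fractions of the cotangent *)

Section Herglotz.
Context (R : realType).
Implicit Types (s t x : R) (n N : nat).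

Lemma is_derive_ge0_le (f df : R -> R) (a b : R) : a <= b ->
  (forall x, a <= x <= b -> is_derive x 1 f (df x)) ->
  (forall x, a <= x <= b -> 0 <= df x) -> f a <= f b.
Proof.
move=> ab dF df0.
have [||c cab E] := @MVT_segment R f df a b ab.
- by move=> x; rewrite in_itv/= => /andP[ax xb]; apply: dF; rewrite !ltW.
- apply: derivable_within_continuous => x; rewrite in_itv/= => xab.
  by have ? := dF _ xab; exact: ex_derive.
rewrite -subr_ge0 E mulr_ge0 ?subr_ge0//.
by apply: df0; move: cab; rewrite in_itv.
Qed.

Lemma sin_le_id x : 0 <= x -> sin x <= x.
Proof.
move=> x0; have : 0 - sin 0 <= x - sin x; last by rewrite sin0 subr0 subr_ge0.
by apply: (@is_derive_ge0_le (fun x => x - sin x) (fun x => 1 - cos x)) => // y _;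
  rewrite subr_ge0 cos_le1.
Qed.

Lemma cos_ge_quadratic x : 0 <= x -> 1 - x ^+ 2 / 2 <= cos x.
Proof.
move=> x0; have -> : x = (x / 2) *+ 2 by rewrite -mulr_natr divfK.
rewrite cos_mulr2n cos2sin2; set y := x / 2.
have y0 : 0 <= y by rewrite divr_ge0.
have s1 := sin_le_id y0.
have : sin y ^+ 2 <= y ^+ 2.
  have [y2|y2] := leP y 1.
    by rewrite ler_sqr ?nnegrE// sin_ge0_pi// y0 (le_trans y2)// (le_trans _ (pi_ge2 R))// ler1n.
  apply: (@le_trans _ _ 1); last by rewrite expr_ge1// ltW.
  by rewrite sin2cos2 gerBl sqr_ge0.
move: (sin y ^+ 2) => u uy.
have -> : 1 - (y *+ 2) ^+ 2 / 2 = 1 - 2 * y ^+ 2 by field.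
have -> : (1 - u) *+ 2 - 1 = 1 - 2 * u by ring.
by move: (y ^+ 2) uy => v; lra.
Qed.

Lemma sin_ge_cubic x : 0 <= x -> x - x ^+ 3 / 6 <= sin x.
Proof.
move=> x0; have : sin 0 - (0 - 0 ^+ 3 / 6) <= sin x - (x - x ^+ 3 / 6).
  apply: (@is_derive_ge0_le (fun x => sin x - (x - x ^+ 3 / 6))
    (fun x => cos x - (1 - x ^+ 2 / 2))) => // y /andP[y0 _].
    by apply: is_derive_eq; rewrite /GRing.scale/=; field.
  by rewrite subr_ge0 cos_ge_quadratic.
by rewrite sin0 expr0n/= mul0r !subr0 subr_ge0.
Qed.

(** The double pole of 1 / sin^2 at 0 is that of 1 / x^2 up to a bounded error. The constant 3 comes
    from (x - sin x)(x + sin x) <= x^4 / 3 and sin x >= x / 3. *)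
Lemma sin_inv_sqr_bounds x : 0 < x <= pi / 2 ->
  x ^- 2 <= sin x ^- 2 <= x ^- 2 + 3.
Proof.
move=> /andP[x0 xpi].
have x2 : x < 2 by rewrite (le_lt_trans xpi)// pihalf_lt2.
have s1 := sin_le_id (ltW x0); have s2 := sin_ge_cubic (ltW x0).
have s3 : x / 3 <= sin x.
  apply: le_trans s2; rewrite -subr_ge0.
  have -> : x - x ^+ 3 / 6 - x / 3 = x * (2 - x) * (2 + x) / 6 by field.
  by rewrite divr_ge0// !mulr_ge0//; lra.
have s0 : 0 < sin x by rewrite (lt_le_trans _ s3)// divr_gt0.
apply/andP; split.
  by rewrite lef_pV2 ?posrE ?exprn_gt0// ler_sqr ?nnegrE// ltW.
rewrite -subr_ge0.
have -> : x ^- 2 + 3 - sin x ^- 2 = (3 * x ^+ 2 * sin x ^+ 2 - (x - sin x) * (x + sin x)) / (x ^+ 2 * sin x ^+ 2).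
  by field; rewrite !gt_eqF//.
apply: divr_ge0; last by rewrite mulr_ge0 ?sqr_ge0.
rewrite subr_ge0.
apply: (@le_trans _ _ ((x ^+ 3 / 6) * (x + x))).
  apply: ler_pM; rewrite ?subr_ge0 ?addr_ge0 ?(ltW x0) ?(ltW s0)//; first by rewrite lerBlDl -lerBlDr.
  by rewrite lerD2l.
apply: (@le_trans _ _ (3 * x ^+ 2 * (x / 3) ^+ 2)).
  by rewrite le_eqVlt; apply/orP; left; apply/eqP; field.
rewrite ler_pM2l; last by rewrite mulr_gt0// exprn_gt0.
by rewrite ler_sqr// nnegrE ?divr_ge0// ltW.
Qed.

Let cotpi s : R := pi * (cos (pi * s) / sin (pi * s)).

Let sinpi_gt0 s : 0 < s < 1 -> 0 < sin (pi * s).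
Proof.
move=> /andP[s0 s1]; apply: sin_gt0_pi.
by rewrite mulr_gt0 ?pi_gt0//= gtr_pMr ?pi_gt0.
Qed.

(** pi cot (pi s) without its poles at 0 and 1, so that the derivative [dV] stays bounded on ]0,
    1[. *)
Let V s : R := cotpi s - s^-1 + (1 - s)^-1.
Let dV s : R := - pi ^+ 2 * sin (pi * s) ^- 2 + s ^- 2 + (1 - s) ^- 2.

Let is_derive_V s : 0 < s < 1 -> is_derive s 1 V (dV s).
Proof.
move=> s01; have p0 := sinpi_gt0 s01; have /andP[s0 s1] := s01.
have dV1 : is_derive s 1 (fun s => sin (pi * s)) (pi * cos (pi * s)).
  by apply: is_derive_eq; rewrite /GRing.scale/=; ring.
have dV2 : is_derive s 1 (fun s => cos (pi * s)) (- pi * sin (pi * s)).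
  by apply: is_derive_eq; rewrite /GRing.scale/=; ring.
have dV3 := @is_deriveV _ _ _ _ _ (lt0r_neq0 p0) dV1.
have dV4 : is_derive s 1 (fun s : R => s^-1) (- s ^- 2).
  have := @is_deriveV _ id _ _ _ (lt0r_neq0 s0) (is_derive_id s 1).
  by rewrite /GRing.scale/= mulr1.
have q0 : 0 < 1 - s by rewrite subr_gt0.
have dV5 : is_derive s 1 (fun s : R => (1 - s)^-1) ((1 - s) ^- 2).
  apply: (is_derive_eq (@is_deriveV _ (fun s => 1 - s) _ _ _ (lt0r_neq0 q0) _)).
  by rewrite /GRing.scale/=; ring.
rewrite /V /cotpi; apply: is_derive_eq; rewrite /GRing.scale/= /dV.
have cs : cos (pi * s) ^+ 2 = 1 - sin (pi * s) ^+ 2 by rewrite cos2sin2.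
have -> : pi * (cos (pi * s) * (- sin (pi * s) ^- 2 * (pi * cos (pi * s))) +
   (sin (pi * s))^-1 * (- pi * sin (pi * s))) =
   - pi ^+ 2 * ((cos (pi * s) ^+ 2 + sin (pi * s) ^+ 2) * sin (pi * s) ^- 2).
  by field; rewrite gt_eqF.
by rewrite cs subrK mul1r; ring.
Qed.

(** The symmetry s <-> 1 - s reduces to s <= 1/2, where [sin_inv_sqr_bounds] cancels the pole at 0
    and the other pole is at distance at least 1/2. *)
Let dV_bound s : 0 < s < 1 -> `|dV s| <= 3 * pi ^+ 2 + 4.
Proof.
have half t : 0 < t <= 1 / 2 ->
    t ^- 2 <= pi ^+ 2 * sin (pi * t) ^- 2 <= t ^- 2 + 3 * pi ^+ 2 /\ 1 <= (1 - t) ^- 2 <= 4.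
  move=> /andP[t0 t2]; split.
    have p0 := pi_gt0 R.
    have /sin_inv_sqr_bounds/andP[h1 h2] : 0 < pi * t <= pi / 2.
      by rewrite mulr_gt0//= ler_pM2l//; move: t2; rewrite div1r.
    have p20 : 0 < pi ^+ 2 :> R by rewrite exprn_gt0.
    have E (P : R) : 0 < P -> t ^- 2 = P ^+ 2 * (P * t) ^- 2.
      by move=> P0; field; rewrite !gt_eqF.
    rewrite (E _ p0).
    by rewrite ler_pM2l// h1/= (mulrC 3) -mulrDr ler_pM2l.
  have u0 : 0 < 1 - t by lra.
  apply/andP; split.
    by rewrite invf_ge1 ?exprn_gt0//; apply: exprn_ile1; lra.
  have -> : 4 = (1 / 2) ^- 2 :> R by field.
  by rewrite lef_pV2 ?posrE ?exprn_gt0// ler_sqr ?nnegrE; lra.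
move=> /andP[s0 s1]; rewrite /dV.
have [s2|s2] := leP s (1 / 2).
  have [|/andP[h1 h2] /andP[h3 h4]] := half s; first by rewrite s0.
  rewrite mulNr; move: (pi ^+ 2) (pi_ge0 R) h1 h2 h3 h4 => P.
  move: (P * _) => Q; move: (s ^- 2) ((1 - s) ^- 2) => A B _ *.
  by rewrite ler_norml; apply/andP; split; lra.
have [|/andP[h1 h2] /andP[h3 h4]] := half (1 - s); first by apply/andP; split; lra.
have E : sin (pi * s) = sin (pi * (1 - s)).
  by rewrite mulrBr mulr1 sinB sinpi cospi mul0r sub0r mulN1r opprK.
rewrite mulNr E; move: h3 h4; rewrite opprB addrC subrK.
move: (pi ^+ 2) h1 h2 => P.
move: (P * _) => Q; move: (s ^- 2) ((1 - s) ^- 2) => A B *.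
by rewrite ler_norml; apply/andP; split; lra.
Qed.

Lemma lipschitz_of_derive (f df : R -> R) (L : R) :
  (forall x, 0 < x < 1 -> is_derive x 1 f (df x)) ->
  (forall x, 0 < x < 1 -> `|df x| <= L) ->
  forall s t, 0 < s < 1 -> 0 < t < 1 -> `|f s - f t| <= L * `|s - t|.
Proof.
move=> dF dFL s t.
wlog ts : s t / t <= s.
  move=> H s01 t01; have [ts|/ltW st] := leP t s; first exact: H.
  by rewrite distrC (distrC s) H.
move=> /andP[s0 s1] /andP[t0 t1].
have I x : x \in `[t, s] -> 0 < x < 1.
  by rewrite in_itv/= => /andP[tx xs]; rewrite (lt_le_trans t0)//= (le_lt_trans xs).
have [||c cab E] := @MVT_segment R f df t s ts.
- by move=> x xts; apply: dF; apply: I; exact: subset_itv_oo_cc.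
- apply: derivable_within_continuous => x /I xab.
  by have ? := dF _ xab; exact: ex_derive.
by rewrite E normrM ler_wpM2r// dFL// I.
Qed.

(** Symmetric partial sums, over |k| <= N, of the expansion of pi cot (pi s) in terms 1 / (s +
    k). *)
Definition cotsum N s : R :=
  s^-1 + \sum_(m < N) ((s + m.+1%:R)^-1 + (s - m.+1%:R)^-1).

Lemma cotsumS N s : cotsum N.+1 s =
  cotsum N s + ((s + N.+1%:R)^-1 + (s - N.+1%:R)^-1).
Proof. by rewrite /cotsum big_ord_recr/= addrA. Qed.

Let natS_gt s N : s < 1 -> s - N.+1%:R < 0.
Proof. by move=> s1; rewrite subr_lt0 (lt_le_trans s1)// ler1n. Qed.

Let inv_lip (x y m : R) : 0 < m -> m <= x -> m <= y ->
  `|x^-1 - y^-1| <= m ^- 2 * `|x - y|.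
Proof.
move=> m0 mx my; have x0 := lt_le_trans m0 mx; have y0 := lt_le_trans m0 my.
have -> : x^-1 - y^-1 = (x * y)^-1 * (y - x) by field; rewrite !gt_eqF.
rewrite normrM distrC ler_wpM2r// ger0_norm ?invr_ge0 ?mulr_ge0 ?(ltW x0) ?(ltW y0)//.
by rewrite lef_pV2 ?posrE ?mulr_gt0 ?exprn_gt0// expr2 ler_pM// ltW.
Qed.

(** A new pair of terms adds at most 2 / n^2 <= 4 / n - 4 / (n + 1) to the Lipschitz constant, so
    the constant telescopes and stays below 5. The index is [N.+1] because the first pair contains
    the pole at 1. *)
Lemma cotsum_lip N s t : 0 < s < 1 -> 0 < t < 1 ->
  `|(cotsum N.+1 s - s^-1 + (1 - s)^-1) - (cotsum N.+1 t - t^-1 + (1 - t)^-1)|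
  <= (5 - 4 / N.+1%:R) * `|s - t|.
Proof.
move=> /andP[s0 s1] /andP[t0 t1]; elim: N => [|N IH].
  have E (u : R) : 0 < u < 1 -> cotsum 1 u - u^-1 + (1 - u)^-1 = (u + 1)^-1.
    move=> /andP[u0 u1]; rewrite /cotsum big_ord1 /=.
    have -> : (1 - u)^-1 = - (u - 1)^-1 by rewrite -invrN opprB.
    by ring.
  rewrite !E ?s0 ?t0// divr1.
  have := @inv_lip (s + 1) (t + 1) 1 ltr01; rewrite expr1n invr1.
  have -> : s + 1 - (t + 1) = s - t by ring.
  have -> : 5 - 4 = 1 :> R by ring.
  by apply; lra.
rewrite (cotsumS N.+1 s) (cotsumS N.+1 t).
set A := cotsum N.+1 s; set B := cotsum N.+1 t.
set n : R := N.+1%:R.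
have nE : N.+2%:R = n + 1 :> R by rewrite /n [in LHS]mulrS addrC.
have n1 : 1 <= n by rewrite /n ler1n.
rewrite nE.
have -> : A + ((s + (n + 1))^-1 + (s - (n + 1))^-1) - s^-1 + (1 - s)^-1 -
  (B + ((t + (n + 1))^-1 + (t - (n + 1))^-1) - t^-1 + (1 - t)^-1) =
  ((A - s^-1 + (1 - s)^-1) - (B - t^-1 + (1 - t)^-1)) +
  (((s + (n + 1))^-1 - (t + (n + 1))^-1) + ((n + 1 - t)^-1 - (n + 1 - s)^-1)).
  have -> : (n + 1 - t)^-1 = - (t - (n + 1))^-1 by rewrite -invrN opprB.
  have -> : (n + 1 - s)^-1 = - (s - (n + 1))^-1 by rewrite -invrN opprB.
  by ring.
have h1 : `|(s + (n + 1))^-1 - (t + (n + 1))^-1| <= n ^- 2 * `|s - t|.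
  have := @inv_lip (s + (n + 1)) (t + (n + 1)) n.
  have -> : s + (n + 1) - (t + (n + 1)) = s - t by ring.
  by apply; lra.
have h2 : `|(n + 1 - t)^-1 - (n + 1 - s)^-1| <= n ^- 2 * `|s - t|.
  have := @inv_lip (n + 1 - t) (n + 1 - s) n.
  have -> : n + 1 - t - (n + 1 - s) = s - t by ring.
  by apply; lra.
apply: (le_trans (ler_normD _ _)); apply: (le_trans (lerD IH (ler_normD _ _))).
apply: (le_trans (lerD (lexx _) (lerD h1 h2))).
rewrite -!mulrDl ler_wpM2r// -/n.
have -> : 5 - 4 / (n + 1) = 5 - 4 / n + 4 / (n * (n + 1)).
  by field; rewrite !gt_eqF//; lra.
rewrite lerD2l.
have -> : n ^- 2 + n ^- 2 = 2 / (n * n) by field; rewrite gt_eqF//; lra.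
rewrite ler_pdivrMr; last by rewrite mulr_gt0//; lra.
rewrite mulrAC ler_pdivlMr; last by rewrite mulr_gt0//; lra.
have : 0 <= n * (2 * n - 2) by rewrite mulr_ge0//; lra.
move=> h; rewrite -subr_ge0.
by have -> : 4 * (n * n) - 2 * (n * (n + 1)) = n * (2 * n - 2) by ring.
Qed.

(** At 1/2 the sum telescopes and the cotangent vanishes; this fixes the additive constant in the
    comparison. *)
Lemma cotsum_half N : cotsum N (1 / 2) = 2 / (2 * N%:R + 1).
Proof.
elim: N => [|N IH]; first by rewrite /cotsum big_ord0 mulr0 add0r addr0; field.
rewrite cotsumS IH -[N.+1%:R]natr1; have n0 : 0 <= N%:R :> R by [].
move: (N%:R : R) n0 => n n0.
have a0 : 2 * n + 1 != 0 by rewrite gt_eqF//; lra.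
have a1 : 2 * n + 3 != 0 by rewrite gt_eqF//; lra.
have -> : 1 / 2 + (n + 1) = (2 * n + 3) / 2 by field.
have -> : 1 / 2 - (n + 1) = - ((2 * n + 1) / 2) by field.
have -> : 2 * (n + 1) + 1 = 2 * n + 3 by ring.
by rewrite invrN; field; rewrite a0 a1.
Qed.

(** The two halves supply the even and the odd shifts of s, namely -2N, ..., 2N + 1; the shift 2N +
    1 has no partner and gives the extra term. *)
Lemma cotsum_dup N s : 0 < s < 1 ->
  cotsum N (s / 2) + cotsum N ((s + 1) / 2) =
  2 * (cotsum (N + N) s + (s + (N + N).+1%:R)^-1).
Proof.
move=> /andP[s0 s1]; elim: N => [|N IH].
  rewrite /cotsum !big_ord0 !addr0; field.
  by rewrite !gt_eqF//; lra.
rewrite addSn addnS !cotsumS addrACA IH.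
have S1 m : m.+1%:R = m%:R + 1 :> R by rewrite natr1.
rewrite (S1 N) (S1 (N + N).+2) (S1 (N + N).+1) (S1 (N + N)%N) natrD.
have n0 : 0 <= N%:R :> R by [].
move: (N%:R : R) n0 (cotsum _ s) => n n0 C.
have -> : (s / 2 + (n + 1))^-1 = 2 / (s + 2 * n + 2) by field; rewrite !gt_eqF//; lra.
have -> : (s / 2 - (n + 1))^-1 = 2 / (s - 2 * n - 2) by field; rewrite !lt_eqF//; lra.
have -> : ((s + 1) / 2 + (n + 1))^-1 = 2 / (s + 2 * n + 3) by field; rewrite !gt_eqF//; lra.
have -> : ((s + 1) / 2 - (n + 1))^-1 = 2 / (s - 2 * n - 1) by field; rewrite !lt_eqF//; lra.
have -> : s + (n + n + 1) = s + 2 * n + 1 by ring.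
have -> : s - (n + n + 1) = s - 2 * n - 1 by ring.
have -> : s + (n + n + 1 + 1) = s + 2 * n + 2 by ring.
have -> : s - (n + n + 1 + 1) = s - 2 * n - 2 by ring.
have -> : s + (n + n + 1 + 1 + 1) = s + 2 * n + 3 by ring.
by ring.
Qed.

Let cotpi_dup s : 0 < s < 1 -> cotpi (s / 2) + cotpi ((s + 1) / 2) = 2 * cotpi s.
Proof.
move=> s01; have p0 := sinpi_gt0 s01; rewrite /cotpi.
set y := pi * (s / 2).
have -> : pi * ((s + 1) / 2) = y + pi / 2 by rewrite /y; field.
have E : pi * s = y *+ 2 by rewrite /y; field.
move: p0; rewrite E cosDpihalf sinDpihalf sin_mulr2n cos_mulr2n => p0.
have c0 : cos y != 0 by apply: contraTneq p0 => ->; rewrite mul0r mul0rn ltxx.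
have z0 : sin y != 0 by apply: contraTneq p0 => ->; rewrite mulr0 mul0rn ltxx.
have -> : cos y ^+ 2 *+ 2 - 1 = cos y ^+ 2 - sin y ^+ 2.
  by rewrite sin2cos2; ring.
by field; rewrite z0 c0.
Qed.

(** Sum of the constants of [cotsum_lip] and [dV_bound]; in the difference [D] below the removed
    poles cancel. *)
Let L : R := 5 + (3 * pi ^+ 2 + 4).
Let D N s := cotsum N s - cotpi s.

Let D_lip N s t : 0 < s < 1 -> 0 < t < 1 -> `|D N.+1 s - D N.+1 t| <= L * `|s - t|.
Proof.
move=> s01 t01.
have -> : D N.+1 s - D N.+1 t =
  ((cotsum N.+1 s - s^-1 + (1 - s)^-1) - (cotsum N.+1 t - t^-1 + (1 - t)^-1)) -
  (V s - V t) by rewrite /D /V; ring.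
rewrite (le_trans (ler_normB _ _))// /L mulrDl lerD//.
  rewrite (le_trans (cotsum_lip N s01 t01))// ler_wpM2r// gerBl.
  by rewrite divr_ge0.
exact: lipschitz_of_derive is_derive_V dV_bound _ _ s01 t01.
Qed.

Let D_half N : D N (1 / 2) = 2 / (2 * N%:R + 1).
Proof.
rewrite /D cotsum_half /cotpi (_ : pi * (1 / 2) = pi / 2) ?cos_pihalf ?mul0r ?mulr0 ?subr0//.
by rewrite div1r.
Qed.

Let half01 : 0 < (1 / 2 : R) < 1.
Proof. by apply/andP; split; lra. Qed.

(** Each added pair is negative on ]0, 1[, so the sequence decreases; the Lipschitz bound against
    the known value at 1/2 bounds it from below. *)
Let cvg_D s : 0 < s < 1 -> cvgn (D ^~ s).
Proof.
move=> s01; have /andP[s0 s1] := s01.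
have ni : nonincreasing_seq (D ^~ s).
  apply/nonincreasing_seqP => n; rewrite lerD2r cotsumS gerDl.
  have h : 0 < n.+1%:R - s by have := natS_gt n s1; rewrite subr_lt0 subr_gt0.
  have -> : (s - n.+1%:R)^-1 = - (n.+1%:R - s)^-1 by rewrite -invrN opprB.
  by move: (n.+1%:R : R) h => m h; rewrite subr_le0 lef_pV2 ?posrE; lra.
apply: nonincreasing_is_cvgn => //; exists (- L) => _ [n _ <-] /=.
apply: (@le_trans _ _ (D n.+1 s)); last exact: ni.
have := D_lip n s01 half01; rewrite D_half.
have : 0 <= 2 / (2 * n.+1%:R + 1) :> R by rewrite divr_ge0// addr_ge0.
have : `|s - 1 / 2| <= 1 by rewrite ler_norml; apply/andP; split; lra.
have L0 : 0 <= L by rewrite /L !addr_ge0// mulr_ge0// exprn_ge0// pi_ge0.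
move: (2 / _) (D n.+1 s) => A B h A0 /(le_trans)/(_ (ler_wpM2l L0 h)).
by rewrite mulr1 ler_norml => /andP[]; lra.
Qed.

Let E s : R := limn (D ^~ s).

Let E_cvg s : 0 < s < 1 -> D n s @[n --> \oo] --> E s.
Proof. exact: cvg_D. Qed.

Let E_lip s t : 0 < s < 1 -> 0 < t < 1 -> `|E s - E t| <= L * `|s - t|.
Proof.
move=> s01 t01.
have h : `|D n s - D n t| @[n --> \oo] --> `|E s - E t|.
  by apply: cvg_norm; apply: cvgB; exact: E_cvg.
apply: (closed_cvg (fun y => y <= L * `|s - t|)) h; first exact: closed_le.
by exists 1%N => // n /= n1; case: n n1 => // n _; exact: D_lip.
Qed.

Let E_half : E (1 / 2) = 0.
Proof.
have h : D n (1 / 2) @[n --> \oo] --> (0 : R); last exact: (cvg_unique _ (E_cvg half01) h).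
rewrite (_ : (fun n => D n (1 / 2)) = (fun n => 2 / (2 * n%:R + 1))); last first.
  by apply/funext => n; exact: D_half.
apply: (@squeeze_cvgr _ _ _ _ (fun=> 0) (fun n => 2 * n.+1%:R^-1)).
- apply: nearW => n; rewrite divr_ge0 ?addr_ge0//= ler_pM2l// lef_pV2 ?posrE//.
  by rewrite -natr1 lerD2r ler_peMl// ler1n.
- exact: cvg_cst.
- rewrite -[X in _ --> X](mulr0 2); apply: cvgM; [exact: cvg_cst|exact: cvg_harmonic].
Qed.

Let E_dup s : 0 < s < 1 -> E (s / 2) + E ((s + 1) / 2) = 2 * E s.
Proof.
move=> s01; have /andP[s0 s1] := s01.
have h1 : D n (s / 2) + D n ((s + 1) / 2) @[n --> \oo] --> E (s / 2) + E ((s + 1) / 2).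
  by apply: cvgD; apply: E_cvg; apply/andP; split; lra.
suff h2 : D n (s / 2) + D n ((s + 1) / 2) @[n --> \oo] --> 2 * E s.
  exact: (cvg_unique _ h1 h2).
have -> : (fun n => D n (s / 2) + D n ((s + 1) / 2)) =
   (fun n => 2 * (D (n + n)%N s + (s + (n + n).+1%:R)^-1)).
  apply/funext => n; rewrite /D addrACA cotsum_dup// -opprD cotpi_dup//; ring.
apply: cvgM; first exact: cvg_cst.
rewrite -[X in _ --> X]addr0; apply: cvgD.
  have h2 : (n + n)%N @[n --> \oo] --> \oo.
    move=> P [N _ HN]; exists N => // n /= Nn; apply: HN => /=.
    by rewrite (leq_trans Nn)// leq_addr.
  exact: (cvg_comp _ _ h2 (E_cvg s01)).
apply: (@squeeze_cvgr _ _ _ _ (fun=> 0) (fun n => n.+1%:R^-1)).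
- apply: nearW => n; rewrite invr_ge0 addr_ge0 ?(ltW s0)//= lef_pV2 ?posrE//.
    by rewrite (@le_trans _ _ (n + n).+1%:R)// ?ler_nat ?ltnS ?leq_addr// lerDr ltW.
  by rewrite addr_gt0.
- exact: cvg_cst.
- exact: cvg_harmonic.
Qed.

(* The duplication formula halves the Lipschitz constant of [E]. *)
Let E_lip_pow n s t : 0 < s < 1 -> 0 < t < 1 ->
  `|E s - E t| <= L / 2 ^+ n * `|s - t|.
Proof.
elim: n s t => [|n IH] s t s01 t01; first by rewrite divr1; exact: E_lip.
have /andP[s0 s1] := s01; have /andP[t0 t1] := t01.
have -> : E s - E t = ((E (s / 2) - E (t / 2)) + (E ((s + 1) / 2) - E ((t + 1) / 2))) / 2.
  have -> : E s = (E (s / 2) + E ((s + 1) / 2)) / 2 by rewrite E_dup// mulrAC mulfV ?mul1r.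
  have -> : E t = (E (t / 2) + E ((t + 1) / 2)) / 2 by rewrite E_dup// mulrAC mulfV ?mul1r.
  by ring.
rewrite normrM (ger0_norm (_ : 0 <= 2^-1))// ler_pdivrMr//.
apply: (le_trans (ler_normD _ _)).
have h1 := IH (s / 2) (t / 2); have h2 := IH ((s + 1) / 2) ((t + 1) / 2).
apply: (le_trans (lerD (h1 _ _) (h2 _ _))); try by apply/andP; split; lra.
have -> : (s + 1) / 2 - (t + 1) / 2 = (s - t) / 2 by ring.
have -> : s / 2 - t / 2 = (s - t) / 2 by ring.
rewrite normrM (ger0_norm (_ : 0 <= 2^-1))// exprS.
have p2 : 2 ^+ n != 0 :> R by rewrite expf_neq0.
by rewrite le_eqVlt; apply/orP; left; apply/eqP; field.
Qed.

(** Herglotz's argument: partial sums and cotangent satisfy the same duplication formula, so the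
    limit [E] of their difference is Lipschitz with every constant L / 2^n. It is therefore
    constant, and it vanishes at 1/2. *)
Theorem cvg_cotsum s : 0 < s < 1 ->
  cotsum n s @[n --> \oo] --> pi * (cos (pi * s) / sin (pi * s)).
Proof.
move=> s01.
have E0 : E s = 0.
  apply/eqP; rewrite -normr_le0; apply/ler_addgt0Pl => e e0; rewrite addr0.
  have h : L / 2 ^+ n @[n --> \oo] --> (0 : R).
    rewrite -[X in _ --> X](mulr0 L); apply: cvgM; first exact: cvg_cst.
    under eq_fun do rewrite -exprVn.
    by apply: cvg_expr; rewrite ger0_norm// invf_lt1// ltr1n.
  have /cvgrPdist_lt/(_ _ e0)[N _ /(_ _ (leqnn _))] := h.
  rewrite /= sub0r normrN => /(le_lt_trans (ler_norm _)) HN.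
  have := E_lip_pow N s01 half01; rewrite E_half subr0 => /le_trans; apply.
  have d1 : `|s - 1 / 2| <= 1.
    by move: s01 => /andP[? ?]; rewrite ler_norml; apply/andP; split; lra.
  have L0 : 0 <= L / 2 ^+ N.
    by rewrite divr_ge0 ?exprn_ge0// /L !addr_ge0// mulr_ge0// exprn_ge0// pi_ge0.
  by apply: (le_trans (ler_wpM2l L0 d1)); rewrite mulr1 ltW.
have := E_cvg s01; rewrite E0 => /cvgD/(_ (cvg_cst (cotpi s))).
rewrite add0r; apply: cvg_trans; apply: near_eq_cvg.
by apply: nearW => n /=; rewrite /D subrK.
Qed.

End Herglotz.

(** * The function J *)

Section Jfun.
Context (R : realType).
Let mu : {measure set _ -> \bar R} := @lebesgue_measure R.
Implicit Types (p q u v x : R).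

Let D01 : set (measurableTypeR R) := `]0, 1[%classic.
Let D1y : set (measurableTypeR R) := `]1, +oo[%classic.
Let D0y : set (measurableTypeR R) := `]0, +oo[%classic.
Let mD01 : measurable D01. Proof. exact: measurable_itv. Qed.
Let mD1y : measurable D1y. Proof. exact: measurable_itv. Qed.
Let mD0y : measurable D0y. Proof. exact: measurable_itv. Qed.

(* [kap p] is the derivative of [Phi p u = (|1 - u|^p - 1) / p + u]. *)
Definition kap p v : R :=
  if v < 1 then 1 - (1 - v) `^ (p - 1) else 1 + (v - 1) `^ (p - 1).
Definition Phi p u : R := (`|1 - u| `^ p - 1) / p + u.

Lemma powR1D x r : 0 < x -> x `^ (1 + r) = x * x `^ r.
Proof. by move=> x0; rewrite powRD ?powRr1 ?(ltW x0)// (gt_eqF x0) implybT. Qed.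

Lemma measurable_kap p : measurable_fun setT (kap p).
Proof.
apply: measurable_fun_ifT; first exact: measurable_fun_ltr.
  by apply: measurable_funB => //; apply: measurable_fun_powR; exact: measurable_funB.
by apply: measurable_funD => //; apply: measurable_fun_powR; exact: measurable_funB.
Qed.

Lemma measurable_Phi p : measurable_fun setT (Phi p).
Proof.
apply: measurable_funD => //; apply: measurable_funM => //.
apply: measurable_funB => //; apply: measurable_fun_powR.
by apply: measurableT_comp => //; exact: measurable_funB.
Qed.

Lemma kap_lt1 p v : v < 1 -> kap p v = 1 - (1 - v) `^ (p - 1).
Proof. by rewrite /kap => ->. Qed.

Lemma kap_ge1 p v : 1 <= v -> kap p v = 1 + (v - 1) `^ (p - 1).
Proof. by rewrite /kap leNgt => /negbTE ->. Qed.

(* For p < 1, (1-v)^(p-1) - 1 = (1-v)^(p-1) (1 - (1-v)^(1-p)) <= v (1-v)^(p-1). *)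
Lemma kap_bound p v : 0 < p -> p < 2 -> 0 < v < 1 ->
  `|kap p v| <= v * (1 + (1 - v) `^ (p - 1)).
Proof.
move=> p0 p2 /andP[v0 v1]; rewrite kap_lt1//.
have w0 : 0 < 1 - v by rewrite subr_gt0.
have w1 : 1 - v <= 1 by rewrite gerBl ltW.
have w01 : 0 < 1 - v <= 1 by rewrite w0.
have -> : v = 1 - (1 - v) by ring.
move: (1 - v) w0 w1 w01 => w w0 w1 w01; rewrite (_ : 1 - (1 - w) = w); last by ring.
have P0 := powR_ge0 w (p - 1).
have [p1|p1] := leP 1 p.
  have h1 : w `^ (p - 1) <= 1.
    by rewrite -[leRHS](powRr0 w); apply: ger_powR => //; rewrite subr_ge0.
  have h2 : w <= w `^ (p - 1).
    by apply: ger1_powR => //; lra.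
  rewrite ger0_norm ?subr_ge0// mulrDr mulr1.
  have : 0 <= (1 - w) * w `^ (p - 1) by rewrite mulr_ge0 ?subr_ge0.
  lra.
have h1 : 1 <= w `^ (p - 1).
  by rewrite -[leLHS](powRr0 w); apply: ger_powR => //; lra.
have h2 : w `^ (p - 1) * w <= 1.
  rewrite mulrC mulr_powRB1 ?(ltW w0)//.
  by rewrite -[leRHS](powRr0 w); apply: ger_powR => //; lra.
rewrite ler0_norm ?subr_le0// opprB mulrDr mulr1 mulrBl mul1r.
move: h2; rewrite mulrC; lra.
Qed.

(* [Jfun beta p] is the integral of [kap p v * v^-beta]; the equation of case (ii)
   reads [Jfun beta nu = - (b / c)]. *)
Definition Jfun (beta p : R) : R :=
  Gamma p * (Gamma (beta - p) / Gamma beta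
             - (1 - beta + p) * Gamma (1 - beta) / Gamma (2 - beta + p)).

Implicit Types beta : R.

(** 1 - beta lies in ]-1, 0[, so exactly one step of the functional equation is taken in the
    definition. *)
Lemma Gamma_1B beta : 1 < beta -> beta < 2 -> Gamma (1 - beta) = Gamma (2 - beta) / (1 - beta).
Proof.
move=> b1 b2; have h1 : 0 < 2 - beta by lra.
rewrite (Gamma_pos_int h1) /Gamma ltNge subr_le0 ltW//=.
have -> : Num.truncn (- (1 - beta)) = 0%N.
  by apply: truncn_def; rewrite opprB; apply/andP; split; lra.
by rewrite big_ord1 addr0 (_ : 1 - beta + 1%:R = 2 - beta)//; ring.
Qed.

Let Beta a b : R := Gamma a * Gamma b / Gamma (a + b).

Definition kapB beta p v := kap p v * v `^ (- beta).

Lemma measurable_kapB beta p : measurable_fun setT (kapB beta p).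
Proof.
apply: measurable_funM; first exact: measurable_kap.
exact: measurable_powR.
Qed.

Lemma hasint_kap01 beta p : 1 < beta -> beta < 2 -> 0 < p -> p < 2 ->
  hasint mu D01 (kapB beta p) ((1 - (1 - beta + p) * Beta (2 - beta) p) / (1 - beta)).
Proof.
move=> b1 b2 p0 p2; have bb : 0 < 2 - beta by lra.
have hB := hasint_Beta bb p0.
have hP := hasint_powR01 bb.
have [A kA _] : exists2 I, hasint mu D01 (kapB beta p) I & `|I| <= (2 - beta)^-1 + Beta (2 - beta) p.
  apply: (hasint_dom mD01 _ (hasintD mD01 hP hB)).
    exact: measurable_funTS (measurable_kapB beta p).
  move=> v; rewrite /D01/= in_itv/= => v01; have /andP[v0 v1] := v01.
  rewrite /kapB normrM (ger0_norm (powR_ge0 _ _)).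
  have -> : 2 - beta - 1 = 1 + - beta by ring.
  rewrite powR1D// (_ : _ + _ = v * (1 + (1 - v) `^ (p - 1)) * v `^ (- beta)); last by ring.
  by rewrite ler_wpM2r ?powR_ge0// kap_bound.
(* Integration by parts in disguise: T' is a combination of [kapB] and a Beta integrand, and T runs
   from 0 to 1, so the integral of [kapB] is found by linearity. *)
pose T u : R := u `^ (1 - beta) * (1 - (1 - u) `^ p).
pose t u : R := (1 - beta) * ((1 - (1 - u) `^ (p - 1)) * u `^ (- beta)) +
  (1 - beta + p) * (u `^ (2 - beta - 1) * (1 - u) `^ (p - 1)).
have ht : hasint mu D01 t ((1 - beta) * A + (1 - beta + p) * Beta (2 - beta) p).
  apply: eq_hasint (hasintD mD01 (hasintZ _ mD01 kA) (hasintZ _ mD01 hB)) => // v.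
  by rewrite /D01/= in_itv/= => /andP[v0 v1]; rewrite /kapB kap_lt1.
have ht' : hasint mu D01 t (1 - 0).
  apply: (@integrable_FTC_oo _ _ _ _ T).
  - exact: ltr01.
  - move=> x /andP[x0 x1].
    have c1 := is_derive_cvg (is_derive_powR_1B (p - 1) x1).
    apply: cvgD; apply: cvgM; try exact: cvg_cst; apply: cvgM.
    + by apply: cvgB; [exact: cvg_cst|exact: c1].
    + exact: continuous_powR_gt0.
    + exact: continuous_powR_gt0.
    + exact: c1.
  - move=> x /andP[x0 x1].
    have d1 := is_derive1_powR (1 - beta) x0.
    have d2 := is_derive_powR_1B p x1.
    apply: is_derive_eq; rewrite /GRing.scale/= /t.
    have -> : (1 - x) `^ p = (1 - x) * (1 - x) `^ (p - 1).
      by rewrite mulr_powRB1// subr_ge0 ltW.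
    have -> : 2 - beta - 1 = 1 + - beta by ring.
    have -> : 1 - beta - 1 = - beta by ring.
    by rewrite !powR1D//; ring.
  (* Since p < 2, 1 - (1 - u)^p <= 1 - (1 - u)^2 <= 2 u, and beta < 2 makes the product vanish at
     0. *)
  - apply: (@squeeze_cvgr _ _ _ _ (fun=> 0) (fun u => 2 * u `^ (2 - beta))).
    + near=> u.
      have u0 : 0 < u by near: u; exact: nbhs_right_gt.
      have u1 : u < 1 by near: u; exact: nbhs_right_lt.
      have w01 : 0 < 1 - u <= 1 by apply/andP; split; lra.
      rewrite mulr_ge0 ?powR_ge0//=; last first.
        by rewrite subr_ge0 -[leRHS](powRr0 (1 - u)); apply: ger_powR => //; exact: ltW.
      have -> : 2 - beta = 1 + (1 - beta) by ring.
      rewrite powR1D// mulrA mulrC /T ler_wpM2l ?powR_ge0//.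
      have : (1 - u) ^+ 2 <= (1 - u) `^ p.
        by rewrite -powR_mulrn ?subr_ge0 ?(ltW u1)//; apply: ger_powR => //; exact: ltW.
      have := sqr_ge0 u; rewrite !expr2; nra.
    + exact: cvg_cst.
    + by rewrite -[X in _ --> X](mulr0 2); apply: cvgM; [exact: cvg_cst|exact: powR_cvg0].
  - have -> : 1 = 1 * (1 - 0) :> R by rewrite subr0 mulr1.
    rewrite [X in _ @[_ --> X^'-]](_ : _ = 1); last by rewrite subr0 mulr1.
    apply: cvgM; first by apply: cvg_at_left_filter; exact: cvg_powR1.
    apply: cvgB; first exact: cvg_cst.
    have h : `|1 - u| `^ p @[u --> (1 : R)^'-] --> (0 : R).
      apply: cvg_at_left_filter.
      have -> : 0 = (fun x : R => `|x| `^ p) (1 - 1) by rewrite /= subrr normr0 powR0 ?gt_eqF.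
      apply: (@continuous_comp _ _ _ (fun u : R => 1 - u) (fun x : R => `|x| `^ p) 1).
        by apply: cvgB; [exact: cvg_cst|exact: cvg_id].
      exact: continuous_norm_powR.
    apply: cvg_trans h; apply: near_eq_cvg; near=> u.
    by rewrite ger0_norm// subr_ge0 ltW//; near: u; exact: nbhs_left_lt.
  - exact: ht.1.
have E := hasint_unique ht ht'.
have b10 : 1 - beta != 0 by rewrite lt_eqF//; lra.
suff -> : (1 - (1 - beta + p) * Beta (2 - beta) p) / (1 - beta) = A by [].
apply: (mulfI b10); rewrite mulrC divfK//.
by apply/eqP; rewrite subr_eq E subr0.
Unshelve. all: end_near. Qed.

(** Translation by 1 turns (v - 1)^(p-1) v^(-beta) into the integrand of [hasint_BetaNy]; p < beta
    is convergence at infinity. *)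
Lemma hasint_kap1y beta p : 1 < beta -> beta < 2 -> 0 < p -> p < beta ->
  hasint mu D1y (kapB beta p) ((beta - 1)^-1 + Beta p (beta - p)).
Proof.
move=> b1 b2 p0 pb; have bp : 0 < beta - p by lra.
have bb : 1 - beta < 0 by lra.
have hP := hasint_powR1y bb.
have hB := hasint_BetaNy p0 bp.
have hB' : hasint mu D1y (fun v => (v - 1) `^ (p - 1) * v `^ (- beta)) (Beta p (beta - p)).
  have mf : measurable_fun setT (fun v : R => v `^ (p - 1) * (1 + v) `^ (- (p + (beta - p)))).
    apply: measurable_funM; first exact: measurable_powR.
    by apply: measurable_fun_powR; exact: measurable_funD.
  have := hasint_shift 1 mf (fun v => mulr_ge0 (powR_ge0 _ _) (powR_ge0 _ _)) hB.
  rewrite /Beta; apply: eq_hasint => // v _; congr (_ * _ `^ _); ring.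
rewrite (_ : (beta - 1)^-1 = - (1 - beta)^-1); last by rewrite -invrN opprB.
apply: eq_hasint (hasintD mD1y hP hB') => // v.
rewrite /D1y/= in_itv/= andbT => v1; rewrite /kapB kap_ge1 ?(ltW v1)// mulrDl mul1r.
by congr (v `^ _ + _); ring.
Qed.

Lemma hasint_kap0y beta p : 1 < beta -> beta < 2 -> 0 < p -> p < beta -> hasint mu D0y (kapB beta p) (Jfun beta p).
Proof.
move=> b1 b2 p0 pb; have p2 : p < 2 by lra.
have h := hasint_kap1y b1 b2 p0 pb.
have E : D0y = D01 `|` (`[1, +oo[%classic : set (measurableTypeR R)).
  exact: itv0y_setU.
have h2 : hasint mu (`[1, +oo[%classic : set (measurableTypeR R)) (kapB beta p) ((beta - 1)^-1 + Beta p (beta - p)).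
  by apply: hasint_obnd_cbnd h; exact: measurable_kapB.
have -> : Jfun beta p = (1 - (1 - beta + p) * Beta (2 - beta) p) / (1 - beta) + ((beta - 1)^-1 + Beta p (beta - p)).
  rewrite /Jfun /Beta (Gamma_1B b1 b2)/= (_ : p + (beta - p) = beta); last by ring.
  have g0 : Gamma beta != 0 by rewrite gt_eqF// Gamma_gt0//; lra.
  have g1 : Gamma (2 - beta + p) != 0 by rewrite gt_eqF// Gamma_gt0//; lra.
  field; rewrite g0 g1 /= gt_eqF ?lt_eqF//; lra.
rewrite E; apply: hasint_setU => //; last exact: hasint_kap01.
move=> x; rewrite /D01 /= !in_itv/= => /andP[_ x1].
by rewrite andbT leNgt x1.
Qed.

Lemma hasint_itv_setU3 (f : R -> R) (a b c I J : R) : a < b -> b < c ->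
  measurable_fun setT f -> hasint mu `]a, b[ f I -> hasint mu `]b, c[ f J ->
  hasint mu `]a, c[ f (I + J).
Proof.
move=> ab bc mf fI fJ.
pose D1 : set (measurableTypeR R) := [set b].
pose Da : set (measurableTypeR R) := `]a, b[%classic.
pose Db : set (measurableTypeR R) := `]b, c[%classic.
have m1 : measurable D1 by exact: measurable_set1.
have ma : measurable Da by exact: measurable_itv.
have mb : measurable Db by exact: measurable_itv.
have h1 : hasint mu D1 f 0.
  split; last exact: integral_set1.
  apply: null_set_integrable => //; last exact: lebesgue_measure_set1.
  by apply/measurable_EFinP; exact: measurable_funTS mf.
have E : `]a, c[%classic = (Da `|` D1) `|` Db.
  apply/seteqP; split=> x /=; rewrite !in_itv/=.
    move=> /andP[ax xc]; have [xb|xb|->] := ltgtP x b.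
    - by left; left; rewrite /Da/= in_itv/= ax.
    - by right; rewrite /Db/= in_itv/= xb.
    - by left; right.
  move=> [[|->]|]; rewrite /Da /Db /= ?in_itv/=.
  - by move=> /andP[-> /lt_trans ->].
  - by rewrite ab.
  - by move=> /andP[/(lt_trans ab) -> ->].
have h2 : hasint mu (Da `|` D1) f (I + 0).
  apply: hasint_setU => // x; rewrite /Da/= in_itv/= => /andP[_ xb] E1.
  by move: xb; rewrite E1 ltxx.
rewrite E -[I]addr0; apply: hasint_setU => //; first exact: measurableU.
move=> x; rewrite /Da /Db/= !in_itv/= => -[/andP[_ xb]|->] /andP[bx _].
  by have := lt_trans xb bx; rewrite ltxx.
by move: bx; rewrite ltxx.
Qed.

Lemma continuous_Phi p : 0 < p -> continuous (Phi p).
Proof.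
move=> p0 u; apply: cvgD; last exact: cvg_id.
apply: cvgM; last exact: cvg_cst.
apply: cvgB; last exact: cvg_cst.
apply: (@continuous_comp _ _ _ (fun u : R => 1 - u) (fun x : R => `|x| `^ p) u).
  by apply: cvgB; [exact: cvg_cst|exact: cvg_id].
exact: continuous_norm_powR.
Qed.

Lemma Phi0 p : Phi p 0 = 0.
Proof. by rewrite /Phi subr0 normr1 powR1 subrr mul0r addr0. Qed.

Lemma integrable_kap01 p : 0 < p -> mu.-integrable D01 (EFin \o kap p).
Proof.
move=> p0; have h1 := hasint_powR01 (@ltr01 R); have h2 := hasint_Beta (@ltr01 R) p0.
have [|v|I [] //] := @hasint_dom _ _ _ mu D01 (kap p) _ _ mD01 _ (hasintD mD01 h1 h2).
  exact: measurable_funTS (measurable_kap p).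
rewrite /D01/= in_itv/= => /andP[v0 v1]; rewrite kap_lt1// subrr powRr0 mul1r.
by rewrite (le_trans (ler_normB _ _))// normr1 ger0_norm ?powR_ge0.
Qed.

(** Below 1 the sign of [kap] depends on whether p exceeds 1, and for p < 1 it is unbounded at 1;
    hence the form of the fundamental theorem that takes integrability as input. *)
Let hasint_kap_Phi_le1 p u : 0 < p -> 0 < u -> u <= 1 ->
  hasint mu `]0, u[ (kap p) (Phi p u).
Proof.
move=> p0 u0 u1; have -> : Phi p u = Phi p u - Phi p 0 by rewrite Phi0 subr0.
pose Du : set (measurableTypeR R) := `]0, u[%classic.
have mDu : measurable Du by exact: measurable_itv.
have iu : mu.-integrable Du (EFin \o kap p).
  apply: integrableS (integrable_kap01 p0) => // x; rewrite /D01 /Du/= !in_itv/=.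
  by move=> /andP[-> xu]/=; exact: lt_le_trans u1.
pose f v : R := 1 - (1 - v) `^ (p - 1).
have Ef v : v < 1 -> kap p v = f v by move=> v1; rewrite kap_lt1.
have near_Phi v : v < 1 -> Phi p v = ((1 - v) `^ p - 1) / p + v.
  by move=> v1; rewrite /Phi ger0_norm// subr_ge0 ltW.
apply: (@eq_hasint _ _ _ mu Du f) => //.
  move=> v; rewrite /Du/= in_itv/= => /andP[_ vu]; rewrite Ef//.
  exact: lt_le_trans u1.
apply: (@integrable_FTC_oo _ 0 u f (fun v => ((1 - v) `^ p - 1) / p + v)) => //.
- move=> x /andP[x0 xu]; have x1 := lt_le_trans xu u1.
  apply: cvgB; first exact: cvg_cst.
  exact: is_derive_cvg (is_derive_powR_1B (p - 1) x1).
- move=> x /andP[x0 xu]; have x1 := lt_le_trans xu u1.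
  have d2 := is_derive_powR_1B p x1.
  by apply: is_derive_eq; rewrite /GRing.scale/= /f; field; rewrite gt_eqF.
- have := @continuous_Phi p p0 0; rewrite /continuous_at => /cvg_at_right_filter.
  apply: cvg_trans; apply: near_eq_cvg; near=> v.
  by rewrite -[LHS]/(Phi p v) near_Phi//; near: v; exact: nbhs_right_lt.
- have := @continuous_Phi p p0 u; rewrite /continuous_at => /cvg_at_left_filter.
  apply: cvg_trans; apply: near_eq_cvg; near=> v.
  rewrite -[LHS]/(Phi p v) near_Phi//; apply: lt_le_trans u1.
  by near: v; exact: nbhs_left_lt.
- apply: eq_integrable iu => // v /set_mem; rewrite /Du/= in_itv/= => /andP[_ vu].
  by rewrite Ef//; exact: lt_le_trans u1.
Unshelve. all: end_near. Qed.

Lemma hasint_kap_Phi p u : 0 < p -> 0 < u -> hasint mu `]0, u[ (kap p) (Phi p u).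
Proof.
move=> p0 u0; have [u1|u1] := leP u 1; first exact: hasint_kap_Phi_le1.
rewrite (_ : Phi p u = Phi p 1 + (Phi p u - Phi p 1)); last by ring.
apply: hasint_itv_setU3 => //; first exact: measurable_kap.
  exact: hasint_kap_Phi_le1.
pose Du : set (measurableTypeR R) := `]1, u[%classic.
pose f v : R := 1 + (v - 1) `^ (p - 1).
have near_Phi v : 1 < v -> Phi p v = ((v - 1) `^ p - 1) / p + v.
  by move=> v1; rewrite /Phi distrC ger0_norm// subr_ge0 ltW.
apply: (@eq_hasint _ _ _ mu Du f); first exact: measurable_itv.
  by move=> v; rewrite /Du/= in_itv/= => /andP[v1 _]; rewrite kap_ge1 ?ltW.
apply: (@ge0_FTC_oo _ 1 u f (fun v => ((v - 1) `^ p - 1) / p + v)) => //.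
- move=> x /andP[x1 xu].
  apply: cvgD; first exact: cvg_cst.
  exact: is_derive_cvg (is_derive_powR_B1 (p - 1) x1).
- move=> x /andP[x1 xu]; have d2 := is_derive_powR_B1 p x1.
  by apply: is_derive_eq; rewrite /GRing.scale/= /f; field; rewrite gt_eqF.
- have := @continuous_Phi p p0 1; rewrite /continuous_at => /cvg_at_right_filter.
  apply: cvg_trans; apply: near_eq_cvg; near=> v.
  by rewrite -[LHS]/(Phi p v) near_Phi//; near: v; exact: nbhs_right_gt.
- have := @continuous_Phi p p0 u; rewrite /continuous_at => /cvg_at_left_filter.
  apply: cvg_trans; apply: near_eq_cvg; near=> v.
  by rewrite -[LHS]/(Phi p v) near_Phi//; near: v; exact: nbhs_left_gt.
- by move=> x _; rewrite addr_ge0 ?powR_ge0.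
Unshelve. all: end_near. Qed.

Lemma measurable_lt_set d (T : measurableType d) (f g : T -> R) :
  measurable_fun setT f -> measurable_fun setT g ->
  measurable [set w | f w < g w].
Proof.
move=> mf mg; have := measurable_fun_ltr mf mg measurableT (Y := [set true]).
by rewrite setTI; apply.
Qed.

(** Fubini for k(w) kappa(v) on the region 0 < v < W(w). The weight [k] lets one statement serve
    probability laws (k = 1) and the Pareto density; [C] provides absolute integrability, as kappa
    may change sign. *)
Lemma layer_cake d (T : measurableType d) (m : {sigma_finite_measure set T -> \bar R})
    (W k : T -> R) (kappa F M : R -> R) (C : R) :
  measurable_fun setT W -> measurable_fun setT k -> (forall w, 0 <= k w) ->
  measurable_fun setT kappa ->
  (forall u, 0 < u -> hasint mu `]0, u[ kappa (F u)) ->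
  (forall v, 0 < v -> hasint m [set w | v < W w] k (M v)) ->
  hasint mu `]0, +oo[ (fun v => `|kappa v| * M v) C ->
  exists I, hasint mu `]0, +oo[ (fun v => kappa v * M v) I /\
            hasint m [set w | 0 < W w] (fun w => k w * F (W w)) I.
Proof.
move=> mW mk k0 mkappa HF HM HC.
pose f (z : T * R) : R :=
  if (0 < z.2) && (z.2 < W z.1) then k z.1 * kappa z.2 else 0.
have mf : measurable_fun setT f.
  apply: measurable_fun_ifT => //; last first.
    by apply: measurable_funM; [exact: measurableT_comp mk measurable_fst|
      exact: measurableT_comp mkappa measurable_snd].
  apply: measurable_and.
    by apply: measurable_fun_ltr => //; exact: measurable_snd.
  by apply: measurable_fun_ltr; [exact: measurable_snd|
    exact: measurableT_comp mW measurable_fst].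
have mWv v : measurable [set w | v < W w] by exact: measurable_lt_set.
have mD0 u : measurable (`]0, u[%classic : set (measurableTypeR R)) by exact: measurable_itv.
pose fE (z : T * measurableTypeR R) := (f z)%:E.
have mfE : measurable_fun setT fE by exact/measurable_EFinP.
have fG v : (\int[m]_w fE (w, v) = (((fun v => kappa v * M v) \_ D0y) v)%:E)%E.
  rewrite patchE mem_setE /D0y in_itv/= andbT; case: ifPn => v0; last first.
    by rewrite integral0_eq// => w _; rewrite /fE /f/= (negbTE v0).
  have [_ <-] := hasintZ (kappa v) (mWv v) (HM _ v0).
  rewrite [RHS]integral_mkcond; apply: eq_integral => w _.
  rewrite /fE /f/= v0 patchE/=; have [vW|vW] := ltP v (W w).
    by rewrite mem_set// mulrC.
  by rewrite memNset//= ltNge vW.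
have fGa v : (\int[m]_w `|fE (w, v)| = (((fun v => `|kappa v| * M v) \_ D0y) v)%:E)%E.
  rewrite patchE mem_setE /D0y in_itv/= andbT; case: ifPn => v0; last first.
    by rewrite integral0_eq// => w _; rewrite /fE /f/= (negbTE v0) normr0.
  have [_ <-] := hasintZ `|kappa v| (mWv v) (HM _ v0).
  rewrite [RHS]integral_mkcond; apply: eq_integral => w _.
  rewrite /fE /f/= v0 patchE/=; have [vW|vW] := ltP v (W w).
    by rewrite mem_set// normrM (ger0_norm (k0 w)) mulrC.
  by rewrite memNset//= ?normr0// ltNge vW.
pose W0 := [set w | 0 < W w].
have mW0 : measurable W0 by exact: mWv.
have fF w : (\int[lebesgue_measure]_v fE (w, v) = (((fun w => k w * F (W w)) \_ W0) w)%:E)%E.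
  rewrite patchE; have [w0|w0] := ltP 0 (W w); last first.
    rewrite memNset; last by rewrite /W0/= ltNge w0.
    rewrite integral0_eq// => v _; rewrite /fE /f/=; case: ifPn => //.
    by move=> /andP[v0 /(lt_trans v0)]; rewrite ltNge w0.
  rewrite mem_set//.
  have [_ <-] := hasintZ (k w) (mD0 (W w)) (HF _ w0).
  rewrite [RHS]integral_mkcond; apply: eq_integral => v _.
  by rewrite /fE /f/= patchE mem_setE/= in_itv/=; case: ifP.
have fi : (m \x (@lebesgue_measure R))%E.-integrable setT fE.
  apply/integrable21ltyP => //.
  under eq_integral do rewrite fGa.
  have [_ h] := (hasint_patch mu _ C mD0y).1 HC.
  by apply: (@le_lt_trans _ _ C%:E); [rewrite -h|rewrite ltry].
have iF := integrable_fubini_F fi; have mG := measurable_fubini_G fi.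
have M0 v : 0 < v -> 0 <= M v by move=> v0; apply: hasint_nng (HM _ v0) _.
have {mG} mG : measurable_fun setT ((fun v => kappa v * M v) \_ D0y).
  apply/measurable_EFinP; apply: eq_measurable_fun mG => v _; exact: fG.
have [|I HI _] := hasint_dom (f := (fun v => kappa v * M v) \_ D0y) measurableT
  mG ((hasint_patch mu _ C mD0y).1 HC).
  move=> v _; rewrite !patchE; case: ifPn => [/set_mem|_]; last by rewrite normr0.
  by rewrite /D0y/= in_itv/= andbT => v0; rewrite normrM (ger0_norm (M0 _ v0)).
exists I; split; first exact/hasint_patch.
apply/hasint_patch => //; split.
  by apply: eq_integrable iF => // w _; exact: fF.
have [_ <-] := HI.
transitivity (\int[m]_w \int[lebesgue_measure]_v fE (w, v))%E.
  by apply: eq_integral => w _; rewrite fF.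
rewrite (Fubini fi).
by apply: eq_integral => v _; rewrite fG.
Qed.

Lemma hasint_norm_kap0y beta p : 1 < beta -> beta < 2 -> 0 < p -> p < beta ->
  exists C, hasint mu `]0, +oo[ (fun v => `|kap p v| * v `^ (- beta)) C.
Proof.
move=> b1 b2 p0 pb; have [C HC] := hasint_norm mD0y (hasint_kap0y b1 b2 p0 pb).
exists C; apply: eq_hasint HC => // v _.
by rewrite /kapB normrM (ger0_norm (powR_ge0 _ _)).
Qed.

(** This form makes monotonicity in p visible: [Phi] increases with p at every point, whereas [kap]
    decreases with p on ]1, 2[. *)
Lemma hasint_Pareto beta p : 1 < beta -> beta < 2 -> 0 < p -> p < beta ->
  hasint mu `]0, +oo[ (fun u => beta * u `^ (- beta - 1) * Phi p u) (Jfun beta p).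
Proof.
move=> b1 b2 p0 pb; have b0 : 0 < beta by lra.
have [C HC] := hasint_norm_kap0y b1 b2 p0 pb.
have E v : [set w : R | v < w] = `]v, +oo[%classic.
  by apply/seteqP; split => x /=; rewrite in_itv/= andbT.
have [|||||||I [HI1 HI2]] := @layer_cake _ (measurableTypeR R) (@lebesgue_measure R) id
  (fun u => beta * u `^ (- beta - 1)) (kap p) (Phi p) (fun v => v `^ (- beta)) C.
- exact: measurable_id.
- by apply: measurable_funM => //; exact: measurable_powR.
- by move=> w; rewrite mulr_ge0 ?powR_ge0 ?ltW.
- exact: measurable_kap.
- by move=> u u0; exact: hasint_kap_Phi.
- by move=> v v0; rewrite E; exact: hasint_powR_tail.
- exact: HC.
have -> : Jfun beta p = I by apply: hasint_unique HI1; exact: hasint_kap0y.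
by move: HI2; rewrite E.
Qed.

(* Strict convexity of [p |-> x ^ p], via tangents of [expR]. *)
Lemma powR_slope_lt x p q : 0 < x -> x != 1 -> 0 < p -> p < q ->
  (x `^ p - 1) / p < (x `^ q - 1) / q.
Proof.
move=> x0 x1 p0 pq; have q0 := lt_trans p0 pq.
rewrite /powR (gt_eqF x0); set l := ln x.
have l0 : l != 0 by rewrite /l ln_eq0.
have h1 : 1 + - (p * l) < expR (- (p * l)).
  by apply: expR_gt1Dx; rewrite oppr_eq0 mulf_neq0// gt_eqF.
have h2 : 1 + (q - p) * l < expR ((q - p) * l).
  by apply: expR_gt1Dx; rewrite mulf_neq0// subr_eq0 gt_eqF.
set a := expR (p * l).
have a0 : 0 < a by exact: expR_gt0.
have E1 : a * expR (- (p * l)) = 1 by rewrite -expRD subrr expR0.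
have E2 : a * expR ((q - p) * l) = expR (q * l) by rewrite -expRD; congr expR; ring.
have h1' : a * (1 + - (p * l)) < 1 by rewrite -[ltRHS]E1 ltr_pM2l.
have h2' : a * (1 + (q - p) * l) < expR (q * l) by rewrite -E2 ltr_pM2l.
rewrite ltr_pdivrMr// mulrAC ltr_pdivlMr//.
have h3 : (q - p) * (a * (1 + - (p * l))) < (q - p) * 1 by rewrite ltr_pM2l ?subr_gt0.
have h4 : p * (a * (1 + (q - p) * l)) < p * expR (q * l) by rewrite ltr_pM2l.
have : (q - p) * (a * (1 + - (p * l))) + p * (a * (1 + (q - p) * l)) = q * a by ring.
move: (expR (q * l)) h3 h4 => b; lra.
Qed.

Lemma Phi_le p q u : 0 < p -> p < q -> Phi p u <= Phi q u.
Proof.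
move=> p0 pq; have q0 := lt_trans p0 pq; rewrite /Phi lerD2r.
have [->|x0] := eqVneq `|1 - u| 0.
  rewrite !powR0 ?gt_eqF// !sub0r !mulN1r lerN2 lef_pV2 ?posrE//; exact: ltW.
have [->|x1] := eqVneq `|1 - u| 1; first by rewrite !powR1 !subrr !mul0r.
by apply/ltW/powR_slope_lt => //; rewrite lt_def x0/=.
Qed.

Lemma Phi_lt p q u : 0 < p -> p < q -> 2 < u -> Phi p u < Phi q u.
Proof.
move=> p0 pq u2; rewrite /Phi ltrD2r distrC ger0_norm; last by lra.
by apply: powR_slope_lt => //; [lra|rewrite gt_eqF//; lra].
Qed.

(** Equality would force the nonnegative difference of the Pareto integrands to vanish almost
    everywhere, but it is positive on ]2, 3[. *)
Lemma Jfun_lt beta p q : 1 < beta -> beta < 2 -> 0 < p -> p < q -> q < beta ->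
  Jfun beta p < Jfun beta q.
Proof.
move=> b1 b2 p0 pq qb; have q0 := lt_trans p0 pq; have pb := lt_trans pq qb.
have b0 : 0 < beta by lra.
have hp := hasint_Pareto b1 b2 p0 pb; have hq := hasint_Pareto b1 b2 q0 qb.
pose g u : R := beta * u `^ (- beta - 1) * Phi q u - beta * u `^ (- beta - 1) * Phi p u.
have h : hasint mu D0y g (Jfun beta q - Jfun beta p) := hasintB mD0y hq hp.
have k0 u : 0 <= beta * u `^ (- beta - 1) by rewrite mulr_ge0 ?powR_ge0 ?ltW.
have d0 u : 0 <= g u by rewrite /g -mulrBr mulr_ge0// subr_ge0 Phi_le.
rewrite lt_neqAle -subr_ge0 (hasint_nng h)// andbT.
apply/negP => /eqP E; move: h; rewrite E subrr => -[hi hI].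
have H0 : (\int[mu]_(x in D0y) `|(EFin \o g) x| = 0)%E.
  by rewrite -[RHS]hI; apply: eq_integral => x _ /=; rewrite ger0_norm.
have [N [mN N0 sub]] := (@ae_eq_integral_abs _ _ _ mu _ mD0y _ (measurable_int _ hi)).1 H0.
have sub' : (`]2, 3[%classic : set (measurableTypeR R)) `<=` N.
  move=> x /=; rewrite in_itv/= => /andP[x2 x3]; apply: sub => /= H.
  have x0 : 0 < x by lra.
  have : g x = 0.
    by have := H _; rewrite /D0y/= in_itv/= andbT => /(_ x0) [].
  apply/eqP; rewrite /g -mulrBr mulf_eq0 subr_eq0 (gt_eqF (Phi_lt _ _ x2))// orbF.
  by rewrite gt_eqF// mulr_gt0// powR_gt0.
have : (mu `]2%R, 3%R[%classic <= mu N)%E by apply: le_measure => //; rewrite inE//; exact: measurable_itv.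
rewrite N0 /mu/= lebesgue_measure_itv/= lte_fin (_ : 2 < 3 :> R) ?ltr_nat// -EFinB lee_fin; lra.
Qed.

Lemma continuous_exponent x l : 0 < x -> {for l, continuous (fun l : R => x `^ l)}.
Proof.
move=> x0; have -> : (fun l => x `^ l) = (fun l => expR (l * ln x)).
  by apply/funext => t; rewrite /powR gt_eqF.
apply: continuous_comp; last exact: continuous_expR.
by apply: cvgM; [exact: cvg_id|exact: cvg_cst].
Qed.

Lemma continuous_exponent_ge0 x l : 0 <= x -> 0 < l ->
  {for l, continuous (fun l : R => x `^ l)}.
Proof.
rewrite le_eqVlt => /predU1P[<-|x0 _]; last exact: continuous_exponent.
move=> l0; rewrite /prop_for /continuous_at powR0 ?gt_eqF//.
apply: cvg_near_cst; near=> t; apply: powR0; rewrite gt_eqF//.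
by near: t; exact: lt_nbhsr.
Unshelve. all: end_near. Qed.

(** For a < q < c monotonicity in the exponent puts [Phi q] between [Phi a] and [Phi c], so |Phi a|
    + |Phi c| dominates near p. *)
Lemma continuous_Jfun beta p : 1 < beta -> beta < 2 -> 0 < p -> p < beta ->
  {for p, continuous (Jfun beta)}.
Proof.
move=> b1 b2 p0 pb; have b0 : 0 < beta by lra.
have [a a0 ap] : exists2 a, 0 < a & a < p by exists (p / 2); lra.
have [c pc cb] : exists2 c, p < c & c < beta by exists ((p + beta) / 2); lra.
pose k u : R := beta * u `^ (- beta - 1).
have k0 u : 0 <= k u by rewrite mulr_ge0 ?powR_ge0 ?ltW.
have H q : a <= q -> q <= c -> hasint mu D0y (fun u => k u * Phi q u) (Jfun beta q).
  by move=> aq qc; apply: hasint_Pareto => //; lra.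
clearbody k; have ac : a <= c by lra.
have [Ja HJa] := hasint_norm mD0y (H a (lexx _) ac).
have [Jc HJc] := hasint_norm mD0y (H c ac (lexx _)).
have Hg := hasintD mD0y HJa HJc.
have pin : p \in (`]a, c[%classic : set R) by apply/mem_set; rewrite /= in_itv/= ap pc.
have X := @continuity_under_integral R _ (measurableTypeR R) mu (fun q u => k u * Phi q u)
  D0y mD0y a c _ _ _ Hg.1 _ p pin.
have {X} : {for p, continuous (fun l => \int[mu]_(x in D0y) (k x * Phi l x))}.
  apply: X.
  - by move=> x /=; rewrite in_itv/= => /andP[/ltW ax /ltW xc]; exact: (H x ax xc).1.
  - apply: aeW => u _ q /set_mem; rewrite /= in_itv/= => /andP[aq qc].
    apply: cvgM; first exact: cvg_cst.
    apply: cvgD; last exact: cvg_cst.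
    apply: cvgM.
      by apply: cvgB; [apply: continuous_exponent_ge0; [|lra]|exact: cvg_cst].
    by apply: cvgV; [rewrite gt_eqF//; lra|exact: cvg_id].
  - move=> q /=; rewrite in_itv/= => /andP[aq qc]; apply: aeW => u _.
    rewrite !normrM (ger0_norm (k0 u)) -mulrDr ler_wpM2l//.
    have h1 := Phi_le u a0 aq; have h2 : Phi q u <= Phi c u by apply: Phi_le => //; lra.
    have n1 := ler_norm (- Phi a u); rewrite normrN in n1.
    have n2 := ler_norm (Phi c u).
    have n3 := normr_ge0 (Phi a u); have n4 := normr_ge0 (Phi c u).
    by rewrite ler_norml; apply/andP; split; lra.
rewrite /prop_for /continuous_at => X.
have E q : a < q -> q < c -> \int[mu]_(x in D0y) (k x * Phi q x) = Jfun beta q.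
  by move=> aq qc; rewrite /Rintegral (H q _ _).2//; exact: ltW.
rewrite -E//; apply: cvg_trans X; apply: near_eq_cvg; near=> q.
by apply: E; near: q; [exact: lt_nbhsr|exact: lt_nbhsl].
Unshelve. all: end_near. Qed.

Lemma hasint_powR_1B01 b : 0 < b -> hasint mu `]0, 1[ (fun t => (1 - t) `^ (b - 1)) b^-1.
Proof.
move=> b0; have := hasint_Beta (@ltr01 R) b0.
rewrite Gamma1 mul1r [1 + b]addrC GammaS// (_ : Gamma b / (b * Gamma b) = b^-1); last first.
  by field; rewrite !gt_eqF// Gamma_gt0.
by apply: eq_hasint => // t _; rewrite subrr powRr0 mul1r.
Qed.

Lemma Jfun_split beta p : 1 < beta -> beta < 2 -> 0 < p -> p < beta ->
  Jfun beta p = (1 - (1 - beta + p) * (Gamma (2 - beta) * Gamma p / Gamma (2 - beta + p))) / (1 - beta)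
    + ((beta - 1)^-1 + Gamma p * Gamma (beta - p) / Gamma (p + (beta - p))).
Proof.
move=> b1 b2 p0 pb; rewrite /Jfun (Gamma_1B b1 b2) (_ : p + (beta - p) = beta); last by ring.
have g0 : Gamma beta != 0 by rewrite gt_eqF// Gamma_gt0//; lra.
have g1 : Gamma (2 - beta + p) != 0 by rewrite gt_eqF// Gamma_gt0//; lra.
by field; rewrite g0 g1 /= gt_eqF ?lt_eqF//; lra.
Qed.

(** The contribution of ]0, 1[ increases with p, hence is bounded below on [beta/2, beta[. In the
    Beta term, 1 + v <= 2 v beyond 1 gives at least 2^(-beta) / (beta - p). *)
Lemma Jfun_unbounded beta A : 1 < beta -> beta < 2 ->
  exists p, [/\ 0 < p, p < beta & A < Jfun beta p].
Proof.
move=> b1 b2.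
pose a p := (1 - (1 - beta + p) * (Gamma (2 - beta) * Gamma p / Gamma (2 - beta + p))) / (1 - beta).
have ha p : 0 < p -> p < beta -> a (beta / 2) <= a p \/ p < beta / 2.
  move=> p0 pb; have [pb2|] := leP (beta / 2) p; last by right.
  left; have h1 := hasint_kap01 b1 b2 (_ : 0 < beta / 2) (_ : beta / 2 < 2).
  have h2 := hasint_kap01 b1 b2 p0 (lt_trans pb b2).
  apply: (hasint_le mD01 (h1 _ _) h2); try lra.
  move=> v; rewrite /D01/= in_itv/= => /andP[v0 v1].
  rewrite /kapB ler_wpM2r ?powR_ge0// !kap_lt1// lerD2l lerN2.
  by apply: ger_powR; [apply/andP; split; lra|lra].
pose w : R := 2 `^ (- beta).
have w0 : 0 < w by rewrite powR_gt0.
have hB p : 0 < p -> p < beta -> w / (beta - p) <= Gamma p * Gamma (beta - p) / Gamma (p + (beta - p)).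
  move=> p0 pb; have bp : 0 < beta - p by rewrite subr_gt0.
  have h1 := hasint_BetaNy p0 bp.
  pose D1 : set (measurableTypeR R) := `]1, +oo[%classic.
  have mD1 : measurable D1 by exact: measurable_itv.
  have D10 : D1 `<=` D0y.
    by move=> x; rewrite /D1 /D0y/= !in_itv/= !andbT; apply: lt_trans.
  have [J HJ] := hasint_subset mD0y mD1 D10 h1.
  have pos x : D0y x -> 0 <= x `^ (p - 1) * (1 + x) `^ (- (p + (beta - p))).
    by move=> _; rewrite mulr_ge0 ?powR_ge0.
  apply: le_trans (hasint_subset_le mD0y mD1 D10 pos h1 HJ).
  have pb0 : p - beta < 0 by rewrite subr_lt0.
  have h2 := hasintZ w mD1 (hasint_powR1y pb0).
  have -> : w / (beta - p) = w * - (p - beta)^-1 by rewrite -invrN opprB.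
  apply: (hasint_le mD1 h2 HJ) => x; rewrite /D1/= in_itv/= andbT => x1.
  have x0 : 0 < x by lra.
  have -> : p + (beta - p) = beta by ring.
  have -> : p - beta - 1 = (p - 1) + - beta by ring.
  rewrite powRD; last by rewrite (gt_eqF x0) implybT.
  rewrite mulrCA ler_wpM2l ?powR_ge0// /w -powRM ?(ltW x0)//.
  rewrite !powRN lef_pV2 ?posrE; try (apply: powR_gt0; lra).
  by apply: ge0_ler_powR; rewrite ?nnegrE; lra.
pose B := `|A - a (beta / 2)| + 1.
have B0 : 0 < B by rewrite ltr_wpDl.
(* Close enough to beta for w / (beta - p) to exceed [B], while p stays at least beta / 2. *)
pose p := beta - Num.min (beta / 2) (w / B).
have m0 : 0 < Num.min (beta / 2) (w / B) by rewrite lt_min !divr_gt0//; lra.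
have m1 : Num.min (beta / 2) (w / B) <= beta / 2 by rewrite ge_min lexx.
have m2 : Num.min (beta / 2) (w / B) <= w / B by rewrite ge_min lexx orbT.
have p0 : 0 < p by rewrite /p; lra.
have pb : p < beta by rewrite /p; lra.
exists p; split => //; rewrite Jfun_split// -/(a p).
have [h1|h1] := ha p p0 pb; last by move: h1; rewrite /p; lra.
have h2 := hB p p0 pb.
have h3 : B <= w / (beta - p).
  have -> : beta - p = Num.min (beta / 2) (w / B) by rewrite /p; ring.
  by rewrite ler_pdivlMr// mulrC -ler_pdivlMr.
have h4 : 0 < (beta - 1)^-1 by rewrite invr_gt0 subr_gt0.
have h5 := ler_norm (A - a (beta / 2)).
move: (_ / Gamma _) h2 => G h2; rewrite /B in h3; lra.
Qed.

(* With s = beta - 1, t^(p-1) ((1-t)^-s - (1-t)^(s-p)) increases as p decreases to 0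
   and its limit t^-1 ((1-t)^-s - (1-t)^s) is a geometric series in 1 - t,
   whose integral is a partial fraction sum of the cotangent. *)
Lemma Jfun_near0 beta y : 1 < beta -> beta < 2 ->
  pi * (cos (pi * (beta - 1)) / sin (pi * (beta - 1))) < y ->
  exists p, [/\ 0 < p, p < beta & Jfun beta p < y].
Proof.
move=> b1 b2; set C := pi * _ => Cy.
have [s sE [s0 s1]] : exists2 s, s = beta - 1 & 0 < s /\ s < 1.
  by exists (beta - 1) => //; split; lra.
(* Two losses of e occur, one in [H] and one in [BE]; the last third leaves strict inequality. *)
pose e := (y - C) / 3; have e0 : 0 < e by rewrite /e; lra.
pose p_ (n : nat) : R := s / n.+1%:R.
have p0 n : 0 < p_ n by rewrite divr_gt0.
have ps n : p_ n <= s by rewrite ler_pdivrMr// ler_peMr ?ler1n// ltW.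
pose h n t : R := t `^ (p_ n - 1) * ((1 - t) `^ (- s) - (1 - t) `^ (s - p_ n)).
(* J (p) equals - H + (p / s) B(p, 1 - s), where B is the Beta integral. Here H comes within e of
   1/s - C from below and the second term within e of 1/s from above, so the two 1/s cancel and C is
   left. *)
pose H n : R := Gamma (p_ n) * Gamma (1 - s) / Gamma (p_ n + (1 - s)) -
  Gamma (p_ n) * Gamma (beta - p_ n) / Gamma (p_ n + (beta - p_ n)).
have bp n : 0 < beta - p_ n by have := ps n; lra.
have hB n : hasint mu D01 (fun t => t `^ (p_ n - 1) * (1 - t) `^ (- s))
    (Gamma (p_ n) * Gamma (1 - s) / Gamma (p_ n + (1 - s))).
  have s10 : 0 < 1 - s by rewrite subr_gt0.
  have := hasint_Beta (p0 n) s10; apply: eq_hasint => // t _.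
  by congr (_ * _ `^ _); ring.
have hh n : hasint mu D01 (h n) (H n).
  have := hasintB mD01 (hB n) (hasint_Beta (p0 n) (bp n)).
  apply: eq_hasint => // t _; rewrite /h mulrBr; congr (_ - _ * _ `^ _).
  by rewrite sE; ring.
pose h_oo t : R := t^-1 * ((1 - t) `^ (- s) - (1 - t) `^ s).
have h_ge0 n t : 0 < t < 1 -> 0 <= h n t.
  move=> /andP[t0 t1]; rewrite mulr_ge0 ?powR_ge0// subr_ge0.
  by apply: ger_powR; [apply/andP; split; lra|have := ps n; lra].
have h_nd t : 0 < t < 1 -> {homo (fun n => h n t) : n m / (n <= m)%N >-> n <= m}.
  move=> /andP[t0 t1] n m nm.
  have pnm : p_ m <= p_ n by rewrite ler_pM2l// lef_pV2 ?posrE// ler_nat.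
  apply: ler_pM; rewrite ?powR_ge0//.
  - by rewrite subr_ge0; apply: ger_powR; [apply/andP; split; lra|have := ps n; lra].
  - by apply: ger_powR; [apply/andP; split; lra|lra].
  - by rewrite lerD2l lerN2; apply: ger_powR; [apply/andP; split; lra|lra].
have h_cvg t : 0 < t < 1 -> h n t @[n --> \oo] --> h_oo t.
  move=> /andP[t0 t1].
  have pc : p_ n @[n --> \oo] --> (0 : R) by exact: cvg_harmonicM.
  have E : h_oo t = t `^ (0 - 1) * ((1 - t) `^ (- s) - (1 - t) `^ (s - 0)).
    by rewrite /h_oo sub0r powR_inv1 ?ltW// subr0.
  have w0 : 0 < 1 - t by lra.
  have c1 : t `^ (p_ n - 1) @[n --> \oo] --> t `^ (0 - 1).
    apply: (@cvg_comp _ _ _ (fun n => p_ n - 1) (fun l => t `^ l)); last exact: continuous_exponent.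
    by apply: cvgB => //; exact: cvg_cst.
  have c2 : (1 - t) `^ (s - p_ n) @[n --> \oo] --> (1 - t) `^ (s - 0).
    apply: (@cvg_comp _ _ _ (fun n => s - p_ n) (fun l => (1 - t) `^ l)); last exact: continuous_exponent.
    by apply: cvgB => //; exact: cvg_cst.
  by rewrite E; apply: cvgM => //; apply: cvgB => //; exact: cvg_cst.
(* Termwise integral of the truncated geometric series [g]; it equals 1/s minus the cotangent sum at
   s. *)
pose S N : R := \sum_(m < N) ((m.+1%:R - s)^-1 - (m.+1%:R + s)^-1).
pose g (N : nat) t : R := \sum_(m < N) ((1 - t) `^ (m.+1%:R - s - 1) - (1 - t) `^ (m.+1%:R + s - 1)).
have hg N : hasint mu D01 (g N) (S N).
  elim: N => [|N IH].
    have := hasintZ 0 mD01 (hasint_powR_1B01 ltr01).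
    rewrite mul0r /S big_ord0; apply: eq_hasint => // t _.
    by rewrite /g big_ord0 mul0r.
  have m0 : 0 < N.+1%:R - s by rewrite subr_gt0 (lt_le_trans s1)// ler1n.
  have m1 : 0 < N.+1%:R + s by rewrite addr_gt0.
  have := hasintD mD01 IH (hasintB mD01 (hasint_powR_1B01 m0) (hasint_powR_1B01 m1)).
  rewrite /S big_ord_recr/=; apply: eq_hasint => // t _.
  by rewrite /g big_ord_recr.
have g_le N t : 0 < t < 1 -> g N t <= h_oo t.
  move=> /andP[t0 t1].
  have w0 : 0 < 1 - t by lra.
  have E : g N t = (\sum_(m < N) (1 - t) ^+ m) * ((1 - t) `^ (- s) - (1 - t) `^ s).
    rewrite /g mulr_suml; apply: eq_bigr => m _.
    have -> : m.+1%:R - s - 1 = m%:R + - s :> R by rewrite -natr1; ring.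
    have -> : m.+1%:R + s - 1 = m%:R + s :> R by rewrite -natr1; ring.
    by rewrite !powRD ?(gt_eqF w0) ?implybT// powR_mulrn ?ltW// mulrBr.
  rewrite E /h_oo ler_wpM2r//.
    by rewrite subr_ge0; apply: ger_powR; [apply/andP; split; lra|lra].
  rewrite -(ler_pM2l t0) mulfV ?gt_eqF//.
  have -> : t * \sum_(m < N) (1 - t) ^+ m = 1 - (1 - t) ^+ N.
    have := subrX1 (1 - t) N; rewrite (_ : 1 - t - 1 = - t); last by ring.
    by move=> /(congr1 -%R); rewrite opprB mulNr opprK => ->.
  by rewrite gerBl exprn_ge0// ltW.
have S_cvg : S n @[n --> \oo] --> s^-1 - C.
  have s01 : 0 < s < 1 by rewrite s0.
  have := cvg_cotsum s01; rewrite -/C sE -/C => h1.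
  have -> : S = (fun n => (beta - 1)^-1 - cotsum n (beta - 1)).
    apply/funext => n; rewrite /S /cotsum opprD addrA subrr sub0r -sumrN sE.
    apply: eq_bigr => m _.
    move: (beta - 1) => z; rewrite opprD -(invrN (z - _)) opprB.
    by rewrite [LHS]addrC [z + _]addrC.
  by apply: cvgB => //; exact: cvg_cst.
have [N SN] : exists N, s^-1 - C - e < S N.
  have /cvgrPdist_lt/(_ _ e0)[N _ /(_ _ (leqnn _))] := S_cvg.
  by rewrite /= ltr_norml => /andP[h1 h2]; exists N; lra.
have [n1 Hn1] : exists n1, forall n, (n1 <= n)%N -> p_ n / (s * (1 - s)) <= e.
  have pc : (s * (s * (1 - s))^-1) * n.+1%:R^-1 @[n --> \oo] --> (0 : R) by exact: cvg_harmonicM.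
  have /cvgrPdist_lt/(_ _ e0)[n1 _ Hn] := pc; exists n1 => n /Hn.
  rewrite /= sub0r normrN => /ltW/(le_trans (ler_norm _)).
  by rewrite mulrAC.
have D01E t : D01 t -> 0 < t < 1 by rewrite /D01/= in_itv.
have [n n1n Hn] : exists2 n, (n1 <= n)%N & s^-1 - C - e < H n.
  apply/not_exists2P => Hle.
  have Hle' n : (n1 <= n)%N -> H n <= s^-1 - C - e.
    by move=> n1n; have [|/negP] := Hle n; rewrite // -leNgt.
  have lim : (\int[mu]_(t in D01) (h n t)%:E)%E @[n --> \oo] --> (\int[mu]_(t in D01) (h_oo t)%:E)%E.
    have E : {in D01, (fun t => (h_oo t)%:E) =1 (fun t => limn (fun n => (h n t)%:E))}.
      move=> t /set_mem/D01E t01; apply/esym/cvg_lim => //.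
      by apply: cvg_EFin; [exact: nearW|exact: h_cvg].
    rewrite (eq_integral _ _ E).
    apply: (@cvg_monotone_convergence _ _ _ mu D01 mD01 (fun n t => (h n t)%:E)).
    - by move=> n; exact: measurable_int (hh n).1.
    - by move=> n t /D01E; rewrite lee_fin; exact: h_ge0.
    - by move=> t /D01E t01 i j ij; rewrite lee_fin; exact: h_nd.
  have up : (\int[mu]_(t in D01) (h_oo t)%:E <= (s^-1 - C - e)%:E)%E.
    rewrite -(cvg_lim (@ereal_hausdorff R) lim); apply: lime_le.
      by apply/cvg_ex; eexists; exact: lim.
    exists n1 => // n /= n1n.
    by rewrite (hh n).2 lee_fin; exact: Hle'.
  have lo : ((S N)%:E <= \int[mu]_(t in D01) (h_oo t)%:E)%E.
    rewrite -(hg N).2; apply: ge0_le_integral => //.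
    - move=> t /D01E/andP[t0 t1]; rewrite lee_fin; apply: sumr_ge0 => m _.
      rewrite subr_ge0; apply: ger_powR; [apply/andP; split; lra|lra].
    - exact: measurable_int (hg N).1.
    - apply: (emeasurable_fun_cvg (fun n t => (h n t)%:E)).
        by move=> n; exact: measurable_int (hh n).1.
      by move=> t /D01E t01; apply: cvg_EFin; [exact: nearW|exact: h_cvg].
    - by move=> t /D01E; rewrite lee_fin; exact: g_le.
  by have := le_trans lo up; rewrite lee_fin; lra.
have BE : (p_ n / s) * (Gamma (p_ n) * Gamma (1 - s) / Gamma (p_ n + (1 - s))) <= s^-1 + e.
  have s10 : 0 < 1 - s by rewrite subr_gt0.
  have := hasint_le mD01 (hB n) (hasintD mD01 (hasint_powR01 (p0 n)) (hasint_powR_1B01 s10)).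
  have le t : D01 t -> t `^ (p_ n - 1) * (1 - t) `^ (- s) <= t `^ (p_ n - 1) + (1 - t) `^ (- s).
    move=> /D01E/andP[t0 t1].
    have w0 : 0 < 1 - t by lra.
    have l r x : 0 < x -> x < 1 -> -1 <= r -> r <= 0 -> 1 <= x `^ r <= x^-1.
      move=> x0 x1 r1 r0; rewrite -(powR_inv1 (ltW x0)) -{1}(powRr0 x).
      by apply/andP; split; apply: ger_powR => //; apply/andP; split; rewrite ?ltW.
    have /andP[A1 A2] : 1 <= t `^ (p_ n - 1) <= t^-1.
      by apply: l => //; have := p0 n; have := ps n; lra.
    have /andP[B1 B2] : 1 <= (1 - t) `^ (- s) <= (1 - t)^-1 by apply: l => //; lra.
    move: (_ `^ _) A1 A2 => A A1 A2; move: (_ `^ _) B1 B2 => B B1 B2.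
    (* This is A B <= A + B; it holds because A <= 1/t, B <= 1/(1-t) and (1/t - 1)(1/(1-t) - 1) =
       1. *)
    suff : (A - 1) * (B - 1) <= 1 by lra.
    apply: (@le_trans _ _ ((t^-1 - 1) * ((1 - t)^-1 - 1))).
      by apply: ler_pM; rewrite ?subr_ge0// lerD2r.
    by rewrite le_eqVlt (_ : _ * _ = 1) ?eqxx//; field; rewrite !gt_eqF.
  rewrite (_ : 1 - s - 1 = - s); last by ring.
  move=> /(_ le) BB.
  have ps0 : 0 <= p_ n / s by rewrite divr_ge0 ?ltW.
  apply: (le_trans (ler_wpM2l ps0 BB)).
  have pn0 := p0 n; have := Hn1 n n1n; move: (p_ n) pn0 => r r0 Hr.
  have -> : r / s * (r^-1 + (1 - s)^-1) = s^-1 + r / (s * (1 - s)).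
    by field; rewrite !gt_eqF.
  by rewrite lerD2l.
exists (p_ n); split => //; first by have := bp n; lra.
have -> : Jfun beta (p_ n) = - H n + (p_ n / s) * (Gamma (p_ n) * Gamma (1 - s) / Gamma (p_ n + (1 - s))).
  rewrite /H Jfun_split//; last by have := bp n; lra.
  rewrite (_ : p_ n + (beta - p_ n) = beta); last by ring.
  have g1 : Gamma (p_ n + (1 - s)) != 0.
    by rewrite gt_eqF// Gamma_gt0// addr_gt0// subr_gt0.
  have g2 : Gamma beta != 0 by rewrite gt_eqF// Gamma_gt0//; lra.
  have -> : 2 - beta + p_ n = p_ n + (1 - s) by rewrite sE; ring.
  have -> : 2 - beta = 1 - s by rewrite sE; ring.
  have bs : beta = 1 + s by rewrite sE; ring.
  have -> : 1 - beta = - s by rewrite bs; ring.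
  have -> : beta - 1 = s by rewrite bs; ring.
  move: (Gamma (p_ n + _)) g1 => G1 g1; move: (Gamma beta) g2 => G2 g2.
  move: (Gamma (1 - s)) (Gamma (p_ n)) (Gamma (beta - _)) => G3 G4 G5.
  by field; rewrite g1 g2 /= ?oppr_eq0 gt_eqF.
by move: BE Hn; rewrite /e; move: (p_ n / s * _) => B; lra.
Qed.

Lemma Jfun_root beta y : 1 < beta -> beta < 2 ->
  pi * (cos (pi * beta) / sin (pi * beta)) < y ->
  exists p, [/\ 0 < p, p < beta & Jfun beta p = y].
Proof.
move=> b1 b2 cy.
(* The cotangent has period pi, and beta - 1 lies in ]0, 1[, where the partial fractions are
   available. *)
have {}cy : pi * (cos (pi * (beta - 1)) / sin (pi * (beta - 1))) < y.
  rewrite mulrBr mulr1 cosB sinB cospi sinpi !mulr0 addr0 subr0 !mulrN1.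
  by rewrite invrN mulrNN.
have [p [p0 pb pJ]] := Jfun_near0 b1 b2 cy.
have [q [q0 qb qJ]] := Jfun_unbounded y b1 b2.
have pq : p <= q.
  have [//|/ltW qp] := leP p q.
  have : Jfun beta q <= Jfun beta p.
    move: qp; rewrite le_eqVlt => /predU1P[->//|qp]; apply: ltW.
    exact: Jfun_lt.
  by lra.
have [||r] := @IVT R (Jfun beta) p q y pq.
  apply: continuous_in_subspaceT => t /set_mem; rewrite /= in_itv/= => /andP[pt tq].
  by apply: continuous_Jfun => //; lra.
  by rewrite ge_min le_max (ltW pJ) (ltW qJ) orbT.
rewrite in_itv/= => /andP[pr rq] <-; exists r; split => //; lra.
Qed.

(** At this exponent the functional equation turns both quotients into (2 - beta) Gamma (2 - beta) /
    ((beta - 1) Gamma (beta - 1)). *)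
Lemma Jfun_eq0 beta : 3 / 2 < beta -> beta < 2 -> Jfun beta (2 * beta - 3) = 0.
Proof.
move=> b1 b2; rewrite /Jfun Gamma_1B//; last lra.
have -> : beta - (2 * beta - 3) = (2 - beta) + 1 by ring.
have -> : 2 - beta + (2 * beta - 3) = beta - 1 by ring.
have -> : 1 - beta + (2 * beta - 3) = beta - 2 by ring.
have e1 : Gamma beta = (beta - 1) * Gamma (beta - 1).
  by rewrite -GammaS ?subrK// subr_gt0; lra.
have bb : 0 < beta - 1 by lra.
rewrite e1 GammaS ?subr_gt0//; have := Gamma_gt0 bb.
move: (Gamma (beta - 1)) (Gamma (2 - beta)) (Gamma _) => x y z x0.
have h1 : 1 - beta != 0 by rewrite lt_eqF//; lra.
by field; rewrite h1 (gt_eqF x0) (gt_eqF bb).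
Qed.

End Jfun.

(** * One-step asymptotics *)

Section Jump.
Context (R : realType) d (T : measurableType d).
Implicit Types (P : probability T R) (eta : T -> R).
Let mu : {measure set _ -> \bar R} := @lebesgue_measure R.
Let D0y : set (measurableTypeR R) := `]0, +oo[%classic.
Let mD0y : measurable D0y. Proof. exact: measurable_itv. Qed.

Lemma powRN_le_large (B eps th : R) : 0 < th -> 0 < eps ->
  exists2 r0, 1 <= r0 & forall r, r0 <= r -> B * r `^ (- th) <= eps.
Proof.
move=> th0 e0; pose b := `|B| / eps.
have b0 : 0 <= b by rewrite divr_ge0// ltW.
exists (1 + b `^ th^-1); first by rewrite lerDl powR_ge0.
move=> r rr0; have bt := powR_ge0 b th^-1.
have r1 : 0 < r by lra.
have h : b <= r `^ th.
  have -> : b = (b `^ th^-1) `^ th by rewrite -powRrM mulVf ?gt_eqF// powRr1.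
  by apply: ge0_ler_powR; rewrite ?nnegrE; lra.
rewrite powRN; apply: (le_trans (ler_wpM2r _ (ler_norm B))).
  by rewrite invr_ge0 powR_ge0.
by rewrite ler_pdivrMr ?powR_gt0// mulrC -ler_pdivrMr.
Qed.

Lemma powR_le_1D (x s a : R) : 0 <= x -> 0 <= s -> s <= a -> x `^ s <= 1 + x `^ a.
Proof.
move=> x0 s0 sa; have [x1|/ltW x1] := leP x 1; last first.
  by rewrite (le_trans (ler_powR x1 sa))// lerDr.
have : x `^ s <= 1 `^ s by apply: ge0_ler_powR; rewrite ?nnegrE.
by rewrite powR1 => /le_trans; apply; rewrite lerDl powR_ge0.
Qed.

Definition tail P eta (y : R) : R := fine (P [set w | y < eta w]).

Lemma measurable_gt_set eta y : measurable_fun setT eta -> measurable [set w | y < eta w].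
Proof.
move=> meta; rewrite -[X in measurable X]setTI.
rewrite (_ : [set w | _] = eta @^-1` `]y, +oo[); first exact: meta.
by apply/seteqP; split=> w /=; rewrite in_itv/= andbT.
Qed.

Lemma hasint_cst P E k : measurable E -> hasint P E (fun=> k) (k * fine (P E)).
Proof.
move=> mE; split.
  by apply: finite_measure_integrable_cst.
by rewrite integral_cst// EFinM fineK// fin_num_measure.
Qed.

Lemma tail_ge0 P eta y : 0 <= tail P eta y.
Proof. by rewrite fine_ge0. Qed.

Lemma tail_le1 P eta y : measurable_fun setT eta -> tail P eta y <= 1.
Proof.
move=> meta; rewrite -lee_fin fineK ?probability_le1//; first exact: measurable_gt_set.
by rewrite fin_num_measure//; exact: measurable_gt_set.
Qed.

Lemma tail_ni P eta y z : measurable_fun setT eta -> y <= z -> tail P eta z <= tail P eta y.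
Proof.
move=> meta yz; apply: fine_le; try by rewrite fin_num_measure//; exact: measurable_gt_set.
apply: le_measure; rewrite ?inE; try exact: measurable_gt_set.
by move=> w /=; exact: le_lt_trans.
Qed.

(** Up to [Y] the trivial bound 1 costs the factor Y^beta. The constant depends on the law only
    through [Y] and [c], so it is uniform in the starting point. *)
Lemma tail_le_powR P eta beta c Y : measurable_fun setT eta -> 0 < beta -> 0 <= Y -> 0 <= c ->
  (forall y, Y < y -> `|y `^ beta * tail P eta y - c| <= 1) ->
  forall y, 0 < y -> tail P eta y <= (Y `^ beta + c + 1) * y `^ (- beta).
Proof.
move=> meta b0 Y0 c0 HY y y0.
have yb : 0 < y `^ beta by exact: powR_gt0.
rewrite powRN ler_pdivlMr//; have [yY|Yy] := leP y Y.
  have : y `^ beta <= Y `^ beta by apply: ge0_ler_powR; rewrite ?nnegrE// ltW.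
  have := tail_le1 P y meta; have := tail_ge0 P eta y.
  move: (tail _ _ _) (y `^ _) (Y `^ _) yb => t a b a0 t0 t1 ab.
  have : t * a <= a by rewrite ler_piMl// ltW.
  by lra.
have := HY _ Yy; rewrite ler_norml => /andP[_]; have := powR_ge0 Y beta; lra.
Qed.

Lemma measurable_tail P eta r : 0 <= r -> measurable_fun setT eta ->
  measurable_fun (setT : set (measurableTypeR R)) (fun v : R => tail P eta (r * v)).
Proof.
move=> r0 meta; apply: nonincreasing_measurable => // v w vw.
by apply: tail_ni => //; rewrite ler_wpM2l.
Qed.

(* The factor [(Y e / u)^th >= 1] pays for the range [u <= Y e], where only the crude
   tail bound is available. *)
Lemma jump_pos beta p c (Y : R -> R) eps : 1 < beta -> beta < 2 -> 0 < p -> p < beta ->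
  0 <= c -> (forall e, 0 <= Y e) -> 0 < eps ->
  exists2 r0, 1 <= r0 & forall P eta, measurable_fun setT eta ->
    (forall e, 0 < e -> forall y, Y e < y -> `|y `^ beta * tail P eta y - c| <= e) ->
    forall r, r0 <= r -> exists2 I, hasint P [set w | 0 < eta w] (fun w => Phi p (eta w / r)) I &
      `|I - c * Jfun beta p * r `^ (- beta)| <= eps * r `^ (- beta).
Proof.
move=> b1 b2 p0 pb c0 Y0 eps0; have b0 : 0 < beta by lra.
(* Keeps beta + th < 2, so [kap] remains integrable at 0 against the steeper power. *)
pose th := (2 - beta) / 2; have th0 : 0 < th by rewrite /th; lra.
have [N HN] := hasint_norm_kap0y b1 b2 p0 pb.
have [N' HN'] : exists N', hasint mu D0y (fun v => `|kap p v| * v `^ (- (beta + th))) N'.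
  by apply: hasint_norm_kap0y; rewrite /th; lra.
have N0 : 0 <= N by apply: (hasint_nng HN) => v _; rewrite mulr_ge0 ?powR_ge0.
(* The limit of the tail costs e N <= eps / 2; the range of crude bounds costs the other half once r
   is large. *)
pose e := eps / (2 * (N + 1)); have e0 : 0 < e by rewrite divr_gt0// mulr_gt0//; lra.
pose K := Y 1 `^ beta + c + 1.
have [||r0 r01 Hr0] := @powRN_le_large ((K + c) * Y e `^ th * N') (eps / 2) th; [lra|lra|].
exists r0 => // P eta meta HY r rr0; have r0' : 0 < r by lra.
have tK y : 0 < y -> tail P eta y <= K * y `^ (- beta).
  by apply: tail_le_powR => //; exact: HY.
have K0 : 0 <= K by rewrite /K; have := powR_ge0 (Y 1) beta; lra.
have mtail := measurable_tail P (ltW r0') meta.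
have splitr v : 0 < v -> (r * v) `^ (- beta) = r `^ (- beta) * v `^ (- beta).
  by move=> v0; rewrite powRM ?ltW.
have [C HC _] : exists2 C, hasint mu D0y (fun v => `|kap p v| * tail P eta (r * v)) C
    & `|C| <= (K * r `^ (- beta)) * N.
  apply: (hasint_dom mD0y _ (hasintZ (K * r `^ (- beta)) mD0y HN)).
    apply: measurable_funTS; apply: measurable_funM => //.
    by apply: measurableT_comp => //; exact: measurable_kap.
  move=> v; rewrite /D0y/= in_itv/= andbT => v0.
  rewrite normrM normr_id (ger0_norm (tail_ge0 _ _ _)) mulrCA ler_wpM2l//.
  by rewrite -mulrA -splitr//; apply: tK; exact: mulr_gt0.
have sub : [set w | 0 < eta w] = [set w | 0 < eta w / r].
  by apply/seteqP; split => w /=; rewrite pmulr_lgt0 ?invr_gt0.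
have meta' : measurable_fun setT (fun w => eta w / r).
  by apply: measurable_funM => //.
have [|||||||I [H1 H2]] := @layer_cake R _ T P (fun w => eta w / r) (fun=> 1)
   (kap p) (Phi p) (fun v => tail P eta (r * v)) C.
- exact: meta'.
- exact: measurable_cst.
- by [].
- exact: measurable_kap.
- by move=> u u0; exact: hasint_kap_Phi.
- move=> v v0; have -> : [set w | v < eta w / r] = [set w | r * v < eta w].
    by apply/seteqP; split => w /=; rewrite ltr_pdivlMr// mulrC.
  have := @hasint_cst P [set w | r * v < eta w] 1 (measurable_gt_set _ meta).
  by rewrite mul1r.
- exact: HC.
exists I.
  rewrite sub; apply: eq_hasint H2; first exact: measurable_gt_set meta'.
  by move=> w _; rewrite mul1r.
have HJ := hasintZ (c * r `^ (- beta)) mD0y (hasint_kap0y b1 b2 p0 pb).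
have HD := hasintB mD0y H1 HJ.
have HU := hasintD mD0y (hasintZ (e * r `^ (- beta)) mD0y HN)
  (hasintZ ((K + c) * Y e `^ th * r `^ (- th) * r `^ (- beta)) mD0y HN').
have key u : 0 < u ->
    `|tail P eta u - c * u `^ (- beta)| <= e * u `^ (- beta) + (K + c) * Y e `^ th * u `^ (- (beta + th)).
  move=> u0; have ub : 0 < u `^ beta by exact: powR_gt0.
  have ubN : 0 < u `^ (- beta) by exact: powR_gt0.
  have ut : 0 < u `^ (- (beta + th)) by exact: powR_gt0.
  have Yt := powR_ge0 (Y e) th.
  have Kc : 0 <= K + c by lra.
  have [uY|Yu] := leP u (Y e).
    have le1 : u `^ (- beta) <= Y e `^ th * u `^ (- (beta + th)).
      rewrite opprD powRD ?(gt_eqF u0) ?implybT// mulrCA ler_peMr ?(ltW ubN)//.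
      rewrite powRN ler_pdivlMr ?powR_gt0// mul1r.
      by apply: ge0_ler_powR; rewrite ?nnegrE ?(ltW u0)//; lra.
    have h1 := tK u u0; have h2 := tail_ge0 P eta u.
    have h3 := ler_wpM2l Kc le1.
    have h4 := mulr_ge0 K0 (ltW ubN); have h5 := mulr_ge0 c0 (ltW ubN).
    have h6 := mulr_ge0 (ltW e0) (ltW ubN).
    rewrite mulrA in h3; rewrite mulrDl in h3.
    by rewrite ler_norml; apply/andP; split; lra.
  have h1 := HY e e0 u Yu.
  have -> : tail P eta u - c * u `^ (- beta) = u `^ (- beta) * (u `^ beta * tail P eta u - c).
    by rewrite powRN; move: (tail _ _ _) => t; field; rewrite gt_eqF.
  rewrite normrM gtr0_norm// (le_trans (ler_wpM2l (ltW ubN) h1))// mulrC lerDl.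
  by rewrite !mulr_ge0 ?(ltW ut).
have [|I' HI' leI'] := hasint_dom mD0y (hasint_measurable HD) HU.
  move=> v; rewrite /D0y/= in_itv/= andbT => v0.
  have := ler_wpM2l (normr_ge0 (kap p v)) (key _ (mulr_gt0 r0' v0)).
  rewrite -normrM opprD powRM ?(ltW r0')// ?(ltW v0)// powRM ?(ltW r0')// ?(ltW v0)//.
  rewrite [r `^ (- beta + _)]powRD ?(gt_eqF r0') ?implybT//.
  rewrite /kapB; move: (kap p v) (tail P eta _) (v `^ _) (v `^ _) (r `^ _) (r `^ _) => B t x y z w h.
  rewrite (_ : B * t - c * w * (B * y) = B * (t - c * (w * y))); last by ring.
  by apply: (le_trans h); rewrite le_eqVlt; apply/orP; left; apply/eqP; ring.
rewrite mulrAC (hasint_unique HD HI'); apply: (le_trans leI').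
have rb : 0 < r `^ (- beta) by exact: powR_gt0.
have h2 := Hr0 r rr0.
have h1 : e * N <= eps / 2.
  rewrite /e mulrAC ler_pdivrMr; last by rewrite mulr_gt0//; lra.
  by rewrite mulrA divfK// ler_wpM2l ?ltW//; lra.
have -> : eps * r `^ (- beta) = (eps / 2) * r `^ (- beta) + (eps / 2) * r `^ (- beta) by field.
apply: lerD; first by rewrite mulrAC ler_wpM2r ?(ltW rb).
by rewrite [X in X <= _]mulrAC (mulrAC _ (r `^ (- th))) ler_wpM2r ?(ltW rb).
Qed.

(** Monotonicity in the exponent compares [Phi p] with the exponents m and 2 from above, and with
    the limiting exponent 0, the logarithm, from below. The constant 4 bounds 2^m in (1 + x)^m <= (2
    x)^m. *)
Lemma norm_Phi_neg (p m x : R) : 0 < p -> p <= m -> 1 <= m -> m <= 2 -> 0 < x ->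
  `|Phi p (- x)| <= 4 * x `^ m.
Proof.
move=> p0 pm m1 m2 x0; have m0 : 0 < m by lra.
have y0 : 0 < 1 + x by lra.
have E q : Phi q (- x) = ((1 + x) `^ q - 1) / q - x by rewrite /Phi opprK ger0_norm//; lra.
have xm0 : 0 < x `^ m by exact: powR_gt0.
have lo : - (x ^+ 2 / (1 + x)) <= Phi p (- x).
  have h1 : ln (1 + x) <= ((1 + x) `^ p - 1) / p.
    rewrite ler_pdivlMr// mulrC; have := expR_ge1Dx (p * ln (1 + x)).
    by rewrite /powR (gt_eqF y0); lra.
  have i0 : 0 < (1 + x)^-1 by rewrite invr_gt0.
  have h2 : -1 < (1 + x)^-1 - 1 by lra.
  have h3 : 1 - (1 + x)^-1 <= ln (1 + x).
    by have := le_ln1Dx h2; rewrite addrC subrK lnV ?posrE//; lra.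
  have h4 : - (x ^+ 2 / (1 + x)) = 1 - (1 + x)^-1 - x by field; rewrite gt_eqF.
  by rewrite E h4; lra.
have hi : Phi p (- x) <= Phi m (- x).
  by move: pm; rewrite le_eqVlt => /predU1P[->//|]; exact: Phi_le.
have x2 : x ^+ 2 / (1 + x) <= x ^+ 2.
  by rewrite ler_pdivrMr// ler_peMr ?exprn_ge0 ?ltW//; lra.
have [x1|x1] := leP x 1.
  have h1 : x ^+ 2 <= x `^ m.
    by rewrite -powR_mulrn ?(ltW x0)//; apply: ger_powR => //; rewrite x0.
  have h2 : Phi m (- x) <= x ^+ 2 / 2.
    have -> : x ^+ 2 / 2 = Phi 2 (- x).
      by rewrite E (_ : (2 : R) = 2%:R)// powR_mulrn ?(ltW y0)//; field.
    by move: m2; rewrite le_eqVlt => /predU1P[->//|]; exact: Phi_le.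
  by rewrite ler_norml; apply/andP; split; lra.
have h1 : x <= x `^ m by rewrite -{1}[x]powRr1 ?(ltW x0)//; apply: ler_powR => //; exact: ltW.
have h2 : x ^+ 2 / (1 + x) <= x.
  by rewrite ler_pdivrMr//; lra.
have h3 : (1 + x) `^ m <= 4 * x `^ m.
  apply: (@le_trans _ _ ((2 * x) `^ m)).
    by apply: ge0_ler_powR; rewrite ?nnegrE; lra.
  rewrite powRM ?(ltW x0)// ler_wpM2r ?(ltW xm0)//.
  have -> : (4 : R) = 2 `^ 2%:R by rewrite powR_mulrn//; ring.
  by apply: ler_powR => //; lra.
have h4 : ((1 + x) `^ m - 1) / m <= 4 * x `^ m.
  rewrite ler_pdivrMr//; have : 4 * x `^ m <= 4 * x `^ m * m by rewrite ler_peMr//; lra.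
  by lra.
by move: hi; rewrite (E m) ler_norml => hi; apply/andP; split; lra.
Qed.

(** Layer cake for u^s: levels below 1 contribute at most 1, levels above 1 the integral of the
    power bound. *)
Lemma tail_moment P eta (K beta s : R) : measurable_fun setT eta -> 0 < s -> s < beta ->
  (forall y, 0 < y -> tail P eta y <= K * y `^ (- beta)) ->
  exists2 I, hasint P [set w | 0 < eta w] (fun w => eta w `^ s) I & I <= 1 + K * (s / (beta - s)).
Proof.
move=> meta s0 sb HK; have bs : s - beta < 0 by lra.
pose f v := s * v `^ (s - 1) * tail P eta v.
have mt : measurable_fun (setT : set (measurableTypeR R)) (tail P eta).
  have := measurable_tail P (@ler01 R) meta.
  by under eq_fun do rewrite mul1r.
have mf D : measurable_fun (D : set (measurableTypeR R)) f.
  apply: measurable_funTS; apply: measurable_funM => //.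
  by apply: measurable_funM => //; exact: measurable_powR.
have f0 v : 0 <= f v by rewrite !mulr_ge0 ?tail_ge0 ?powR_ge0 ?(ltW s0).
pose D01 : set (measurableTypeR R) := `]0, 1[%classic.
have mD01 : measurable D01 by exact: measurable_itv.
pose D1y : set (measurableTypeR R) := `]1, +oo[%classic.
have mD1y : measurable D1y by exact: measurable_itv.
have [|I1 H1 L1] := hasint_dom mD01 (mf _) (hasintZ s mD01 (hasint_powR01 s0)).
  by move=> v _; rewrite ger0_norm// ler_piMr ?tail_le1// mulr_ge0 ?powR_ge0 ?(ltW s0).
have [|I2 H2 L2] := hasint_dom mD1y (mf _) (hasintZ (K * s) mD1y (hasint_powR1y bs)).
  move=> v; rewrite /D1y/= in_itv/= andbT => v1; have v0 : 0 < v by lra.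
  have sv : 0 <= s * v `^ (s - 1) by rewrite mulr_ge0 ?powR_ge0 ?(ltW s0).
  rewrite ger0_norm// (le_trans (ler_wpM2l sv (HK _ v0)))//.
  have -> : s - beta - 1 = (s - 1) + - beta by ring.
  rewrite [v `^ (s - 1 - beta)]powRD ?(gt_eqF v0) ?implybT//.
  by rewrite le_eqVlt; apply/orP; left; apply/eqP; ring.
have HI : hasint mu D0y f (I1 + I2).
  rewrite /D0y itv0y_setU; apply: hasint_setU => //.
  - by move=> x /=; rewrite !in_itv/= => /andP[_ x1]; rewrite andbT leNgt x1.
  - by apply: hasint_obnd_cbnd H2; exact: mf.
have [|||||||I [H3 H4]] := @layer_cake R _ T P eta (fun=> 1)
   (fun v => s * v `^ (s - 1)) (fun u => u `^ s) (tail P eta) (I1 + I2).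
- exact: meta.
- exact: measurable_cst.
- by [].
- by apply: measurable_funM => //; exact: measurable_powR.
- by move=> u u0; exact: hasint_powR0.
- move=> v v0; have := @hasint_cst P [set w | v < eta w] 1 (measurable_gt_set _ meta).
  by rewrite mul1r.
- apply: eq_hasint HI => // v _; rewrite ger0_norm//.
  by rewrite mulr_ge0 ?powR_ge0 ?(ltW s0).
exists I.
  apply: eq_hasint H4; first exact: measurable_gt_set meta.
  by move=> w _; rewrite mul1r.
rewrite (hasint_unique H3 HI); have n1 := ler_norm I1; have n2 := ler_norm I2.
have e1 : s * s^-1 = 1 by rewrite mulfV// gt_eqF.
have e2 : K * s * - (s - beta)^-1 = K * (s / (beta - s)) by rewrite -invrN opprB mulrA.
by lra.
Qed.

Lemma measurable_neg_set eta : measurable_fun setT eta -> measurable [set w | eta w < 0].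
Proof.
move=> meta; have mN : measurable_fun setT (fun w => - eta w) by exact: measurableT_comp.
have := measurable_gt_set 0 mN.
by congr (measurable _); apply/seteqP; split => w /=; rewrite oppr_gt0.
Qed.

(** Applied with m > beta, this is o(r^(-beta)): outward jumps do not contribute to J. *)
Lemma jump_neg P eta (p m alpha M r : R) : measurable_fun setT eta ->
  0 < p -> p <= m -> 1 <= m -> m <= 2 -> m <= alpha ->
  (\int[P]_w ((Num.max 0 (- eta w)) `^ alpha)%:E <= M%:E)%E -> 0 < r ->
  exists2 I, hasint P [set w | eta w < 0] (fun w => Phi p (eta w / r)) I &
    `|I| <= 4 * (1 + M) * r `^ (- m).
Proof.
move=> meta p0 pm m1 m2 ma HM r0.
have m0 : 0 < m by lra.
have mN := measurable_neg_set meta.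
have mX : measurable_fun setT (fun w => Num.max 0 (- eta w) `^ alpha).
  apply: measurable_fun_powR; apply: measurable_maxr => //.
  exact: measurableT_comp.
have [||A HA A0] := @hasint_ge0_lty _ T R P setT _ measurableT mX.
- by move=> w _; exact: powR_ge0.
- by apply: le_lt_trans HM _; exact: ltry.
have AM : A <= M by move: HM; rewrite HA.2 lee_fin.
have [B HB] := hasint_subset measurableT mN (@subsetT _ _) HA.
have BA : B <= A.
  by apply: (hasint_subset_le measurableT mN _ _ HA HB) => // w _; exact: powR_ge0.
have H1 := hasint_cst P 1 mN; rewrite mul1r in H1.
have HU := hasintZ (4 * r `^ (- m)) mN (hasintD mN H1 HB).
have [||I HI LI] := @hasint_dom _ T R P _ (fun w => Phi p (eta w / r)) _ _ mN _ HU.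
- apply: measurable_funTS; apply: measurableT_comp; first exact: measurable_Phi.
  exact: measurable_funM.
- move=> w /= ew; have x0 : 0 < - eta w / r by rewrite divr_gt0// oppr_gt0.
  have := norm_Phi_neg p0 pm m1 m2 x0; rewrite mulNr opprK => /le_trans; apply.
  rewrite -mulNr powRM; [|lra|by rewrite invr_ge0 ltW].
  rewrite -mulrA ler_wpM2l// mulrC -powR_inv1 ?(ltW r0)// -powRrM mulN1r.
  rewrite ler_wpM2l ?powR_ge0// max_r; last by rewrite oppr_ge0 ltW.
  by apply: powR_le_1D => //; [rewrite oppr_ge0 ltW|exact: ltW].
exists I => //; apply: (le_trans LI); rewrite mulrAC ler_wpM2r ?powR_ge0// ler_wpM2l//.
apply: lerD; last exact: le_trans AM.
by rewrite -lee_fin fineK ?probability_le1// fin_num_measure.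
Qed.

(** [r0] is chosen before the law [P], which makes the expansion uniform over starting points.
    Subtracting the linear part in [Phi] isolates the mean, so the drift enters exactly. *)
Lemma jump_asymp (alpha beta p c M : R) (Y : R -> R) eps : 1 < beta -> beta < 2 -> beta < alpha ->
  0 < p -> p < beta -> 0 <= c -> (forall e, 0 <= Y e) -> 0 < eps ->
  exists2 r0, 1 <= r0 & forall P eta mean, measurable_fun setT eta ->
    (forall e, 0 < e -> forall y, Y e < y -> `|y `^ beta * tail P eta y - c| <= e) ->
    (\int[P]_w ((Num.max 0 (- eta w)) `^ alpha)%:E <= M%:E)%E ->
    hasint P setT eta mean ->
    forall r, r0 <= r -> exists2 I, hasint P setT (fun w => `|r - eta w| `^ p) I &
      `|I - (r `^ p - p * r `^ (p - 1) * mean + c * p * Jfun beta p * r `^ (p - beta))|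
        <= eps * r `^ (p - beta).
Proof.
move=> b1 b2 ba p0 pb c0 Y0 e0.
(* The moment of order alpha controls only m <= alpha, and the quadratic behaviour of [Phi] at 0
   requires m <= 2; both bounds exceed beta. *)
pose m := Num.min alpha 2.
have mb : beta < m by rewrite lt_min ba.
have ma : m <= alpha by rewrite ge_min lexx.
have m2 : m <= 2 by rewrite ge_min lexx orbT.
have e1 : 0 < eps / (2 * p) by rewrite divr_gt0// mulr_gt0.
have [r1 r11 H1] := jump_pos b1 b2 p0 pb c0 Y0 e1.
have [|r2 r21 H2] := @powRN_le_large (4 * (1 + M)) (eps / (2 * p)) (m - beta) _ e1.
  by rewrite subr_gt0.
exists (Num.max r1 r2); first by rewrite le_max r11.
move=> P eta mean meta HY HM Hm r; rewrite ge_max => /andP[r1r r2r].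
have r0 : 0 < r by lra.
have [I1 HI1 L1] := H1 P eta meta HY r r1r.
have pm : p <= m by lra.
have m1 : 1 <= m by lra.
have [I2 HI2 L2] := jump_neg meta p0 pm m1 m2 ma HM r0.
have mP : measurable [set w | 0 < eta w] by exact: measurable_gt_set.
have mN := measurable_neg_set meta.
have mZ : measurable [set w | eta w = 0].
  by have := meta measurableT [set 0] (measurable_set1 0); rewrite setTI.
have HZ : hasint P [set w | eta w = 0] (fun w => Phi p (eta w / r)) 0.
  have := hasint_cst P 0 mZ; rewrite mul0r; apply: eq_hasint => // w /= ->.
  by rewrite mul0r Phi0.
have HI : hasint P setT (fun w => Phi p (eta w / r)) (I1 + I2).
  have -> : [set: T] = ([set w | 0 < eta w] `|` [set w | eta w < 0]) `|` [set w | eta w = 0].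
    apply/seteqP; split => w //= _.
    by have [|/ltW|] := ltgtP (eta w) 0; [left; right|left; left|right].
  rewrite -[I1 + I2]addr0; apply: hasint_setU => //.
  - exact: measurableU.
  - by move=> w [] /= h1 h2; rewrite h2 ltxx in h1.
  - apply: hasint_setU => // w /= h1 h2; have := lt_trans h1 h2; by rewrite ltxx.
have rp : 0 < r `^ p by exact: powR_gt0.
have HT := hasint_cst P (r `^ p) (@measurableT _ T).
rewrite probability_setT/= mulr1 in HT.
have HE := hasintD measurableT (hasintB measurableT HT (hasintZ (p * r `^ (p - 1)) measurableT Hm))
  (hasintZ (p * r `^ p) measurableT HI).
eexists.
  apply: (eq_hasint measurableT _ HE) => w _; rewrite /Phi.
  have E : `|r - eta w| `^ p = r `^ p * `|1 - eta w / r| `^ p.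
    rewrite -powRM ?(ltW r0)//; congr (_ `^ _).
    rewrite -[X in X * _](gtr0_norm r0) -normrM; congr (`|_|).
    by field; rewrite gt_eqF.
  have E1 : r `^ (p - 1) = r `^ p / r.
    by rewrite powRD ?(gt_eqF r0) ?implybT// powR_inv1 ?(ltW r0).
  rewrite E E1; move: (`|_| `^ _) (r `^ _) => x y.
  by field; rewrite !gt_eqF.
have E2 : r `^ (p - beta) = r `^ p * r `^ (- beta).
  by rewrite powRD ?(gt_eqF r0) ?implybT.
have h2 : `|I2| <= eps / (2 * p) * r `^ (- beta).
  apply: (le_trans L2); have -> : - m = - (m - beta) + - beta by ring.
  rewrite powRD ?(gt_eqF r0) ?implybT// mulrA ler_wpM2r ?powR_ge0//; exact: H2.
rewrite E2; set z := r `^ (- beta) in L1 h2 *.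
rewrite (_ : _ - _ = p * r `^ p * ((I1 - c * Jfun beta p * z) + I2)); last by ring.
rewrite normrM gtr0_norm ?mulr_gt0//.
apply: (@le_trans _ _ (p * r `^ p * (eps / (2 * p) * z + eps / (2 * p) * z))).
  rewrite ler_wpM2l ?mulr_ge0 ?(ltW rp) ?(ltW p0)//.
  by apply: (le_trans (ler_normD _ _)); exact: lerD.
by rewrite le_eqVlt; apply/orP; left; apply/eqP; field; rewrite gt_eqF.
Qed.

End Jump.

(** * Survival probabilities *)

Section KernelLaw.
Context d d' (T : measurableType d) (U : measurableType d') (R : realType)
  (K : R.-pker T ~> U).
Variable x : T.

(* [K x], with its canonical structure of probability. *)
Definition klaw : set U -> \bar R := K x.

HB.instance Definition _ := isMeasure.Build _ _ _ klaw
  (measure0 (K x)) (measure_ge0 (K x)) (@measure_semi_sigma_additive _ _ _ (K x)).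

HB.instance Definition _ :=
  Measure_isProbability.Build _ _ _ klaw (@prob_kernel _ _ _ _ _ K x).

End KernelLaw.

Section FullSet.
Context (R : realType) d (T : measurableType d) (P : probability T R) (X : set T).
Hypotheses (mX : measurable X) (PX : P X = 1%E).

(** Bounds are known only at points of the state space; as the kernel gives it full mass, comparing
    integrands there is enough. *)
Lemma hasint_full f I : hasint P setT f I -> hasint P X f I.
Proof.
move=> fI; have mC : measurable (~` X) by exact: measurableC.
have C0 : P (~` X) = 0%E by rewrite probability_setC// PX subee.
have hC : hasint P (~` X) f 0.
  have mf := measurable_funTS (D := ~` X) (hasint_measurable fI).
  have fi : P.-integrable (~` X) (EFin \o f).
    by apply: null_set_integrable => //; exact/measurable_EFinP.
  split => //; apply: null_set_integral => //; exact/measurable_EFinP.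
have [J fJ] := hasint_subset measurableT mX (@subsetT _ _) fI.
suff -> : I = J by [].
have := hasint_setU mX mC _ fJ hC; rewrite setUv addr0 => h.
by apply: (hasint_unique fI); apply: h => y Xy; apply.
Qed.

Lemma hasint_le_full f g I J : hasint P setT f I -> hasint P setT g J ->
  (forall y, X y -> f y <= g y) -> I <= J.
Proof. by move=> /hasint_full fI /hasint_full gJ; exact: hasint_le mX fI gJ. Qed.

End FullSet.

Section Chain.
Context (R : realType) (K : R.-pker R ~> R) (X : set R).
Hypotheses (mX : measurable X) (KX : forall x, X x -> K x X = 1%E).

Lemma chain_fdd_ge0 As x : (0 <= chain_fdd K As x)%E.
Proof.
elim: As x => //= A As IH x.
by rewrite mule_ge0 ?lee_fin ?indicE//; apply: integral_ge0 => y _; exact: IH.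
Qed.

Lemma measurable_chain_fdd As : (forall A, A \in As -> measurable A) ->
  measurable_fun setT (chain_fdd K As).
Proof.
elim: As => [|A As IH] mA /=; first exact: measurable_cst.
apply: emeasurable_funM.
  by apply/measurable_EFinP; apply: measurable_indic; apply: mA; rewrite inE eqxx.
apply: measurable_fun_integral_kernel => //.
- by move=> U mU; exact: measurable_kernel.
- by move=> y; exact: chain_fdd_ge0.
- by apply: IH => B BA; apply: mA; rewrite inE BA orbT.
Qed.

(* [surv a n.+1 x] is [P_x[tau_a > n]]. *)
Definition surv (a : R) (k : nat) (x : R) : R :=
  fine (chain_fdd K (nseq k [set y | a < `|y|]) x).

Lemma measurable_norm_gt (a : R) : measurable [set y : R | a < `|y|].
Proof.
apply: (@measurable_gt_set _ _ _ (fun y : R => `|y|)).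
exact: measurableT_comp.
Qed.

Lemma chain_fdd_le1 As x : (forall A, A \in As -> measurable A) ->
  (chain_fdd K As x <= 1)%E.
Proof.
elim: As x => //= A As IH x mA.
have h : (\int[K x]_y chain_fdd K As y <= 1)%E.
  have mc : measurable_fun setT (chain_fdd K As).
    by apply: measurable_chain_fdd => B BA; apply: mA; rewrite inE BA orbT.
  apply: (@le_trans _ _ (\int[K x]_y cst 1%E y)%E).
    apply: ge0_le_integral => // [y _|y _]; first exact: chain_fdd_ge0.
    by apply: IH => B BA; apply: mA; rewrite inE BA orbT.
  by rewrite integral_cst// mul1e prob_kernel.
rewrite indicE; case: (x \in A); first by rewrite mul1e.
by rewrite mul0e lee01.
Qed.

Let mA a k : forall A, A \in nseq k [set y : R | a < `|y|] -> measurable A.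
Proof. by move=> A /nseqP[-> _]; exact: measurable_norm_gt. Qed.

Lemma surv_ge0 a k x : 0 <= surv a k x.
Proof. by rewrite fine_ge0// chain_fdd_ge0. Qed.

Lemma surv_EFin a k x : chain_fdd K (nseq k [set y | a < `|y|]) x = (surv a k x)%:E.
Proof.
rewrite /surv fineK// ge0_fin_numE ?chain_fdd_ge0//.
by apply: le_lt_trans (ltry 1); apply: chain_fdd_le1; exact: mA.
Qed.

Lemma surv_le1 a k x : surv a k x <= 1.
Proof. by rewrite -lee_fin -surv_EFin; apply: chain_fdd_le1; exact: mA. Qed.

Lemma surv0 a x : surv a 0 x = 1. Proof. by []. Qed.

Lemma surv_out a k x : `|x| <= a -> surv a k.+1 x = 0.
Proof.
move=> xa; rewrite /surv /= indicE memNset ?mul0e//=.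
by rewrite ltNge xa.
Qed.

(** The Markov property at time 1, and the recursion behind all inductions on the number of
    steps. *)
Lemma hasint_surv a k x : a < `|x| ->
  hasint (klaw K x) setT (surv a k) (surv a k.+1 x).
Proof.
move=> ax; apply: hasint_ge0 => //.
- have := measurable_chain_fdd (mA (a := a) (k := k)).
  by move=> mc; apply: (@measurableT_comp _ _ _ _ _ _ (@fine R)) => //; exact: measurable_fine.
- by move=> y _; exact: surv_ge0.
- rewrite -surv_EFin /= indicE mem_set// mul1e.
  by apply: eq_integral => y _; rewrite surv_EFin.
Qed.

Lemma hasint_le_klaw x f g I J : X x -> hasint (klaw K x) setT f I ->
  hasint (klaw K x) setT g J -> (forall y, X y -> f y <= g y) -> I <= J.
Proof. by move=> Xx; apply: hasint_le_full => //; exact: KX. Qed.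

End Chain.

(** * Bounds on survival probabilities from one-step moment inequalities *)

Section SurvivalBounds.
Context (R : realType) (K : R.-pker R ~> R) (X : set R).
Hypotheses (mX : measurable X) (KX : forall x, X x -> K x X = 1%E).
Variable a : R.
Hypothesis a1 : 1 <= a.

Lemma powR_ge1 (x r : R) : 1 <= x -> 0 <= r -> 1 <= x `^ r.
Proof. by move=> x1 r0; rewrite -[X in X <= _](powRr0 x) ler_powR. Qed.

Lemma bernoulli_ineq (t : R) n : 0 <= t -> t <= 1 -> 1 - n%:R * t <= (1 - t) ^+ n.
Proof.
move=> t0 t1; elim: n => [|n IH]; first by rewrite mul0r subr0 expr0.
have h0 : 0 <= 1 - t by lra.
rewrite exprS -natr1; apply: le_trans (ler_wpM2l h0 IH).
have : 0 <= n%:R * t * t by rewrite !mulr_ge0.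
by move: (n%:R) => m; lra.
Qed.

(** When D |x|^s is at least the number of steps the bound exceeds 1. Otherwise |x|^(-s) is large
    enough for the one-step gain 1 - eps |x|^(-s) to pay for the change of denominator. *)
Lemma surv_upper (s p eps : R) : 0 < s -> 0 < p -> 0 < eps ->
  (forall x, X x -> a < `|x| -> exists2 I,
     hasint (klaw K x) setT (fun y => `|y| `^ p) I &
     I <= `|x| `^ p - eps * `|x| `^ (p - s)) ->
  exists2 D, 0 < D & forall k x, X x ->
    surv K a k.+1 x <= (D * `|x| `^ s / k.+1%:R) `^ (p / s).
Proof.
have a1' := a1; move=> s0 p0 e0 H; pose kp := p / s.
have kp0 : 0 < kp by rewrite divr_gt0.
(* An integer above p / s, so that Bernoulli's inequality applies and (1 - t)^m <= (1 - t)^(p/s). *)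
pose m := (Num.truncn kp).+1.
have km : kp <= m%:R by apply: ltW; exact: truncnS_gt.
(* D >= 1 makes the case of one step trivial; D eps >= m makes the gain at least m t, with t the
   inverse of the number of steps. *)
pose D := Num.max 1 (m%:R / eps).
have D1 : 1 <= D by rewrite le_max lexx.
have Dm : m%:R <= D * eps by rewrite -ler_pdivrMr// le_max lexx orbT.
have D0 : 0 < D by lra.
have E (x : R) k : a < `|x| -> (D * `|x| `^ s / k.+1%:R) `^ kp = (D / k.+1%:R) `^ kp * `|x| `^ p.
  move=> _; rewrite mulrAC powRM ?powR_ge0 ?divr_ge0 ?(ltW D0)//.
  by rewrite -powRrM mulrC [s * _]mulrC divfK ?gt_eqF// mulrC.
exists D => // k; rewrite -/kp; elim: k => [|k IH] x Xx;
  (have [xa|ax] := leP `|x| a; first by rewrite surv_out// powR_ge0).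
  apply: (le_trans (surv_le1 _ _ _ _)); rewrite divr1; apply: powR_ge1 (ltW kp0).
  have h : 1 <= `|x| `^ s by apply: powR_ge1; [lra|exact: ltW].
  by rewrite -[X in X <= _]mulr1 ler_pM.
have x0 : 0 < `|x| by lra.
have [big|small] := leP k.+2%:R (D * `|x| `^ s).
  apply: (le_trans (surv_le1 _ _ _ _)); apply: powR_ge1 (ltW kp0).
  by rewrite ler_pdivlMr// mul1r.
have [I HI leI] := H x Xx ax.
have h1 := hasint_le_klaw mX KX Xx (hasint_surv K k.+1 ax)
  (hasintZ ((D / k.+1%:R) `^ kp) measurableT HI) _.
apply: (le_trans (h1 _)) => {h1}.
  move=> y Xy; have [ya|ay] := leP `|y| a.
    by rewrite surv_out// mulr_ge0 ?powR_ge0.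
  by rewrite -E//; exact: IH.
rewrite E//; have c0 : 0 <= (D / k.+1%:R) `^ kp by exact: powR_ge0.
apply: (le_trans (ler_wpM2l c0 leI)).
rewrite [in `|x| `^ (p - s)]powRD ?(gt_eqF x0) ?implybT//.
set z := `|x| `^ (- s); set w := `|x| `^ p.
have w0 : 0 < w by exact: powR_gt0.
pose t : R := k.+2%:R^-1.
have t0 : 0 < t by rewrite invr_gt0.
have t1 : t < 1 by rewrite invf_lt1// ltr1n.
have zt : m%:R * t <= eps * z.
  have xs : 0 < `|x| `^ s by exact: powR_gt0.
  have : t * D <= z.
    rewrite /z powRN /t mulrC ler_pdivrMr// -ler_pdivrMl ?invr_gt0// invrK.
    by rewrite mulrC ltW.
  move=> h; have h2 := ler_wpM2l (ltW e0) h.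
  by apply: le_trans h2; rewrite mulrCA mulrC ler_wpM2l ?(ltW t0)// mulrC.
have Et : D / k.+2%:R = (D / k.+1%:R) * (1 - t).
  rewrite /t -(natr1 k.+1); have : (0 : R) < k.+1%:R by [].
  by move: k.+1%:R => n n0; field; rewrite !gt_eqF//; lra.
have d0 : 0 <= D / k.+1%:R by rewrite divr_ge0 ?(ltW D0).
have t1' : 0 <= 1 - t by lra.
rewrite Et (powRM _ d0 t1').
rewrite -mulrA ler_wpM2l//.
have -> : w - eps * (w * z) = (1 - eps * z) * w by ring.
rewrite ler_wpM2r ?(ltW w0)//.
apply: (@le_trans _ _ (1 - m%:R * t)); first lra.
apply: (le_trans (bernoulli_ineq m (ltW t0) (ltW t1))).
rewrite -powR_mulrn; last lra.
by apply: ger_powR => //; apply/andP; split; lra.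
Qed.

(* The displacement from [x] to [y], counted positively towards the origin. *)
Definition inward (x y : R) : R := if 0 < x then x - y else y - x.

Lemma norm_inward x y : `| `|x| - inward x y| = `|y|.
Proof.
rewrite /inward; case: ltP => x0.
  by rewrite (gtr0_norm x0) (_ : x - (x - y) = y)//; ring.
by rewrite (ler0_norm x0) (_ : - x - (y - x) = - y) ?normrN//; ring.
Qed.

(* [(1 - y)_+^2] has second derivative at most 2; steps longer than 1 are absorbed
   by [|e|^s]. *)
Lemma quad_bound (r e s : R) : 0 <= r -> 1 <= s -> s <= 2 ->
  (Num.max 0 (1 - `|r - e|)) ^+ 2 <=
    (Num.max 0 (1 - r)) ^+ 2 + 2 * Num.max 0 (1 - r) * e + 3 * `|e| `^ s.
Proof.
move=> r0 s1 s2; set h := Num.max 0 (1 - r).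
have h0 : 0 <= h by rewrite le_max lexx.
have h1 : h <= 1 by rewrite ge_max ler01/=; lra.
have hr : 1 - r <= h by rewrite le_max lexx orbT.
set g := Num.max 0 (1 - `|r - e|).
have g0 : 0 <= g by rewrite le_max lexx.
have g1 : g <= 1 by rewrite ge_max ler01/=; have := normr_ge0 (r - e); lra.
have gh : g <= Num.max 0 (h + e).
  rewrite ge_max le_max lexx/= le_max; apply/orP; right.
  by have := ler_norm (r - e); lra.
have [e1|e1] := leP `|e| 1.
  have es : e ^+ 2 <= `|e| `^ s.
    have [->|en0] := eqVneq e 0; first by rewrite expr0n powR_ge0.
    rewrite -real_normK ?num_real// -powR_mulrn//.
    by apply: ger_powR => //; rewrite normr_gt0 en0.
  have : g ^+ 2 <= (h + e) ^+ 2.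
    have [he|he] := leP 0 (h + e).
      by rewrite max_r// in gh; rewrite ler_pXn2r ?nnegrE.
    have : g = 0 by apply/eqP; rewrite eq_le g0 andbT; rewrite max_l in gh => //; exact: ltW.
    by move=> ->; rewrite expr0n sqr_ge0.
  by have := powR_ge0 `|e| s; rewrite !expr2; lra.
have es : `|e| <= `|e| `^ s.
  by rewrite -{1}[`|e|]powRr1//; apply: ler_powR => //; exact: ltW.
have he : - (2 * `|e|) <= 2 * h * e.
  have := ler_norm (- e); rewrite normrN => e2.
  have [e0|e0] := leP 0 e; first by have := mulr_ge0 h0 e0; have := normr_ge0 e; lra.
  have : h * (- e) <= 1 * (- e) by apply: ler_wpM2r => //; lra.
  by lra.
have : g ^+ 2 <= 1 by rewrite exprn_ile1.
by have := sqr_ge0 h; lra.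
Qed.

(** By [quad_bound] the mean of the squared cut-off grows by O(Z^(-s)) per step, which the linear
    term in k absorbs. The factor 4 makes the bound exceed 1 once |x| <= Z / 2, and 2 a <= Z puts
    the ball inside that region. *)
Lemma surv_escape (s B B' : R) : 1 <= s -> s <= 2 -> 0 <= B -> 0 <= B' ->
  (forall x, X x -> a < `|x| -> exists mean S,
     [/\ hasint (klaw K x) setT (inward x) mean, `|mean| <= B * `|x| `^ (- (s - 1)),
      hasint (klaw K x) setT (fun y => `|inward x y| `^ s) S & S <= B']) ->
  exists2 C, 0 <= C & forall Z, 2 * a <= Z -> forall k x, X x ->
    1 - surv K a k x <= 4 * (Num.max 0 (1 - `|x| / Z)) ^+ 2 + C * k%:R * Z `^ (- s).
Proof.
(* 16 B is the cost of the drift term and 12 B' that of the s-th moment in one step. *)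
have a1' := a1; move=> s1 s2 B0 B'0 H; pose C := 4 * (4 * B + 3 * B').
have C0 : 0 <= C by rewrite /C; lra.
exists C => // Z aZ; have Z0 : 0 < Z by lra.
have z0 : 0 < Z `^ (- s) by exact: powR_gt0.
elim=> [|k IH] x Xx; first by rewrite surv0 subrr mulr0 mul0r addr0 mulr_ge0// sqr_ge0.
have hC : 0 <= C * k.+1%:R * Z `^ (- s) by rewrite mulr_ge0 ?(ltW z0)// mulr_ge0.
have [xZ|Zx] := leP `|x| (Z / 2).
  have h : 1 / 2 <= Num.max 0 (1 - `|x| / Z).
    rewrite le_max; apply/orP; right.
    have : `|x| / Z <= 1 / 2 by rewrite ler_pdivrMr//; lra.
    by lra.
  have : (1 / 2) ^+ 2 <= Num.max 0 (1 - `|x| / Z) ^+ 2.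
    by rewrite ler_pXn2r ?nnegrE//; lra.
  by have := surv_ge0 K a k.+1 x; rewrite expr2; lra.
have ax : a < `|x| by lra.
have [mean [S [Hm leM HS leS]]] := H x Xx ax.
set h := Num.max 0 (1 - `|x| / Z).
have h0 : 0 <= h by rewrite le_max lexx.
have h1 : h <= 1.
  by rewrite ge_max ler01/= gerBl divr_ge0// ltW.
have E1 : hasint (klaw K x) setT (fun=> 1) 1.
  by have := hasint_cst (klaw K x) 1 (@measurableT _ _); rewrite probability_setT mulr1.
have HL := hasintB measurableT E1 (hasint_surv K k ax).
have HR := hasintD measurableT (hasintZ (4 * h ^+ 2 + C * k%:R * Z `^ (- s)) measurableT E1)
  (hasintD measurableT (hasintZ (8 * h / Z) measurableT Hm) (hasintZ (12 * Z `^ (- s)) measurableT HS)).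
apply: (le_trans (hasint_le_klaw mX KX Xx HL HR _)).
  move=> y Xy; apply: (le_trans (IH y Xy)).
  have xZ0 : 0 <= `|x| / Z by rewrite divr_ge0// ltW.
  have := quad_bound (inward x y / Z) xZ0 s1 s2.
  rewrite -mulrBl normrM norm_inward (gtr0_norm (_ : 0 < Z^-1)) ?invr_gt0//.
  rewrite -/h normrM (gtr0_norm (_ : 0 < Z^-1)) ?invr_gt0//.
  rewrite powRM ?invr_ge0 ?(ltW Z0)// -powR_inv1 ?(ltW Z0)// -powRrM mulN1r.
  rewrite powR_inv1 ?(ltW Z0)//.
  move: (Num.max 0 (1 - `|y| / Z)) (Z `^ _) (Z^-1) (_ `^ s) (C * _) => g z iz t c'.
  by rewrite !expr2; lra.
(* Here |x| > Z / 2, and the exponent s - 1 <= 1 turns this factor 2 into at most 2. *)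
have mZ : `|mean| * Z^-1 <= 2 * B * Z `^ (- s).
  have -> : - s = - (s - 1) + -1 by ring.
  rewrite powRD ?(gt_eqF Z0) ?implybT// powR_inv1 ?(ltW Z0)// mulrA.
  rewrite ler_wpM2r ?invr_ge0 ?(ltW Z0)//.
  apply: (le_trans leM); rewrite [2 * B]mulrC -mulrA ler_wpM2l//.
  have x0 : 0 < `|x| by lra.
  have xs : 0 < `|x| `^ (s - 1) by exact: powR_gt0.
  have Zs : 0 < Z `^ (s - 1) by exact: powR_gt0.
  rewrite !powRN -ler_pdivrMr ?invr_gt0// invrK mulrC ler_pdivrMr//.
  apply: (@le_trans _ _ ((2 * `|x|) `^ (s - 1))).
    by apply: ge0_ler_powR; rewrite ?nnegrE ?subr_ge0 ?(ltW Z0) ?mulr_ge0//; lra.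
  rewrite powRM// ler_wpM2r ?(ltW xs)//.
  have : (2 : R) `^ (s - 1) <= 2 `^ 1 by apply: ler_powR; lra.
  by rewrite powRr1.
have h3 : 8 * h / Z * mean <= 16 * B * Z `^ (- s).
  have n1 := ler_norm mean; have iz : 0 < Z^-1 by rewrite invr_gt0.
  have : h * (`|mean| * Z^-1) <= 1 * (`|mean| * Z^-1).
    by rewrite ler_wpM2r// mulr_ge0// ltW.
  have : h * (mean * Z^-1) <= h * (`|mean| * Z^-1).
    by rewrite ler_wpM2l// ler_wpM2r// ltW.
  by move: (Z^-1) mZ => w; lra.
have h4 : 12 * Z `^ (- s) * S <= 12 * Z `^ (- s) * B' by rewrite ler_wpM2l// mulr_ge0// ltW.
rewrite -(natr1 k) mulr1 /C; move: (8 * h / Z * mean) h3 => w h3; lra.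
Qed.

Section Lower.
Variables (s C : R).
Hypotheses (s0 : 0 < s) (C0 : 0 <= C).
Hypothesis escape : forall Z, 2 * a <= Z -> forall k x, X x ->
    1 - surv K a k x <= 4 * (Num.max 0 (1 - `|x| / Z)) ^+ 2 + C * k%:R * Z `^ (- s).

(** From distance at least Z the quadratic term vanishes, and [del] makes the linear one at most
    1/2. *)
Lemma escape_half : exists2 del, 0 < del & forall Z k x, 2 * a <= Z -> X x ->
  Z <= `|x| -> k%:R <= del * Z `^ s -> 1 / 2 <= surv K a k x.
Proof.
have a1' := a1; have C0' := C0.
pose del := (2 * (C + 1))^-1; have del0 : 0 < del by rewrite invr_gt0 mulr_gt0//; lra.
exists del => // Z k x aZ Xx Zx kZ; have Z0 : 0 < Z by lra.
have zs : 0 < Z `^ s by exact: powR_gt0.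
have := escape aZ k Xx; rewrite max_l; last first.
  by rewrite subr_le0 ler_pdivlMr// mul1r.
have : C * k%:R * Z `^ (- s) <= 1 / 2.
  rewrite powRN ler_pdivrMr//.
  have h1 := ler_wpM2l C0 kZ; apply: (le_trans h1).
  rewrite mulrA ler_wpM2r ?(ltW zs)// /del -ler_pdivlMr ?invr_gt0 ?invrK.
    by rewrite /del; lra.
  by rewrite mulr_gt0//; lra.
by rewrite expr0n /=; lra.
Qed.

(* Below [et * Z] the function bounding [surv] is a submartingale; above it,
   [escape_half] applies. *)
Lemma surv_lower (b p p' eps D : R) : 0 < p -> p < p' -> 0 < eps -> 0 <= D ->
  (forall x, X x -> a < `|x| -> exists I I',
     [/\ hasint (klaw K x) setT (fun y => `|y| `^ p) I,
         `|x| `^ p + eps * `|x| `^ (p - b) <= I,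
         hasint (klaw K x) setT (fun y => `|y| `^ p') I' &
         I' <= `|x| `^ p' + D * `|x| `^ (p' - b)]) ->
  exists del Z0, [/\ 0 < del, 0 < Z0 & forall Z, Z0 <= Z -> forall k x, X x -> k%:R <= del * Z `^ s ->
    ((`|x| `^ p - a `^ p) * Z `^ (- p) - `|x| `^ p' * Z `^ (- p')) / 2 <= surv K a k x].
Proof.
have a1' := a1; move=> p0 pp' e0 D0 H; have p'0 : 0 < p' by lra.
(* Chosen so that D et^(p' - p) <= eps: up to distance et Z the loss from the power p' is at most
   the gain from the power p. *)
pose et := Num.min 1 (eps / (D + 1)) `^ (p' - p)^-1.
have m0 : 0 < Num.min 1 (eps / (D + 1)) by rewrite lt_min ltr01 divr_gt0//; lra.
have et0 : 0 < et by exact: powR_gt0.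
have etp : D * et `^ (p' - p) <= eps.
  rewrite /et -powRrM mulVf ?powRr1 ?(ltW m0)//; last by rewrite gt_eqF// subr_gt0.
  apply: (@le_trans _ _ (D * (eps / (D + 1)))).
    by rewrite ler_wpM2l// ge_min lexx orbT.
  rewrite mulrCA ler_piMr ?(ltW e0)// ler_pdivrMr; lra.
have [del del0 Hd] := escape_half.
exists (del * et `^ s), (2 * a / et); split.
- by rewrite mulr_gt0 ?powR_gt0.
- by rewrite divr_gt0//; lra.
move=> Z ZZ; have Z0 : 0 < Z by apply: lt_le_trans ZZ; rewrite divr_gt0//; lra.
have zp : 0 < Z `^ (- p) by exact: powR_gt0.
have zp' : 0 < Z `^ (- p') by exact: powR_gt0.
pose f (x : R) : R := ((`|x| `^ p - a `^ p) * Z `^ (- p) - `|x| `^ p' * Z `^ (- p')) / 2.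
have ap0 := powR_ge0 a p.
(* With t = |x| / Z, t^p - t^p' <= 1. This bound is below 1 at k = 0 and matches [escape_half]
   beyond et Z. *)
have fle x : f x <= 1 / 2.
  rewrite /f ler_wpM2r//.
  have xp' : 0 <= `|x| `^ p' * Z `^ (- p') by rewrite mulr_ge0 ?powR_ge0.
  have ap : 0 <= a `^ p * Z `^ (- p) by rewrite mulr_ge0 ?powR_ge0.
  have E q : `|x| `^ q * Z `^ (- q) = (`|x| / Z) `^ q.
    rewrite powRM ?invr_ge0 ?(ltW Z0)// -powR_inv1 ?(ltW Z0)//.
    by rewrite -powRrM mulN1r.
  have t0 : 0 <= `|x| / Z by rewrite divr_ge0// ltW.
  rewrite E in xp' *; rewrite mulrBl E.
  have [t1|t1] := leP (`|x| / Z) 1.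
    have : (`|x| / Z) `^ p <= 1 `^ p by apply: ge0_ler_powR; rewrite ?nnegrE ?(ltW p0).
    by rewrite powR1; lra.
  have : (`|x| / Z) `^ p <= (`|x| / Z) `^ p' by apply: ler_powR; exact: ltW.
  by lra.
have fout x : `|x| <= a -> f x <= 0.
  move=> xa; rewrite /f pmulr_lle0//.
  have : `|x| `^ p <= a `^ p by apply: ge0_ler_powR; rewrite ?nnegrE ?(ltW p0)//; lra.
  move=> h; have h' := powR_ge0 `|x| p'.
  have := mulr_ge0 h' (ltW zp').
  have : (`|x| `^ p - a `^ p) * Z `^ (- p) <= 0 by rewrite pmulr_lle0// subr_le0.
  by lra.
elim=> [|k IH] x Xx kZ; rewrite -/(f x).
  by rewrite surv0; have := fle x; lra.
have [xa|ax] := leP `|x| a; first by rewrite surv_out// fout.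
have x0 : 0 < `|x| by lra.
have [big|small] := leP (et * Z) `|x|.
  apply: (le_trans (fle x)); apply: (Hd (et * Z)) => //.
    by rewrite [et * Z]mulrC -ler_pdivrMr.
  by rewrite powRM ?(ltW et0) ?(ltW Z0)// mulrA.
have [I [I' [HI leI HI' leI']]] := H x Xx ax.
have E1 : hasint (klaw K x) setT (fun=> a `^ p) (a `^ p).
  by have := hasint_cst (klaw K x) (a `^ p) (@measurableT _ _); rewrite probability_setT mulr1.
have Hf := hasintZ 2^-1 measurableT (hasintB measurableT (hasintZ (Z `^ (- p)) measurableT (hasintB measurableT HI E1))
  (hasintZ (Z `^ (- p')) measurableT HI')).
apply: le_trans (hasint_le_klaw mX KX Xx Hf (hasint_surv K k ax) _); last first.
  move=> y Xy; apply: le_trans (IH y Xy _).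
    by rewrite le_eqVlt; apply/orP; left; apply/eqP; ring.
  by apply: le_trans kZ; rewrite ler_nat.
rewrite /f mulrC ler_wpM2l ?invr_ge0//.
have h1 := ler_wpM2l (ltW zp) leI; have h2 := ler_wpM2l (ltW zp') leI'.
suff : Z `^ (- p') * (D * `|x| `^ (p' - b)) <= Z `^ (- p) * (eps * `|x| `^ (p - b)) by lra.
have xb : 0 < `|x| `^ (p - b) by exact: powR_gt0.
have -> : p' - b = (p' - p) + (p - b) by ring.
have -> : - p' = - (p' - p) + - p by ring.
have -> : `|x| `^ (p' - p + (p - b)) = `|x| `^ (p' - p) * `|x| `^ (p - b).
  by rewrite powRD// (gt_eqF x0) implybT.
have -> : Z `^ (- (p' - p) + - p) = Z `^ (- (p' - p)) * Z `^ (- p).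
  by rewrite powRD// (gt_eqF Z0) implybT.
have hx : D * (`|x| `^ (p' - p) * Z `^ (- (p' - p))) <= eps.
  apply: le_trans etp; rewrite ler_wpM2l// powRN ler_pdivrMr ?powR_gt0//.
  rewrite -powRM ?(ltW et0) ?(ltW Z0)//.
  by apply: ge0_ler_powR; rewrite ?nnegrE ?subr_ge0; [exact: ltW|exact: ltW|rewrite mulr_ge0 ?ltW|exact: ltW].
have h3 := ler_wpM2r (mulr_ge0 (ltW xb) (ltW zp)) hx.
rewrite (_ : Z `^ _ * Z `^ _ * (_ * _) = D * (`|x| `^ (p' - p) * Z `^ (- (p' - p))) * (`|x| `^ (p - b) * Z `^ (- p))); last by ring.
by rewrite (_ : Z `^ _ * _ = eps * (`|x| `^ (p - b) * Z `^ (- p))); last by ring.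
Qed.

(** Converts a scale of distance into a scale of time by taking Z with del Z^s = n + 1. *)
Lemma tail_of_scale (q : R) (u : nat -> R) c del Z0 : 0 < c -> 0 < del -> 0 <= q ->
  (forall Z, Z0 <= Z -> forall k, k%:R <= del * Z `^ s -> c * Z `^ (- q) <= u k) ->
  exists2 c', 0 < c' & exists N, forall n, (N <= n)%N -> c' * n.+1%:R `^ (- (q / s)) <= u n.+1.
Proof.
move=> c0 d0 q0 H; exists (c * del `^ (q / s)); first by rewrite mulr_gt0 ?powR_gt0.
pose N := Num.truncn (del * `|Z0| `^ s); exists N => n Nn.
pose Z := (n.+1%:R / del) `^ s^-1.
have nd : 0 < n.+1%:R / del by rewrite divr_gt0.
have Zs : Z `^ s = n.+1%:R / del by rewrite /Z -powRrM mulVf ?powRr1 ?(ltW nd)// gt_eqF.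
have ZZ : Z0 <= Z.
  apply: (le_trans (ler_norm _)).
  have -> : `|Z0| = (`|Z0| `^ s) `^ s^-1 by rewrite -powRrM mulfV ?powRr1// gt_eqF.
  apply: ge0_ler_powR; rewrite ?nnegrE ?powR_ge0 ?(ltW nd)//.
    by rewrite invr_ge0 ltW.
  rewrite ler_pdivlMr// mulrC; apply: ltW.
  by apply: (lt_le_trans (truncnS_gt _)); rewrite ler_nat.
have -> : c * del `^ (q / s) * n.+1%:R `^ (- (q / s)) = c * Z `^ (- q).
  rewrite /Z -powRrM mulrN [s^-1 * q]mulrC powRM ?invr_ge0 ?(ltW d0)//.
  by rewrite -(powR_inv1 (ltW d0)) -powRrM mulN1r opprK; ring.
by apply: H => //; rewrite Zs mulrC divfK ?gt_eqF.
Qed.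

End Lower.

End SurvivalBounds.

(** * Moments of the hitting time *)

Section HittingTime.
Context (R : realType) d (Om : measurableType d) (xi : nat -> Om -> R) (a : R).
Hypothesis mxi : forall n, measurable_fun setT (xi n).

(** The event that the hitting time is at least n: only the times 0, ..., n - 1 are tested. *)
Definition avoid (n : nat) : set Om := [set w | forall i, (i < n)%N -> a < `|xi i w|].

Lemma measurable_avoid n : measurable (avoid n).
Proof.
have -> : avoid n = \big[setI/setT]_(i < n) [set w | a < `|xi i w|].
  rewrite -(bigcap_mkord n (fun i => [set w | a < `|xi i w|])).
  apply/seteqP; split => w /=.
    by move=> h i /= ik; exact: h.
  by move=> h i ik; exact: h.
apply: bigsetI_measurable => i _.
by apply: measurable_gt_set; exact: measurableT_comp.
Qed.

Lemma avoid_le m n w : (m <= n)%N -> avoid n w -> avoid m w.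
Proof. by move=> mn h i im; apply: h; exact: leq_trans mn. Qed.

Lemma hitting_timeP w : (hitting_time xi a w = +oo%E /\ forall n, avoid n w) \/
  exists N, hitting_time xi a w = N%:R%:E /\ forall n, avoid n w <-> (n <= N)%N.
Proof.
have [h|/existsNP[n hn]] := pselect (forall n, a < `|xi n w|).
  left; split; last by move=> n i _.
  rewrite /hitting_time (_ : [set _ | _ in _] = set0) ?ereal_inf0//.
  by apply/seteqP; split => // y [n /=]; rewrite leNgt h.
right; have ex : exists n, `|xi n w| <= a by exists n; rewrite leNgt; exact/negP.
have [N hN minN] := ex_minnP ex; exists N; split.
  apply/eqP; rewrite eq_le; apply/andP; split.
    by apply: ereal_inf_lbound; exists N.
  by apply: le_ereal_inf_tmp => _ [k /= /minN Nk <-]; rewrite lee_fin ler_nat.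
move=> k; split=> [h|kN i ik].
  by rewrite leqNgt; apply/negP => Nk; have := h N Nk; rewrite ltNge hN.
by rewrite ltNge; apply/negP => /minN Ni; move: (leq_trans ik kN); rewrite ltnNge Ni.
Qed.

(* [ntau n] is the minimum of [n] and the hitting time. *)
Definition ntau (n : nat) (w : Om) : R := \sum_(i < n) \1_(avoid i.+1) w.

Lemma measurable_ntau n : measurable_fun setT (ntau n).
Proof.
apply: measurable_sum => i; apply: measurable_indic; exact: measurable_avoid.
Qed.

Lemma ntau_full n w : avoid n w -> ntau n w = n%:R.
Proof.
move=> h; rewrite /ntau (eq_bigr (fun=> 1)) ?sumr_const ?card_ord// => i _.
by rewrite indicE mem_set//; apply: avoid_le h.
Qed.

Lemma ntau_stop n k w : (k <= n)%N -> ~ avoid k.+1 w -> ntau n w = ntau k w.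
Proof.
move=> /subnKC <-; elim: (n - k)%N => [|m IH] h; first by rewrite addn0.
rewrite addnS /ntau big_ord_recr/= -/(ntau _ _) IH// indicE memNset ?addr0//.
by move=> h'; apply: h; apply: avoid_le h'; rewrite ltnS leq_addr.
Qed.

Lemma ntau_nd m n w : (m <= n)%N -> ntau m w <= ntau n w.
Proof.
move=> /subnKC <-; elim: (n - m)%N => [|k IH]; first by rewrite addn0.
by rewrite addnS /ntau big_ord_recr/= (le_trans IH)// lerDl indicE.
Qed.

Lemma ntau_ge0 n w : 0 <= ntau n w.
Proof. by apply: sumr_ge0 => i _; rewrite indicE. Qed.

Lemma ntau_leq n w : ntau n w <= n%:R.
Proof.
rewrite -[X in _ <= X%:R]card_ord -sumr_const; apply: ler_sum => i _.
by rewrite indicE; case: (_ \in _).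
Qed.

Lemma ntau_le n k w : ~ avoid k.+1 w -> ntau n w <= k%:R.
Proof.
move=> h; have [kn|nk] := leqP k n; first by rewrite (ntau_stop kn h) ntau_leq.
by apply: (le_trans (ntau_leq n w)); rewrite ler_nat ltnW.
Qed.

Lemma cvg_ntau_powR q w : 0 < q ->
  (ntau n w `^ q)%:E @[n --> \oo] --> poweR (hitting_time xi a w) q.
Proof.
move=> q0; have [[-> h]|[N [-> h]]] := hitting_timeP w.
  rewrite poweRyr ?gt_eqF//; apply/cvgeyPge => A.
  pose n0 := (Num.truncn (`|A| `^ q^-1)).+1; exists n0 => // n /= nn.
  rewrite ntau_full// lee_fin; apply: (le_trans (ler_norm _)).
  have -> : `|A| = (`|A| `^ q^-1) `^ q by rewrite -powRrM mulVf ?powRr1// gt_eqF.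
  apply: ge0_ler_powR; rewrite ?nnegrE ?powR_ge0 ?(ltW q0)//.
  by apply: ltW; apply: lt_le_trans (truncnS_gt _) _; rewrite ler_nat.
rewrite poweR_EFin; apply: cvg_near_cst; exists N => // n /= Nn.
have hN : ~ avoid N.+1 w by move/h; rewrite ltnn.
by rewrite (ntau_stop Nn hN) ntau_full//; exact/h.
Qed.

Variables (P : probability Om R) (q : R).
Hypothesis q0 : 0 < q.

Lemma cvg_moment_ntau : (\int[P]_w (ntau n w `^ q)%:E)%E @[n --> \oo] -->
  (\int[P]_w poweR (hitting_time xi a w) q)%E.
Proof.
have E w : poweR (hitting_time xi a w) q = limn (fun n => (ntau n w `^ q)%:E).
  by apply/esym/cvg_lim => //; exact: cvg_ntau_powR.
under [X in _ --> X]eq_integral do rewrite E.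
apply: (@cvg_monotone_convergence _ _ _ P setT measurableT (fun n w => (ntau n w `^ q)%:E)).
- by move=> n; apply/measurable_EFinP; apply: measurable_fun_powR; exact: measurable_ntau.
- by move=> n w _; rewrite lee_fin powR_ge0.
- move=> w _ m n mn; rewrite lee_fin.
  by apply: ge0_ler_powR; rewrite ?nnegrE ?ntau_ge0 ?(ltW q0)//; exact: ntau_nd.
Qed.

(** [tail_moment] applied to the truncated times gives a bound uniform in the truncation, which then
    passes to the monotone limit. *)
Lemma moment_lty (kp C : R) : q < kp -> 0 <= C ->
  (forall n, fine (P (avoid n.+1)) <= C * n.+1%:R `^ (- kp)) ->
  (\int[P]_w poweR (hitting_time xi a w) q < +oo)%E.
Proof.
move=> qk C0 HC; have kp0 : 0 < kp by exact: lt_trans qk.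
suff h n : (\int[P]_w (ntau n w `^ q)%:E <= (1 + C * (q / (kp - q)))%:E)%E.
  have cv := cvg_moment_ntau.
  rewrite -(cvg_lim (@ereal_hausdorff R) cv).
  apply: (@le_lt_trans _ _ (1 + C * (q / (kp - q)))%:E); last exact: ltry.
  apply: lime_le; first by apply/cvg_ex; eexists; exact: cv.
  by apply: nearW => n; exact: h.
have mn := measurable_ntau n.
have [|I HI leI] := @tail_moment _ _ _ P (ntau n) C kp q mn q0 qk.
  (* ntau n > y forces survival through k + 1 tests, and k + 1 > y, so the rate at k + 1 is below
     the one at y. *)
  move=> y y0; pose k := Num.truncn y.
  have sub : [set w | y < ntau n w] `<=` avoid k.+1.
    move=> w /= yn; apply: contrapT => h.
    by have := lt_le_trans yn (ntau_le n h); rewrite ltNge truncn_le// ltW.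
  apply: (@le_trans _ _ (fine (P (avoid k.+1)))).
    apply: fine_le; try (rewrite fin_num_measure//; first [exact: measurable_gt_set|exact: measurable_avoid]).
    by apply: le_measure; rewrite ?inE//; [exact: measurable_gt_set|exact: measurable_avoid].
  apply: (le_trans (HC k)); rewrite ler_wpM2l// !powRN lef_pV2 ?posrE ?powR_gt0//.
  apply: ge0_ler_powR; rewrite ?nnegrE ?(ltW kp0)// ?(ltW y0)//.
  by apply: ltW; exact: truncnS_gt.
apply: (@le_trans _ _ I%:E); last by rewrite lee_fin.
rewrite -HI.2 le_eqVlt; apply/orP; left; apply/eqP.
have mS : measurable [set w | 0 < ntau n w] by exact: measurable_gt_set.
rewrite [RHS]integral_mkcond; apply: eq_integral => w _ /=.
rewrite patchE; case: ifPn => // /negP; rewrite inE/= => /negP.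
rewrite -leNgt => h; have -> : ntau n w = 0 by apply/eqP; rewrite eq_le h ntau_ge0.
by rewrite powR0// gt_eqF.
Qed.

(** On [avoid (2 m)] doubling the truncation raises its q-th power by (2 m)^q (1 - 2^(-q)), so by kp
    <= q the truncated moment grows by at least c' at each doubling. This works at equality too, as
    the critical value in case (iii) requires. *)
Lemma moment_eqy (kp c : R) (N : nat) : kp <= q -> 0 < c ->
  (forall n, (N <= n)%N -> c * n.+1%:R `^ (- kp) <= fine (P (avoid n.+1))) ->
  (\int[P]_w poweR (hitting_time xi a w) q = +oo)%E.
Proof.
move=> kq c0 Hc; pose c' := c * (1 - 2 `^ (- q)).
have q2 : (2 : R) `^ (- q) < 1.
  rewrite powRN invf_lt1 ?powR_gt0//.
  have : 1 `^ q < (2 : R) `^ q by apply: gt0_ltr_powR; rewrite ?nnegrE//; lra.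
  by rewrite powR1.
have c'0 : 0 < c' by rewrite mulr_gt0// subr_gt0.
have mf n : measurable_fun setT (fun w => ntau n w `^ q).
  by apply: measurable_fun_powR; exact: measurable_ntau.
have /choice[I HI] n : exists J, hasint P setT (fun w => ntau n w `^ q) J.
  have [w _|J HJ _] := hasint_dom measurableT (mf n) (hasint_cst P (n%:R `^ q) (@measurableT _ Om)).
    rewrite ger0_norm ?powR_ge0//.
    by apply: ge0_ler_powR; rewrite ?nnegrE ?ntau_ge0 ?ntau_leq ?(ltW q0).
  by exists J.
have Ind m n : (m <= n)%N -> I m <= I n.
  move=> mn; apply: (hasint_le measurableT (HI m) (HI n)) => w _.
  by apply: ge0_ler_powR; rewrite ?nnegrE ?ntau_ge0 ?(ltW q0)//; exact: ntau_nd.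
have double m : (N.+1 <= m)%N -> I m + c' <= I (2 * m)%N.
  move=> Nm; have m0 : (0 < m)%N by exact: leq_ltn_trans Nm.
  have mA := measurable_avoid (2 * m).
  pose k : R := (2 * m)%:R `^ q - m%:R `^ q.
  have H1 : hasint P setT ((fun=> k) \_ (avoid (2 * m))) (k * fine (P (avoid (2 * m)))).
    by apply: (hasint_patch _ _ _ mA).1; exact: hasint_cst.
  have h2 : k * fine (P (avoid (2 * m))) + I m <= I (2 * m)%N.
    apply: (hasint_le measurableT (hasintD measurableT H1 (HI m)) (HI (2 * m)%N)) => w _.
    rewrite patchE; case: ifPn => [/set_mem h|_].
      have h' : avoid m w by apply: avoid_le h; rewrite leq_pmull.
      rewrite (ntau_full h) (ntau_full h').
      by rewrite /k subrK.
    rewrite add0r; apply: ge0_ler_powR; rewrite ?nnegrE ?ntau_ge0 ?(ltW q0)//.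
    by apply: ntau_nd; rewrite leq_pmull.
  suff : c' <= k * fine (P (avoid (2 * m))) by lra.
  have mm : (2 * m)%:R = 2 * m%:R :> R by rewrite natrM.
  have mr0 : (0 : R) < m%:R by rewrite ltr0n.
  have kE : k = (2 * m)%:R `^ q * (1 - 2 `^ (- q)).
    rewrite /k mm powRM ?(ltW mr0)// mulrBr mulr1 mulrAC -powRD ?subrr ?powRr0 ?mul1r//.
    by rewrite pnatr_eq0 implybT.
  have k0 : 0 <= k by rewrite kE mulr_ge0 ?powR_ge0 ?subr_ge0 ?(ltW q2).
  have := Hc (2 * m).-1; rewrite prednK; last by rewrite muln_gt0.
  move=> h; have {}h : c * (2 * m)%:R `^ (- kp) <= fine (P (avoid (2 * m))).
    by apply: h; rewrite -ltnS prednK ?muln_gt0// (leq_trans Nm)// leq_pmull.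
  apply: le_trans (ler_wpM2l k0 h).
  have M1 : 1 <= (2 * m)%:R :> R by rewrite ler1n muln_gt0.
  have h3 : 1 <= (2 * m)%:R `^ (q - kp) by apply: powR_ge1 => //; lra.
  rewrite powRD in h3; last by rewrite (gt_eqF (lt_le_trans ltr01 M1)) implybT.
  rewrite kE /c' (_ : _ * _ * (c * _) = c * (1 - 2 `^ (- q)) * ((2 * m)%:R `^ q * (2 * m)%:R `^ (- kp))); last by ring.
  by rewrite ler_peMr// ltW.
have grow j : j%:R * c' <= I (2 ^ j * N.+1)%N.
  elim: j => [|j IH].
    by rewrite mul0r; apply: (hasint_nng (HI _)) => w _; exact: powR_ge0.
  rewrite expnS -mulnA; apply: le_trans (double _ _); last by rewrite leq_pmull ?expn_gt0.
  by rewrite -natr1 mulrDl mul1r lerD2r.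
apply/eqyP => A A0; have cv := cvg_moment_ntau.
rewrite -(cvg_lim (@ereal_hausdorff R) cv).
apply: lime_ge; first by apply/cvg_ex; eexists; exact: cv.
pose j := (Num.truncn (A / c')).+1; exists (2 ^ j * N.+1)%N => // n /= jn.
rewrite (HI n).2 lee_fin; apply: le_trans (Ind _ _ jn); apply: le_trans (grow j).
by rewrite -ler_pdivrMr//; apply: ltW; exact: truncnS_gt.
Qed.

End HittingTime.

(** * Passage from the chain to its transition kernel *)

Section Transport.
Context (R : realType) d (Om : measurableType d) (X : set R) (K : R.-pker R ~> R)
  (P : R -> probability Om R) (xi : nat -> Om -> R).
Hypothesis HM : is_markov_chain X K P xi.
Variable x : R.
Hypothesis Xx : X x.

Let mxi n : measurable_fun setT (xi n). Proof. by case: HM => _ [_ [h _]]. Qed.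

Lemma avoid_surv a n : fine (P x (avoid xi a n)) = surv K a n x.
Proof.
case: HM => _ [_ [_ h]]; rewrite /surv -h//; last first.
  by move=> A /nseqP[-> _]; exact: measurable_norm_gt.
rewrite size_nseq; congr (fine (P x _)); apply/seteqP; split => w /= H i iN.
  by rewrite nth_nseq iN; exact: H.
by have := H i iN; rewrite nth_nseq iN.
Qed.

Lemma law_xi0 : P x [set w | xi 0%N w = x] = 1%E.
Proof.
case: HM => _ [_ [_ h]]; have := h x Xx [:: [set x]].
rewrite (_ : [set w | _] = [set w | xi 0%N w = x]); last first.
  apply/seteqP; split => w /=; first by move=> /(_ 0%N isT).
  by move=> H [|i].
move=> ->; last by move=> A; rewrite inE => /eqP ->; exact: measurable_set1.
by rewrite /= indicE mem_set// mul1e integral_cst// mul1e prob_kernel.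
Qed.

Lemma law_xi1 B : measurable B -> P x (xi 1%N @^-1` B) = K x B.
Proof.
move=> mB; case: HM => _ [_ [_ h]]; have := h x Xx [:: setT; B].
rewrite (_ : [set w | _] = xi 1%N @^-1` B); last first.
  apply/seteqP; split => w /=; first by move=> /(_ 1%N isT).
  by move=> H [|[|i]].
move=> ->; last by move=> A; rewrite !inE => /orP[] /eqP ->.
rewrite /= indicE mem_set// mul1e.
transitivity (\int[K x]_y (\1_B y)%:E)%E.
  by apply: eq_integral => y _; rewrite integral_cst// mul1e prob_kernel mule1.
by rewrite integral_indic// setIT.
Qed.

(** The initial state equals x almost surely and xi_1 has law K x, so the increment may be replaced
    by y - x. *)
Lemma integral_increment (f : R -> \bar R) : measurable_fun setT f -> (forall y, 0 <= f y)%E ->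
  (\int[P x]_w f (xi 1%N w - xi 0%N w)%R = \int[klaw K x]_y f (y - x)%R)%E.
Proof.
move=> mf f0; pose g y := f (y - x).
have mg : measurable_fun setT g.
  by apply: measurableT_comp => //; exact: measurable_funB.
transitivity (\int[P x]_w g (xi 1%N w))%E.
  apply: ae_eq_integral => //.
  - by apply: measurableT_comp => //; exact: measurable_funB.
  - by apply: measurableT_comp.
  - have m0 : measurable [set w | xi 0%N w = x].
      by have := @mxi 0%N measurableT _ (measurable_set1 x); rewrite setTI.
    exists (~` [set w | xi 0%N w = x]); split; first exact: measurableC.
      have C0 : P x (~` [set w | xi 0%N w = x]) = 0%E.
        by rewrite probability_setC// law_xi0 subee.
      exact: C0.
    by move=> w /= H e; apply: H => _; rewrite /g e.
rewrite -[LHS](ge0_integral_pushforward (mxi 1%N) _ measurableT mg)//.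
  by apply: eq_measure_integral => B mB _; exact: law_xi1.
by move=> y _; exact: f0.
Qed.

Lemma prob_increment B : measurable B ->
  P x [set w | B (xi 1%N w - xi 0%N w)] = klaw K x [set y | B (y - x)].
Proof.
move=> mB; have := @integral_increment (fun y => (\1_B y)%:E) _ _.
have E1 : [set w | B (xi 1%N w - xi 0%N w)] = (fun w => xi 1%N w - xi 0%N w) @^-1` B by [].
have m1 : measurable [set w | B (xi 1%N w - xi 0%N w)].
  by rewrite E1 -[X in measurable X]setTI; apply: measurable_funB.
have m2 : measurable [set y : R | B (y - x)].
  rewrite (_ : [set y | _] = (fun y : R => y - x) @^-1` B)// -[X in measurable X]setTI.
  exact: measurable_funB.
rewrite (_ : (fun w : Om => (\1_B (xi 1%N w - xi 0%N w))%:E) =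
   (fun w => (\1_[set w | B (xi 1%N w - xi 0%N w)] w)%:E))//.
rewrite (_ : (fun y : R => (\1_B (y - x))%:E) = (fun y => (\1_[set y : R | B (y - x)] y)%:E))//.
rewrite !integral_indic// !setIT; apply => //.
by apply/measurable_EFinP; exact: measurable_indic.
Qed.

(** Extended subtraction never yields a real number when either operand is +oo, even both. Hence a
    real drift forces the increment to be integrable. *)
Lemma fin_sube_lty (u v : \bar R) (m : R) : (u - v = m%:E -> u < +oo /\ v < +oo)%E.
Proof. by case: u => [r||]; case: v => [t||]//= _; rewrite !ltry. Qed.

Lemma hasint_drift m : drift P xi x = m%:E -> hasint (klaw K x) setT (fun y => y - x) m.
Proof.
rewrite /drift integralE => H.
have Ep (f : Om -> R) w : ((fun w => (f w)%:E)^\+ w)%E = (Num.max (f w) 0)%:E.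
  by rewrite funeposE EFin_max.
have En (f : Om -> R) w : ((fun w => (f w)%:E)^\- w)%E = (Num.max (- f w) 0)%:E.
  by rewrite funenegE EFin_max.
have mp : measurable_fun setT (fun y : R => Num.max y 0) by exact: measurable_maxr.
have mn : measurable_fun setT (fun y : R => Num.max (- y) 0).
  by apply: measurable_maxr => //; exact: measurableT_comp.
move: H.
have -> : (\int[P x]_w (fun w => (xi 1%N w - xi 0%N w)%R%:E)^\+ w =
    \int[klaw K x]_y (Num.max (y - x) 0)%:E)%E.
  under eq_integral do rewrite Ep.
  apply: (@integral_increment (fun y => (Num.max y 0)%:E)); first exact/measurable_EFinP.
  by move=> y; rewrite lee_fin le_max lexx orbT.
have -> : (\int[P x]_w (fun w => (xi 1%N w - xi 0%N w)%R%:E)^\- w =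
    \int[klaw K x]_y (Num.max (- (y - x)) 0)%:E)%E.
  under eq_integral do rewrite En.
  apply: (@integral_increment (fun y => (Num.max (- y) 0)%:E)); first exact/measurable_EFinP.
  by move=> y; rewrite lee_fin le_max lexx orbT.
have mx : measurable_fun setT (fun y : R => y - x) by exact: measurable_funB.
have h1 : measurable_fun setT (fun y : R => Num.max (y - x) 0) by exact: measurable_maxr.
have h2 : measurable_fun setT (fun y : R => Num.max (- (y - x)) 0).
  by apply: measurable_maxr => //; exact: measurableT_comp.
move=> H.
have p0 (y : R) : 0 <= Num.max y 0 by rewrite le_max lexx orbT.
have [A_lty B_lty] := fin_sube_lty H.
have [|A HA A0] := hasint_ge0_lty measurableT h1 _ A_lty; first by [].
have [|B HB B0] := hasint_ge0_lty measurableT h2 _ B_lty; first by [].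
move: H; rewrite HA.2 HB.2 => -[<-].
have := hasintB measurableT HA HB; apply: eq_hasint => // y _.
have [h|h] := leP (y - x) 0.
  have h' : 0 <= - (y - x) by rewrite oppr_ge0.
  by rewrite (max_l h'); ring.
have h' : - (y - x) <= 0 by rewrite oppr_le0 ltW.
by rewrite (max_r h'); ring.
Qed.

End Transport.

Section AffineBounds.
Context (R : realFieldType).
Implicit Types (I u k v z t : R).

Lemma affine_lower I u k v : `|I - (u + k * v)| <= k / 2 * v -> u + k / 2 * v <= I.
Proof. by rewrite ler_norml => /andP[h _]; lra. Qed.

Lemma affine_upper I u k v : 0 <= v -> `|I - (u + k * v)| <= 1 * v ->
  I <= u + (`|k| + 1) * v.
Proof.
rewrite ler_norml => v0 /andP[_ h].
have := ler_wpM2r v0 (ler_norm k); lra.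
Qed.

Lemma quarter_le k z t : t <= k / 2 * z -> k / 4 * z <= (k * z - t) / 2.
Proof. by lra. Qed.

Lemma norm_le_add (t u e : R) : `|t - u| <= e -> `|t| <= `|u| + e.
Proof. by have := ler_normD (t - u) u; rewrite subrK; lra. Qed.

End AffineBounds.

(** * Survival exponents from the increments of |x| *)

Section Asymptotics.
Context (R : realType) (K : R.-pker R ~> R) (X : set R).
Hypotheses (mX : measurable X) (KX : forall x, X x -> K x X = 1%E).
Variables (alpha beta c gamma b N0 M : R) (Y : R -> R).
Hypotheses (b1 : 1 < beta) (b2 : beta < 2) (ba : beta < alpha) (c0 : 0 < c)
  (g0 : 0 <= gamma) (N01 : 1 <= N0) (Y0 : forall e, 0 <= Y e).
Hypothesis Htail : forall e, 0 < e -> forall y, Y e < y -> forall x, X x -> N0 <= `|x| ->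
  `|y `^ beta * tail (klaw K x) (inward x) y - c| <= e.
Hypothesis Hmom : forall x, X x -> N0 <= `|x| ->
  (\int[klaw K x]_y ((Num.max 0 (- inward x y)) `^ alpha)%:E <= M%:E)%E.
(** [m] is the outward drift, hence the mean - m of the inward step; this sign treats both
    half-lines at once. *)
Hypothesis Hdrift : forall e, 0 < e -> exists N, forall x, X x -> N <= `|x| ->
  exists2 m, hasint (klaw K x) setT (inward x) (- m) & `| `|x| `^ gamma * m - b| <= e.

Lemma measurable_inward (x : R) : measurable_fun setT (inward x).
Proof.
have [x0|x0] := boolP (0 < x).
  by rewrite /inward x0; exact: measurable_funB.
by rewrite /inward (negbTE x0); exact: measurable_funB.
Qed.

Lemma norm_moment p e : 0 < p -> p < beta -> 0 < e ->
  exists2 N, 1 <= N & forall x, X x -> N <= `|x| -> exists m I,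
    [/\ `| `|x| `^ gamma * m - b| <= e,
        hasint (klaw K x) setT (fun y => `|y| `^ p) I &
        `|I - (`|x| `^ p + p * `|x| `^ (p - 1) * m + c * p * Jfun beta p * `|x| `^ (p - beta))|
          <= e * `|x| `^ (p - beta)].
Proof.
move=> p0 pb e0; have [N1 HN1] := Hdrift e0.
have [r0 r01 Hr] := jump_asymp R M b1 b2 ba p0 pb (ltW c0) Y0 e0.
exists (Num.max (Num.max N0 N1) r0); first by rewrite !le_max r01 !orbT.
move=> x Xx; rewrite !ge_max => /andP[/andP[xN0 xN1] xr].
have [m Hm mb] := HN1 x Xx xN1.
have [||I HI LI] := Hr (klaw K x) (inward x) (- m) (measurable_inward x) _ _ Hm _ xr.
- by move=> e' e'0 y Yy; exact: Htail.
- exact: Hmom.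
have E y : `| `|x| - inward x y| `^ p = `|y| `^ p by rewrite norm_inward.
exists m, I; split; [exact: mb|exact: eq_hasint (fun y _ => E y) HI|].
by move: LI; rewrite mulrN opprK.
Qed.

(* The part of the drift that is visible at the scale [|x|^(p - beta)]. *)
Definition beff : R := if beta - 1 < gamma then 0 else b.

(** Relative to |x|^(p - beta) the drift carries the factor |x|^(-(gamma - (beta - 1))), which tends
    to 0 above the critical gamma and is 1 at it. Cases (i) and (ii) thus share one expansion. *)
Lemma norm_moment_beff p e : beta - 1 <= gamma -> 0 < p -> p < beta -> 0 < e ->
  exists2 N, 1 <= N & forall x, X x -> N <= `|x| -> exists2 I,
    hasint (klaw K x) setT (fun y => `|y| `^ p) I &
    `|I - (`|x| `^ p + p * (beff + c * Jfun beta p) * `|x| `^ (p - beta))| <= e * `|x| `^ (p - beta).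
Proof.
move=> bg p0 pb e0.
(* The moment expansion costs e' and the drift term p e'; the cap at 1 gives the fixed bound |b| + 1
   on the scaled drift. *)
pose e' := Num.min 1 (e / (p + 1)).
have p1 : 0 < p + 1 by lra.
have e'0 : 0 < e' by rewrite lt_min ltr01 divr_gt0.
have e'1 : e' <= 1 by rewrite ge_min lexx.
have e'e : e' * (p + 1) <= e by rewrite -ler_pdivlMr// ge_min lexx orbT.
have [N N1 HN] := norm_moment p0 pb e'0.
have [N' N'1 HN'] : exists2 N', 1 <= N' & beta - 1 < gamma -> forall r, N' <= r ->
    (`|b| + 1) * r `^ (- (gamma - (beta - 1))) <= e'.
  have [bg'|bg'] := ltP (beta - 1) gamma; last by exists 1.
  have h : 0 < gamma - (beta - 1) by rewrite subr_gt0.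
  by have [r r1 Hr] := powRN_le_large (`|b| + 1) h e'0; exists r.
exists (Num.max N N'); first by rewrite le_max N1.
move=> x Xx; rewrite ge_max => /andP[xN xN'].
have [m [I [mb HI LI]]] := HN x Xx xN; exists I => //.
have x0 : 0 < `|x| by lra.
have z0 : 0 < `|x| `^ (p - beta) by exact: powR_gt0.
have g0' : 0 < `|x| `^ gamma by exact: powR_gt0.
suff h : `| `|x| `^ (p - 1) * m - beff * `|x| `^ (p - beta)| <= e' * `|x| `^ (p - beta).
  have h' := ler_wpM2l (ltW p0) h; rewrite -{1}(gtr0_norm p0) -normrM in h'.
  have h3 := ler_wpM2r (ltW z0) e'e.
  rewrite (_ : I - _ = (I - (`|x| `^ p + p * `|x| `^ (p - 1) * m + c * p * Jfun beta p * `|x| `^ (p - beta)))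
     + p * (`|x| `^ (p - 1) * m - beff * `|x| `^ (p - beta))); last by ring.
  apply: (le_trans (ler_normD _ _)); lra.
have E : `|x| `^ (p - 1) * m = `|x| `^ (p - beta) * (`|x| `^ (- (gamma - (beta - 1))) * (`|x| `^ gamma * m)).
  rewrite !mulrA -!powRD ?(gt_eqF x0) ?implybT//; congr (_ `^ _ * _); ring.
rewrite E /beff; case: ifP => bg'.
  rewrite mul0r subr0 normrM gtr0_norm// mulrC ler_wpM2r ?(ltW z0)//.
  apply: le_trans (HN' bg' _ xN'); rewrite normrM ger0_norm ?powR_ge0// mulrC.
  rewrite ler_wpM2r ?powR_ge0//.
  exact: le_trans (norm_le_add mb) (lerD (lexx _) e'1).
have -> : gamma = beta - 1 by apply/eqP; rewrite eq_le bg andbT leNgt bg'.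
rewrite subrr oppr0 powRr0 mul1r [b * _]mulrC -mulrBr normrM gtr0_norm// mulrC.
rewrite ler_wpM2r ?(ltW z0)//.
by move: mb; rewrite (_ : gamma = beta - 1)//; apply/eqP; rewrite eq_le bg andbT leNgt bg'.
Qed.

(** s < beta makes the s-th moment of inward jumps uniformly bounded, and s <= gamma + 1 makes a
    drift of order |x|^(-gamma) at most of order |x|^(-(s - 1)). *)
Lemma escape_chain s : 1 <= s -> s < beta -> s <= gamma + 1 ->
  exists2 N, 1 <= N & forall a, N <= a -> exists2 C, 0 <= C &
    forall Z, 2 * a <= Z -> forall k x, X x ->
    1 - surv K a k x <= 4 * (Num.max 0 (1 - `|x| / Z)) ^+ 2 + C * k%:R * Z `^ (- s).
Proof.
move=> s1 sb sg; have [N1 HN1] := Hdrift (@ltr01 R).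
exists (Num.max N0 N1); first by rewrite le_max N01.
move=> a; rewrite ge_max => /andP[aN0 aN1].
have c0' := c0; have N01' := N01; have b2' := b2; have ba' := ba; have b0 : 0 < beta by lra.
have s0 : 0 < s by lra.
pose Kc := Y 1 `^ beta + c + 1.
have Kc0 : 0 <= Kc by rewrite /Kc; have := powR_ge0 (Y 1) beta; lra.
(* The inward moment from [tail_moment], plus the outward one from x^s <= 1 + x^alpha. *)
pose B' := 1 + Kc * (s / (beta - s)) + (1 + `|M|).
have B'0 : 0 <= B'.
  have : 0 <= Kc * (s / (beta - s)) by rewrite mulr_ge0// divr_ge0; lra.
  by rewrite /B'; have := normr_ge0 M; lra.
have a1 : 1 <= a by lra.
have B0 : 0 <= `|b| + 1 by have := normr_ge0 b; lra.
have s2 : s <= 2 by lra.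
apply: (surv_escape mX KX a1 s1 s2 B0 B'0) => x Xx ax.
have xN0 : N0 <= `|x| by lra.
have xN1 : N1 <= `|x| by lra.
have x1 : 1 <= `|x| by lra.
have x0 : 0 < `|x| by lra.
have [m Hm mb] := HN1 x Xx xN1.
have meta := measurable_inward x.
have mE : measurable_fun setT (fun y => `|inward x y| `^ s).
  by apply: measurable_fun_powR; exact: measurableT_comp.
have tl y : 0 < y -> tail (klaw K x) (inward x) y <= Kc * y `^ (- beta).
  apply: tail_le_powR => //; first exact: ltW.
  by move=> z Yz; exact: Htail.
have [I1 HI1 L1] := tail_moment meta s0 sb tl.
have mX' : measurable_fun setT (fun y => Num.max 0 (- inward x y) `^ alpha).
  by apply: measurable_fun_powR; apply: measurable_maxr => //; exact: measurableT_comp.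
have [||A HA A0] := @hasint_ge0_lty _ _ R (klaw K x) setT _ measurableT mX'.
- by move=> w _; exact: powR_ge0.
- by apply: le_lt_trans (Hmom Xx xN0) _; exact: ltry.
have AM : A <= M by have := Hmom Xx xN0; rewrite HA.2 lee_fin.
have E1 := hasint_cst (klaw K x) 1 (@measurableT _ _); rewrite probability_setT mulr1 in E1.
have mP : measurable [set y | 0 < inward x y] by exact: measurable_gt_set.
have H1 := (hasint_patch _ _ _ mP).1 HI1.
have HU := hasintD measurableT H1 (hasintD measurableT E1 HA).
have [|S HS LS] := hasint_dom measurableT mE HU.
  move=> y _; rewrite ger0_norm ?powR_ge0//= patchE.
  have h0 := powR_ge0 (Num.max 0 (- inward x y)) alpha.
  case: ifPn => [/set_mem/= h|/negP h].
    by rewrite gtr0_norm// lerDl addr_ge0.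
  have {}h : inward x y <= 0 by rewrite leNgt; apply/negP => h'; apply: h; exact: mem_set.
  rewrite add0r ler0_norm// max_r ?oppr_ge0//.
  by apply: powR_le_1D; [rewrite oppr_ge0|exact: ltW|exact: ltW (lt_trans sb ba)].
exists (- m), S; split => //.
- rewrite normrN; have gx : 0 < `|x| `^ gamma by exact: powR_gt0.
  have mg : `|m| <= (`|b| + 1) * `|x| `^ (- gamma).
    rewrite powRN ler_pdivlMr// mulrC -{1}(gtr0_norm gx) -normrM.
    exact: norm_le_add.
  apply: (le_trans mg); rewrite ler_wpM2l//.
  by apply: ler_powR => //; lra.
- apply: (le_trans (ler_norm _)); apply: (le_trans LS).
  by rewrite /B'; have := ler_norm M; lra.
Qed.

Definition tail_small (q a x : R) := exists C kp,
  [/\ q < kp, 0 <= C & forall n, surv K a n.+1 x <= C * n.+1%:R `^ (- kp)].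

(** The exponent may equal q here, whereas [tail_small] needs one strictly above q: decay of order
    k^(-q) still gives an infinite q-th moment. *)
Definition tail_large (q a x : R) := exists k kp N,
  [/\ kp <= q, 0 < k & forall n, (N <= n)%N -> k * n.+1%:R `^ (- kp) <= surv K a n.+1 x].

Lemma tail_small_surv (s p eps q a : R) : 1 <= a -> 0 < s -> 0 < p -> 0 < eps -> q < p / s ->
  (forall x, X x -> a < `|x| -> exists2 I,
     hasint (klaw K x) setT (fun y => `|y| `^ p) I &
     I <= `|x| `^ p - eps * `|x| `^ (p - s)) ->
  forall x, X x -> tail_small q a x.
Proof.
move=> a1 s0 p0 e0 qp H x Xx.
have [D D0 HD] := surv_upper mX KX a1 s0 p0 e0 H.
exists ((D * `|x| `^ s) `^ (p / s)), (p / s); split => // [|n]; first exact: powR_ge0.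
apply: (le_trans (HD n x Xx)).
rewrite powRM ?mulr_ge0 ?powR_ge0 ?(ltW D0) ?invr_ge0//.
by rewrite -(@powR_inv1 _ n.+1%:R)// -powRrM mulN1r.
Qed.

(** For p < nu strict monotonicity of J makes beff + c J(p) negative, which gives the inequality of
    [surv_upper] with s = beta. *)
Lemma recurrence_upper nu q : beta - 1 <= gamma -> 0 < nu -> nu < beta ->
  Jfun beta nu = - (beff / c) -> 0 < q -> q < nu / beta ->
  exists a0, forall a, a0 <= a -> forall x, X x -> tail_small q a x.
Proof.
move=> bg nu0 nub Jnu q0; have b0 : 0 < beta by have := b1; lra.
(* Strictly between q beta, so that q < p / beta, and nu, so that the drift is negative. *)
rewrite ltr_pdivlMr// => qnu; pose p := (q * beta + nu) / 2.
have qb0 : 0 < q * beta by exact: mulr_gt0.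
have p0 : 0 < p by rewrite /p; lra.
have pnu : p < nu by rewrite /p; lra.
have pb : p < beta by lra.
have qp : q < p / beta by rewrite ltr_pdivlMr// /p; lra.
pose de := - (beff + c * Jfun beta p).
have de0 : 0 < de.
  have := Jfun_lt b1 b2 p0 pnu nub; rewrite Jnu -(ltr_pM2l c0).
  rewrite mulrN [c * (_ / _)]mulrC divfK ?gt_eqF// /de; lra.
have e0 : 0 < p * de / 2 by rewrite divr_gt0// mulr_gt0.
have [N N1 HN] := norm_moment_beff bg p0 pb e0.
exists N => a aN; apply: (tail_small_surv _ b0 p0 e0 qp); first exact: le_trans aN.
move=> x Xx ax; have [I HI LI] := HN x Xx (le_trans aN (ltW ax)).
exists I => //; move: LI; rewrite ler_norml /de => /andP[_].
by move: (`|x| `^ _) (`|x| `^ _) => u v; lra.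
Qed.

(** With s = gamma + 1 < beta the drift term |x|^(p - s) dominates the jump term |x|^(p - beta), so
    every p < beta is allowed. *)
Lemma drift_upper q : gamma < beta - 1 -> b < 0 -> 0 < q -> q < beta / (gamma + 1) ->
  exists a0, forall a, a0 <= a -> forall x, X x -> tail_small q a x.
Proof.
move=> bg bneg q0; pose s := gamma + 1; rewrite -/s.
have s0 : 0 < s by rewrite /s; have := g0; lra.
have b0 : 0 < beta by have := b1; lra.
rewrite ltr_pdivlMr// => qs; pose p := (q * s + beta) / 2.
have qs0 : 0 < q * s by exact: mulr_gt0.
have p0 : 0 < p by rewrite /p; lra.
have pb : p < beta by rewrite /p; lra.
have qp : q < p / s by rewrite ltr_pdivlMr// /p; lra.
have e0 : 0 < - b / 2 by lra.
have [N N1 HN] := norm_moment p0 pb e0.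
(* The scaled drift is at most b / 2, contributing p b / 2; the jump terms may use half of that. *)
have eps0 : 0 < - (p * b) / 4.
  by rewrite divr_gt0// -mulrN mulr_gt0// oppr_gt0.
have bs : 0 < beta - s by rewrite /s; lra.
have [r r1 Hr] := powRN_le_large (c * p * Jfun beta p + - b / 2) bs eps0.
exists (Num.max N r) => a; rewrite ge_max => /andP[aN ar].
have a1 : 1 <= a by lra.
apply: (tail_small_surv a1 s0 p0 eps0 qp) => x Xx ax.
have [m [I [mb HI LI]]] := HN x Xx (le_trans aN (ltW ax)).
exists I => //.
have x0 : 0 < `|x| by lra.
have E1 : `|x| `^ (p - 1) * m = `|x| `^ (p - s) * (`|x| `^ gamma * m).
  by rewrite mulrA -powRD ?(gt_eqF x0) ?implybT//; congr (_ `^ _ * _); rewrite /s; ring.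
have E2 : `|x| `^ (p - beta) = `|x| `^ (p - s) * `|x| `^ (- (beta - s)).
  by rewrite -powRD ?(gt_eqF x0) ?implybT//; congr (_ `^ _); ring.
move: LI; rewrite E2 -[p * _ * m]mulrA E1 ler_norml => /andP[_ LI].
have h1 := Hr _ (le_trans ar (ltW ax)).
move: mb; rewrite ler_norml => /andP[_ mb].
have z0 : 0 < `|x| `^ (p - s) by exact: powR_gt0.
have h2 := ler_wpM2l (ltW z0) h1.
have h3 : p * (`|x| `^ (p - s) * (`|x| `^ gamma * m)) <= p * (`|x| `^ (p - s) * (b / 2)).
  by rewrite !ler_wpM2l ?(ltW z0) ?(ltW p0)//; lra.
move: (`|x| `^ p) (`|x| `^ (p - s)) (`|x| `^ (- _)) (`|x| `^ gamma * m) (Jfun beta p) LI h2 h3 => u v w t J LI h2 h3.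
by lra.
Qed.

Lemma recurrence_lower nu q : beta - 1 <= gamma -> 0 < nu -> nu < beta ->
  Jfun beta nu = - (beff / c) -> 0 < q -> nu / beta < q ->
  exists a0, forall a, a0 <= a -> forall x, X x -> a < `|x| -> tail_large q a x.
Proof.
move=> bg nu0 nub Jnu q0; have b1' := b1; have b2' := b2; have b0 : 0 < beta by lra.
rewrite ltr_pdivrMr// => nuq.
(* Below beta for finite s-th moments, at least 1 for [surv_escape], and above nu / q so that some p
   > nu satisfies p / s <= q. *)
pose s := (Num.max 1 (nu / q) + beta) / 2.
have [s1 [sb nus]] : 1 <= s /\ s < beta /\ nu < q * s.
  have h1 : 1 <= Num.max 1 (nu / q) by rewrite le_max lexx.
  have h2 : nu / q <= Num.max 1 (nu / q) by rewrite le_max lexx orbT.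
  have h3 : Num.max 1 (nu / q) < beta by rewrite gt_max b1 ltr_pdivrMr// mulrC.
  split; first by rewrite /s; lra.
  split; first by rewrite /s; lra.
  by rewrite mulrC -ltr_pdivrMr// /s; lra.
have s0 : 0 < s by lra.
have sg : s <= gamma + 1 by lra.
pose t := Num.min (q * s) beta.
have tq : t <= q * s by rewrite ge_min lexx.
have tb : t <= beta by rewrite ge_min lexx orbT.
have nut : nu < t by rewrite lt_min nus.
pose p := (nu + t) / 2; pose p' := (p + beta) / 2.
have nup : nu < p by rewrite /p; lra.
have pt : p < t by rewrite /p; lra.
have p0 : 0 < p by lra.
have pb : p < beta by lra.
have pp' : p < p' by rewrite /p'; lra.
have p'b : p' < beta by rewrite /p'; lra.
have p'0 : 0 < p' by lra.
have [N1 N11 H1] := escape_chain s1 sb sg.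
pose de := beff + c * Jfun beta p.
have de0 : 0 < de.
  have := Jfun_lt b1 b2 nu0 nup pb; rewrite Jnu -(ltr_pM2l c0).
  rewrite mulrN [c * (_ / _)]mulrC divfK ?gt_eqF// /de; lra.
have e0 : 0 < p * de / 2 by rewrite divr_gt0// mulr_gt0.
have [N2 N21 H2] := norm_moment_beff bg p0 pb e0.
have [N3 N31 H3] := norm_moment_beff bg p'0 p'b (@ltr01 R).
pose D := `|p' * (beff + c * Jfun beta p')| + 1.
have D0 : 0 <= D by rewrite /D addr_ge0.
exists (Num.max N1 (Num.max N2 N3)) => a; rewrite !ge_max => /and3P[aN1 aN2 aN3].
have a1 : 1 <= a by exact: le_trans N11 aN1.
have [C C0 HC] := H1 a aN1.
have [x Xx ax|del [Z0 [del0 Z00 HZ]]] := surv_lower (b := beta) mX KX a1 C0 HC p0 pp' e0 D0.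
  have [I HI LI] := H2 x Xx (le_trans aN2 (ltW ax)).
  have [I' HI' LI'] := H3 x Xx (le_trans aN3 (ltW ax)).
  exists I, I'; split => //.
    exact: affine_lower.
  by apply: affine_upper LI'; exact: powR_ge0.
move=> x Xx ax.
pose k := `|x| `^ p - a `^ p.
have k0 : 0 < k by rewrite subr_gt0; apply: gt0_ltr_powR; rewrite ?nnegrE// (le_trans ler01 a1).
(* With x fixed, the p' term is of smaller order in Z and eventually costs at most half of k
   Z^(-p). *)
have [||Z1 Z11 HZ1] := @powRN_le_large _ (`|x| `^ p') (k / 2) (p' - p).
- by rewrite subr_gt0.
- by rewrite divr_gt0.
have k4 : 0 < k / 4 by rewrite divr_gt0.
have H4 Z : Num.max Z0 Z1 <= Z -> forall n, n%:R <= del * Z `^ s -> k / 4 * Z `^ (- p) <= surv K a n x.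
  rewrite ge_max => /andP[ZZ0 ZZ1] n nZ; apply: le_trans (HZ Z ZZ0 n x Xx nZ).
  have Zp : 0 < Z by exact: lt_le_trans ZZ0.
  have zp : 0 < Z `^ (- p) by exact: powR_gt0.
  have -> : - p' = - (p' - p) + - p by ring.
  rewrite powRD ?(gt_eqF Zp) ?implybT//.
  have h := ler_wpM2r (ltW zp) (HZ1 Z ZZ1).
  by rewrite -/k mulrA; exact: quarter_le.
have [k' k'0 [N HN]] := tail_of_scale s0 k4 del0 (ltW p0) H4.
exists k', (p / s), N; split => //.
by rewrite ler_pdivrMr// (le_trans (ltW pt)).
Qed.

(** An inward jump longer than Z + |x| overshoots the origin and lands beyond distance Z, from where
    the chain stays out for a time of order Z^s with probability at least 1/2. *)
Lemma drift_lower q : gamma < beta - 1 -> 0 < q -> beta / (gamma + 1) <= q ->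
  exists a0, forall a, a0 <= a -> forall x, X x -> a < `|x| -> tail_large q a x.
Proof.
move=> bg q0; pose s := gamma + 1; rewrite -/s => qs.
have g0' := g0; have b1' := b1; have s1 : 1 <= s by rewrite /s; lra.
have s0 : 0 < s by lra.
have sb : s < beta by rewrite /s; lra.
have [N1 N11 H1] := escape_chain s1 sb (lexx _).
have b0 : 0 <= beta by lra.
exists (Num.max N1 N0) => a; rewrite ge_max => /andP[aN1 aN0].
have a1 : 1 <= a by lra.
have [C C0 HC] := H1 a aN1.
have [del del0 Hdel] := escape_half (K := K) a1 C0 HC.
move=> x Xx ax; have c2 : 0 < c / 2 by rewrite divr_gt0.
(* Half of c from the tail limit, 1/2 from the escape, and 2^(-beta) from Z + |x| <= 2 Z. *)
pose k := c / 4 * 2 `^ (- beta).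
have k0 : 0 < k by rewrite mulr_gt0 ?powR_gt0// divr_gt0.
pose Z0 := Num.max (Num.max `|x| (2 * a)) (Y (c / 2)).
have H2 Z : Z0 <= Z -> k * Z `^ (- beta) <= tail (klaw K x) (inward x) (Z + `|x|) / 2.
  rewrite !ge_max => /andP[/andP[xZ aZ] YZ].
  have Z00 : 0 < Z by lra.
  have y0 : 0 < Z + `|x| by have := normr_ge0 x; lra.
  have Yy : Y (c / 2) < Z + `|x| by lra.
  have := Htail c2 Yy Xx (le_trans aN0 (ltW ax)); rewrite ler_norml => /andP[h _].
  have yb : 0 < (Z + `|x|) `^ beta by exact: powR_gt0.
  have h2 : c / 2 * (Z + `|x|) `^ (- beta) <= tail (klaw K x) (inward x) (Z + `|x|).
    by rewrite powRN ler_pdivrMr// mulrC; lra.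
  have h3 : 2 `^ (- beta) * Z `^ (- beta) <= (Z + `|x|) `^ (- beta).
    rewrite -powRM ?(ltW Z00)// !powRN lef_pV2 ?posrE ?powR_gt0 ?mulr_gt0//.
    by apply: ge0_ler_powR; rewrite ?nnegrE ?(ltW y0) ?mulr_ge0 ?(ltW Z00)//; lra.
  have := ler_wpM2l (ltW c2) h3; rewrite /k; lra.
have H3 Z : Z0 <= Z -> forall n, n%:R <= del * Z `^ s -> k * Z `^ (- beta) <= surv K a n x.
  move=> ZZ [|n] nZ; apply: (le_trans (H2 Z ZZ)).
    rewrite surv0; have := @tail_le1 _ _ _ (klaw K x) (inward x) (Z + `|x|) (measurable_inward x).
    by lra.
  have mE := measurable_gt_set (Z + `|x|) (measurable_inward x).
  have HE := (hasint_patch _ _ _ mE).1 (hasint_cst (klaw K x) 2^-1 mE).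
  rewrite mulrC; apply: (hasint_le_klaw mX KX Xx HE (hasint_surv K n ax)) => y Xy.
  rewrite patchE; case: ifPn => [/set_mem/= h|_]; last exact: surv_ge0.
  move: ZZ; rewrite !ge_max => /andP[/andP[xZ aZ] YZ].
  have := Hdel Z n y aZ Xy; rewrite div1r; apply.
    by rewrite -(norm_inward x y); have := ler_norm (inward x y - `|x|); rewrite distrC; lra.
  by apply: le_trans nZ; rewrite ler_nat.
have [k' k'0 [N HN]] := tail_of_scale s0 k0 del0 b0 H3.
by exists k', (beta / s), N.
Qed.

End Asymptotics.

(** * The assumptions on the chain restated for its kernel *)

Section KernelConditions.
Context (R : realType) d (Om : measurableType d) (X : set R) (K : R.-pker R ~> R)
  (P : R -> probability Om R) (xi : nat -> Om -> R).
Hypothesis HM : is_markov_chain X K P xi.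
Variables (alpha beta c gamma b : R).

Lemma kernel_tail (x y : R) (f : R -> R) : X x -> 0 <= y -> measurable_fun setT f ->
  (forall z, inward x z = f (z - x)) ->
  P x [set w | y < Num.max 0 (f (xi 1%N w - xi 0%N w))] = (tail (klaw K x) (inward x) y)%:E.
Proof.
move=> Xx y0 mf Ef.
have mB : measurable [set t : R | y < Num.max 0 (f t)].
  by apply: (@measurable_gt_set _ _ _ (fun t : R => Num.max 0 (f t))); exact: measurable_maxr.
rewrite (prob_increment HM Xx mB) /tail.
have -> : [set z | [set t | y < Num.max 0 (f t)] (z - x)] = [set w | y < inward x w].
  by apply/seteqP; split => z /=; rewrite Ef lt_max (ltNge y 0) y0.
rewrite fineK// fin_num_measure//.
by apply: measurable_gt_set; exact: measurable_inward.
Qed.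

Lemma kernel_moment (x a : R) (f : R -> R) : X x -> measurable_fun setT f ->
  (forall z, - inward x z = f (z - x)) ->
  (\int[P x]_w ((Num.max 0 (f (xi 1%N w - xi 0%N w))) `^ a)%:E =
   \int[klaw K x]_z ((Num.max 0 (- inward x z)) `^ a)%:E)%E.
Proof.
move=> Xx mf Ef; under [RHS]eq_integral do rewrite Ef.
apply: (@integral_increment _ _ _ _ _ _ _ HM x Xx (fun t => ((Num.max 0 (f t)) `^ a)%:E)).
  apply/measurable_EFinP; apply: measurable_fun_powR; exact: measurable_maxr.
by move=> t; rewrite lee_fin powR_ge0.
Qed.

Hypothesis HT : cond_Tin X P xi alpha beta c.
Hypothesis HD : cond_Dprime X P xi gamma b.

Lemma kernel_conditions : exists N0 M (Y : R -> R), [/\ 1 <= N0, forall e, 0 <= Y e,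
  forall e, 0 < e -> forall y, Y e < y -> forall x, X x -> N0 <= `|x| ->
    `|y `^ beta * tail (klaw K x) (inward x) y - c| <= e,
  forall x, X x -> N0 <= `|x| ->
    (\int[klaw K x]_y ((Num.max 0 (- inward x y)) `^ alpha)%:E <= M%:E)%E &
  forall e, 0 < e -> exists N, forall x, X x -> N <= `|x| ->
    exists2 m, hasint (klaw K x) setT (inward x) (- m) & `| `|x| `^ gamma * m - b| <= e].
Proof.
case: HT => _ [_ [_ [_ [x0 [x00 [H1 [H2 [[M1 H3] [M2 H4]]]]]]]]].
case: HD => _ [H5 H6].
have mN : measurable_fun setT (fun t : R => - t) by exact: measurableT_comp.
have pos (x : R) : 0 < x -> (forall z, inward x z = - (z - x)).
  by move=> xp z; rewrite /inward xp opprB.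
have neg (x : R) : x <= 0 -> (forall z, inward x z = z - x).
  by move=> xp z; rewrite /inward ltNge xp.
have /choice[Y HY] e : exists Y, 0 <= Y /\ (0 < e -> forall y, Y < y -> forall x, X x ->
    Num.max 1 x0 <= `|x| -> `|y `^ beta * tail (klaw K x) (inward x) y - c| <= e).
  have [e0|e0] := ltP 0 e; last by exists 0; split => //; rewrite ltNge e0.
  have [Y1 HY1] := H1 e e0; have [Y2 HY2] := H2 e e0.
  (* With Y >= 0 the level y is positive, and then y < max 0 t is the same as y < t. *)
  exists (Num.max 0 (Num.max Y1 Y2)); split; first by rewrite le_max lexx.
  move=> _ y; rewrite !gt_max => /and3P[y0 y1 y2] x Xx; rewrite ge_max => /andP[x1 xx0].
  have [xp|xn] := ltP 0 x.
    have := HY1 y y1 x Xx; rewrite (gtr0_norm xp) in xx0.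
    rewrite (kernel_tail Xx (ltW y0) mN (pos x xp)) -EFinM -EFinB /= lee_fin.
    by apply.
  have := HY2 y y2 x Xx; rewrite (ler0_norm xn) in xx0.
  rewrite (@kernel_tail x y id Xx (ltW y0) _ (neg x xn))// -EFinM -EFinB /= lee_fin.
  by apply; lra.
exists (Num.max 1 x0), (Num.max M1 M2), Y; split.
- by rewrite le_max lexx.
- by move=> e; have [] := HY e.
- by move=> e e0 y Yy x Xx xx; have [_ /(_ e0)] := HY e; apply.
- move=> x Xx; rewrite ge_max => /andP[x1 xx0]; rewrite EFin_max.
  have [xp|xn] := ltP 0 x.
    rewrite (gtr0_norm xp) in xx0; rewrite le_max; apply/orP; left.
    rewrite -(@kernel_moment x alpha id Xx)//; first exact: H3.
    by move=> z; rewrite pos// opprK.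
  rewrite (ler0_norm xn) in xx0; rewrite le_max; apply/orP; right.
  rewrite -(@kernel_moment x alpha -%R Xx mN).
    by apply: H4 => //; lra.
  by move=> z; rewrite neg.
- move=> e e0; have [L1 HL1] := H5 e e0; have [L2 HL2] := H6 e e0.
  (* The unit margins turn the bound on |x| into the strict inequalities L1 < x and x < L2. *)
  exists (Num.max 1 (Num.max (L1 + 1) (1 - L2))) => x Xx.
  rewrite !ge_max => /and3P[x1 xL1 xL2].
  have [xp|xn] := ltP 0 x.
    rewrite (gtr0_norm xp) in xL1 *.
    have [|m [Hm hm]] := HL1 x Xx; first by lra.
    exists m; last exact: ltW.
    have := hasintZ (-1) measurableT (hasint_drift HM Xx Hm); rewrite mulN1r.
    by apply: eq_hasint => // z _; rewrite mulN1r pos.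
  have [|m [Hm hm]] := HL2 x Xx; first by rewrite (ler0_norm xn) in xL2; lra.
  exists (- m); last by rewrite mulrN ltW.
  rewrite opprK; apply: eq_hasint (hasint_drift HM Xx Hm) => // z _.
  by rewrite neg.
Qed.

Lemma moment_tau_lty (a q x : R) : X x -> 0 < q -> tail_small K q a x ->
  (moment_tau P xi a q x < +oo)%E.
Proof.
move=> Xx q0 [C [kp [qk C0 H]]]; have mxi : forall n, measurable_fun setT (xi n) by case: HM => _ [_ []].
apply: (moment_lty mxi q0 qk C0) => n; rewrite (avoid_surv HM Xx); exact: H.
Qed.

Lemma moment_tau_eqy (a q x : R) : X x -> 0 < q -> tail_large K q a x ->
  moment_tau P xi a q x = +oo%E.
Proof.
move=> Xx q0 [k [kp [N [kq k0 H]]]]; have mxi : forall n, measurable_fun setT (xi n) by case: HM => _ [_ []].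
apply: (moment_eqy mxi q0 kq k0 (N := N)) => n Nn; rewrite (avoid_surv HM Xx); exact: H.
Qed.

End KernelConditions.

(** * Assembly of the three cases *)

Lemma eventually_imply (R : realType) (A : Prop) (Q : R -> Prop) :
  (A -> exists a0, forall a, a0 <= a -> Q a) -> exists a0, forall a, a0 <= a -> A -> Q a.
Proof.
(* The theorem asks for one threshold before the cases are distinguished; deciding [A] classically
   supplies it, since any threshold serves when [A] fails. *)
move=> H; have [/H[a0 Ha]|nA] := pselect A; first by exists a0 => a aa _; exact: Ha.
by exists 0.
Qed.

Theorem theorem2p6 (R : realType) (d : measure_display) (Omega : measurableType d)
  (X : set R) (K : R.-pker R ~> R) (P : R -> probability Omega R)
  (xi : nat -> Omega -> R) (alpha beta c gamma b : R) :
  infinite_set X ->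
  (forall M : R, exists x, X x /\ M < `|x|) ->
  is_markov_chain X K P xi ->
  cond_Tin X P xi alpha beta c ->
  cond_Dprime X P xi gamma b ->
  forall q : R, 0 < q ->
  exists a0 : R, forall a : R, a0 <= a -> forall x : R, X x -> a < `|x| ->
    (* (i) *)
    ((beta - 1 < gamma /\ 1 / 2 < beta - 1) ->
       (q < (2 * beta - 3) / beta -> (moment_tau P xi a q x < +oo)%E) /\
       ((2 * beta - 3) / beta < q -> moment_tau P xi a q x = +oo%E)) /\
    (* (ii) *)
    ((gamma = beta - 1 /\ b + c * pi * (cos (pi * beta) / sin (pi * beta)) < 0) ->
       let eqn := fun nu : R => b / c = Gamma nu *
           ((1 - beta + nu) * Gamma (1 - beta) / Gamma (2 - beta + nu)
            - Gamma (beta - nu) / Gamma beta) in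
       exists nu : R, [/\ 0 < nu < beta, eqn nu,
         (forall nu' : R, 0 < nu' -> nu' < beta -> eqn nu' -> nu' = nu),
         (q < nu / beta -> (moment_tau P xi a q x < +oo)%E) &
         (nu / beta < q -> moment_tau P xi a q x = +oo%E)]) /\
    (* (iii) *)
    ((gamma < beta - 1 /\ b < 0) ->
       (q < beta / (gamma + 1) -> (moment_tau P xi a q x < +oo)%E) /\
       (beta / (gamma + 1) <= q -> moment_tau P xi a q x = +oo%E)).
Proof.
move=> _ _ HM HT HD q q0.
have mX : measurable X by case: HM.
have KX x : X x -> K x X = 1%E by case: HM => _ [h _]; exact: h.
have [N0 [M [Y [N01 Y0 Htail Hmom Hdrift]]]] := kernel_conditions HM HT HD.
have [b1 [b2 [ba [c0 _]]]] := HT; have g0 : 0 <= gamma by case: HD.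
pose fin a := forall x, X x -> a < `|x| -> (moment_tau P xi a q x < +oo)%E.
pose inf a := forall x, X x -> a < `|x| -> moment_tau P xi a q x = +oo%E.
have toF A : (A -> exists a0, forall a, a0 <= a -> forall x, X x -> tail_small K q a x) ->
    exists a0, forall a, a0 <= a -> A -> fin a.
  move=> H; apply: eventually_imply => /H[a0 Ha]; exists a0 => a aa x Xx _.
  by apply: (moment_tau_lty HM Xx q0); exact: Ha.
have toI A : (A -> exists a0, forall a, a0 <= a -> forall x, X x -> a < `|x| -> tail_large K q a x) ->
    exists a0, forall a, a0 <= a -> A -> inf a.
  move=> H; apply: eventually_imply => /H[a0 Ha]; exists a0 => a aa x Xx ax.
  by apply: (moment_tau_eqy HM Xx q0); exact: Ha.
have up nu : beta - 1 <= gamma -> 0 < nu -> nu < beta -> Jfun beta nu = - (beff beta gamma b / c) ->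
    exists a0, forall a, a0 <= a -> q < nu / beta -> fin a.
  move=> bg nu0 nub J; apply: toF => qnu.
  exact: (recurrence_upper mX KX b1 b2 ba c0 Y0 Htail Hmom Hdrift bg nu0 nub J q0 qnu).
have lo nu : beta - 1 <= gamma -> 0 < nu -> nu < beta -> Jfun beta nu = - (beff beta gamma b / c) ->
    exists a0, forall a, a0 <= a -> nu / beta < q -> inf a.
  move=> bg nu0 nub J; apply: toI => qnu.
  exact: (recurrence_lower mX KX b1 b2 ba c0 N01 Y0 Htail Hmom Hdrift bg nu0 nub J q0 qnu).
have [a1 H1] : exists a0, forall a, a0 <= a -> (beta - 1 < gamma /\ 1 / 2 < beta - 1) ->
    (q < (2 * beta - 3) / beta -> fin a) /\ ((2 * beta - 3) / beta < q -> inf a).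
  apply: eventually_imply => -[bg hb].
  (* In case (i) the effective drift is 0, and beta > 3/2 makes the zero 2 beta - 3 of J
     positive. *)
  have J : Jfun beta (2 * beta - 3) = - (beff beta gamma b / c).
    by rewrite /beff bg mul0r oppr0 Jfun_eq0//; lra.
  have [||a1 H1] := up _ (ltW bg) _ _ J; try lra.
  have [||a2 H2] := lo _ (ltW bg) _ _ J; try lra.
  exists (Num.max a1 a2) => a; rewrite ge_max => /andP[aa1 aa2].
  by split; [exact: H1|exact: H2].
have [a2 H2] : exists a0, forall a, a0 <= a ->
    (gamma = beta - 1 /\ b + c * pi * (cos (pi * beta) / sin (pi * beta)) < 0) ->
    exists nu, [/\ 0 < nu, nu < beta, Jfun beta nu = - (b / c),
      q < nu / beta -> fin a & nu / beta < q -> inf a].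
  apply: eventually_imply => -[gb bc].
  have [|nu [nu0 nub J]] := @Jfun_root _ beta (- (b / c)) b1 b2.
    (* Division by c turns the sign condition of case (ii) into pi cot (pi beta) < - b / c, as
       [Jfun_root] requires. *)
    by rewrite -mulNr ltr_pdivlMr//; lra.
  have bg : beta - 1 <= gamma by rewrite gb.
  have J' : Jfun beta nu = - (beff beta gamma b / c) by rewrite /beff gb ltxx.
  have [a1' H1'] := up _ bg nu0 nub J'; have [a2' H2'] := lo _ bg nu0 nub J'.
  exists (Num.max a1' a2') => a; rewrite ge_max => /andP[aa1 aa2].
  by exists nu; split => //; [exact: H1'|exact: H2'].
have [a3 H3] : exists a0, forall a, a0 <= a -> (gamma < beta - 1 /\ b < 0) /\ q < beta / (gamma + 1) -> fin a.
  apply: toF => -[[gb bneg] qb].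
  exact: (drift_upper mX KX b1 b2 ba c0 g0 Y0 Htail Hmom Hdrift gb bneg q0 qb).
have [a4 H4] : exists a0, forall a, a0 <= a -> gamma < beta - 1 /\ beta / (gamma + 1) <= q -> inf a.
  apply: toI => -[gb qb].
  exact: (drift_lower mX KX b1 b2 ba c0 g0 N01 Y0 Htail Hmom Hdrift gb q0 qb).
exists (Num.max (Num.max a1 a2) (Num.max a3 a4)) => a.
rewrite !ge_max => /andP[/andP[aa1 aa2] /andP[aa3 aa4]] x Xx ax; split; last split.
- move=> /(H1 a aa1)[h1 h2]; split; first by move/h1; apply.
  by move/h2; apply.
- move=> /(H2 a aa2)[nu [nu0 nub J h1 h2]] eqn.
  have eqnE v : eqn v <-> Jfun beta v = - (b / c).
    rewrite /eqn /Jfun; split => h; last first.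
      by apply: oppr_inj; rewrite -h; ring.
    by rewrite h; ring.
  exists nu; split.
  + by rewrite nu0.
  + exact/eqnE.
  + move=> v v0 vb /eqnE Jv; have [vn|nv|//] := ltgtP v nu.
      by have := Jfun_lt b1 b2 v0 vn nub; rewrite Jv J ltxx.
    by have := Jfun_lt b1 b2 nu0 nv vb; rewrite Jv J ltxx.
  + by move/h1; apply.
  + by move/h2; apply.
- move=> gb; split=> [qb|qb]; first exact: H3.
  by apply: H4 => //; case: gb.
Qed.
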